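(* Let $1 \le p < \infty$ and $\alpha > -1$, and let $g$ be an analytic function on $D$ such that $T_g$ is bounded on $A^p_\alpha$. Then $T_g$ is bounded below on $A^p_\alpha$ if and only if there exist $c>0$ and $\delta>0$ such that, for all arcs $I \subseteq \partial D$, $$\left|\{z \in D : |g'(z)|(1-|z|^2) > c\} \cap S(I)\right| > \delta |I|^2 .$$
   Context: $D$ is the open unit disk in $\mathbb{C}$ and $H(D)$ is the set of analytic functions on $D$. For $g\in H(D)$, $T_g f(z) = \int_0^z f(w) g'(w)\, dw$. The weighted Bergman space is $A^p_\alpha = \{f \in H(D) : \|f\|_{A^p_\alpha}^p = \int_D |f(z)|^p (1-|z|^2)^\alpha dA(z) < \infty\}$, where $dA$ is Lebesgue area measure. For an arc $I\subseteq\partial D$, $|I|$ is its length and $S(I) = \{re^{i\theta} : 1-|I| < r < 1,\ e^{i\theta}\in I\}$ (with $r\ge 0$). For a measurable set $E\subseteq D$, $|E|$ is its Lebesgue area measure. Arcs are nondegenerate ($|I|>0$). An operator $T$ on a normed space is bounded below if there exists $C>0$ such that $\|Tf\| \ge C\|f\|$ for all $f$ in the space. *)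

(* Defs.v *)
From mathcomp Require Import all_boot all_order all_algebra.
From mathcomp Require Import complex.
From mathcomp Require Import all_classical all_reals all_analysis.

Set Implicit Arguments.
Unset Strict Implicit.
Unset Printing Implicit Defensive.

Import Order.TTheory GRing.Theory Num.Theory.
Import numFieldNormedType.Exports.
Import ComplexField.Normc.

Local Open Scope classical_set_scope.
Local Open Scope ring_scope.
Local Open Scope complex_scope.

Section bergman.
Variable R : realType.

(* The regular module R[i]^o carries the normed space structure of the complex
   plane over itself, so that derivatives in this type are complex
   derivatives. The norm of the library is complex-valued on R[i]; [normc] is
   the real-valued modulus. *)
Local Notation C := (R[i]^o).

Definition unit_disk : set C := [set z | normc z < 1].

(* Functions on the disk are represented by total functions on the plane: all
   the notions below only depend on the values taken in the disk. *)
Definition analytic_on_disk (f : C -> C) : Prop :=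
  forall z, unit_disk z -> derivable f z 1.

Definition cintegral01 (h : R -> C) : C :=
  (\int[lebesgue_measure]_(t in `[0%R, 1%R]) complex.Re (h t)) +i*
  (\int[lebesgue_measure]_(t in `[0%R, 1%R]) complex.Im (h t)).

(* The integral of f(w) g'(w) dw from 0 to z, along the segment w = t z; for f
   and g analytic on the disk it does not depend on the path. *)
Definition T_ (g f : C -> C) : C -> C := fun z =>
  cintegral01 (fun t => f (t%:C * z) * g^`()%classic (t%:C * z) * z).

(* Area measure on the plane, in the coordinates (x, y) of x + iy. *)
Local Notation dA := (@lebesgue_measure R \x @lebesgue_measure R)%E.

Definition area : set (R * R) -> \bar R := dA.

Definition coords (E : set C) : set (R * R) := [set u | E (u.1 +i* u.2)].

Definition bergman_norm (p alpha : R) (f : C -> C) : \bar R :=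
  ((\int[dA]_(u in coords unit_disk)
     (normc (f (u.1 +i* u.2)) `^ p *
      (1 - normc (u.1 +i* u.2) ^+ 2) `^ alpha)%:E) `^ p^-1)%E.

Definition bergman_space (p alpha : R) : set (C -> C) :=
  [set f | analytic_on_disk f /\ (bergman_norm p alpha f < +oo)%E].

Definition bounded_operator (X : set (C -> C)) (N : (C -> C) -> \bar R)
    (T : (C -> C) -> (C -> C)) : Prop :=
  (forall f, X f -> X (T f)) /\
  exists M : R, forall f, X f -> (N (T f) <= M%:E * N f)%E.

Definition bounded_below (X : set (C -> C)) (N : (C -> C) -> \bar R)
    (T : (C -> C) -> (C -> C)) : Prop :=
  exists2 K : R, 0 < K & forall f, X f -> (K%:E * N f <= N (T f))%E.

(* [is_arc I l]: I is a nondegenerate arc of the unit circle, of length l. The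
   endpoints may be included or not, and I may be the whole circle. *)
Definition is_arc (I : set C) (l : R) : Prop :=
  exists (b1 b2 : bool) (s t : R),
    [/\ s < t, t <= s + 2 * pi, l = t - s &
        I = [set cos x +i* sin x | x in
               [set` Interval (BSide b1 s) (BSide b2 t)]]].

(* The Carleson box over the arc I of length l. *)
Definition carleson_box (I : set C) (l : R) : set C :=
  [set z | exists (r : R) (zeta : C), [/\ 0 <= r, 1 - l < r, r < 1, I zeta &
                              z = r%:C * zeta]].

End bergman.

(* Main.v *)
Require Import Defs.
From HB Require Import structures.
From mathcomp Require Import all_boot all_order all_algebra.
From mathcomp Require Import complex.
From mathcomp Require Import all_classical all_reals all_analysis.
From mathcomp Require Import measurable_realfun.
From mathcomp Require Import ring lra.
Import Order.TTheory GRing.Theory Num.Theory.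
Import numFieldNormedType.Exports.
Import ComplexField.Normc.
Local Open Scope classical_set_scope.
Local Open Scope ring_scope.
Set Implicit Arguments.
Unset Strict Implicit.
Unset Printing Implicit Defensive.

(** Write F = T_g f, so that F' = f g' on the disk, and let dA_alpha be area measure with the
    weight (1 - |z|^2)^alpha. The weight is essentially constant on each disc of radius
    rho (1 - |a|) about a, for rho < 1, and all estimates take place on such discs or on boxes.

    Sufficiency. In a Carleson box of size l the collar 1 - |z| < eps l has area O(eps l^2), so
    if the set G where |g'| (1 - |z|^2) > c fills a fixed part of every box, then it fills a fixed
    part of every disc of radius rho (1 - |a|) about a, for some rho < 1 ([discs_of_boxes]). By a
    theorem of Luecking, such a relatively dense set carries a fixed part of the Bergman norm
    ([dense_sets_norm]): apart from points a that carry little of the norm, |f(a)|^p is not small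
    against its mean over the disc about a, and then subharmonicity of log |f| shows that f is
    small against f(a) only on a small part of that disc ([small_values], [dense_point]). Hence
    the norm of f is controlled by the integral over G of |f|^p, there by that of
    (|f g'| (1 - |z|))^p, and this is at most a constant times the norm of F to the power p by
    Cauchy's estimate ([derivative_norm]).

    Necessity. Boundedness of T_g gives |g'| (1 - |z|) <= B ([bloch_bound]). Conversely to
    Cauchy's estimate, Hardy's inequality along radii bounds the norm of F by the integral of
    (|f g'| (1 - |z|))^p, up to the values of f g' on a smaller disk ([hardy_area],
    [area_norm_estimate]). Apply this to powers of the Cauchy kernel at a point a, whose norm is
    concentrated in a box of size h = 1 - |a| at a / |a|. The points where g' is small, the points
    far from a / |a| and those in a thin collar contribute little, so the rest of G in the box
    must have area at least a constant times h^2 ([big_part_area]).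

    The analytic tools are derived from the definition of the complex derivative: the mean value
    property comes from Goursat's bisection in logarithmic polar coordinates ([mean_value_Re]),
    and it yields Cauchy's estimates in integral form, continuity of the derivative, and
    Jensen's inequality for log |F| ([log_circle_mean]). The estimates of integrals with
    singular powers all sum geometric series over dyadic layers ([integral_dyadic_sum]). *)

Lemma le_of_eq d (T : porderType d) (x y : T) : x = y -> (x <= y)%O.
Proof. by move=> ->. Qed.

(** * Integrals of continuous functions over segments *)

Section interval_integrals.
Variable R : realType.
Notation mu := (@lebesgue_measure R).
Implicit Types (f g : R -> R) (a b : R).

Lemma continuous_eps f x :
  (forall e, 0 < e -> exists2 d, 0 < d & forall s, `|s| < d ->
     `|f (x + s) - f x| <= e) -> {for x, continuous f}.
Proof.
move=> H; apply/cvgrPdist_le => e /H[d d0 Hd].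
apply/nbhs_ballP; exists d => //= z.
by rewrite /ball /= distrC => /Hd; rewrite subrKC distrC.
Qed.

Definition cont_on a b f := forall x, a <= x <= b -> {for x, continuous f}.

Definition Iab a b f : R := \int[mu]_(x in `[a, b]) f x.

Lemma cont_on_integrable a b f : cont_on a b f ->
  mu.-integrable `[a, b] (EFin \o f).
Proof.
move=> cf; apply: continuous_compact_integrable; first exact: segment_compact.
apply: continuous_in_subspaceT => x.
by rewrite inE /= in_itv /=; apply: cf.
Qed.

Lemma cont_onS a b c d f : a <= c -> d <= b -> cont_on a b f -> cont_on c d f.
Proof.
move=> ac db cf x /andP[cx xd]; apply: cf.
by rewrite (le_trans ac cx) (le_trans xd db).
Qed.

Lemma IabB a b f g : cont_on a b f -> cont_on a b g ->
  Iab a b (fun x => f x - g x) = Iab a b f - Iab a b g.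
Proof.
move=> cf cg; rewrite /Iab RintegralB //; exact: cont_on_integrable.
Qed.

Lemma Iab_split a b c f : a <= b -> b <= c -> cont_on a c f ->
  Iab a c f = Iab a b f + Iab b c f.
Proof.
move=> ab bc cf; have H := @Rintegral_itvB _ f (BLeft a) (BRight c) b
  (cont_on_integrable cf).
rewrite -[LHS](subrK (Iab a b f)) /Iab H ?bnd_simp //.
rewrite addrC Rintegral_itv_obnd_cbnd //.
apply: integrableS (cont_on_integrable cf) => //.
by apply: subset_itv; rewrite bnd_simp.
Qed.

Lemma Iab_cst a b (k : R) : a <= b -> Iab a b (fun=> k) = k * (b - a).
Proof.
move=> ab; rewrite /Iab Rintegral_cst //= lebesgue_measure_itv /= lte_fin.
by case: ltP => // ba; rewrite (le_anti (introT andP (conj ab ba))) subrr mulr0.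
Qed.

Lemma Iab_le a b f g : cont_on a b f -> cont_on a b g ->
  (forall x, a <= x <= b -> f x <= g x) -> Iab a b f <= Iab a b g.
Proof.
move=> cf cg fg; apply: le_Rintegral => //; try exact: cont_on_integrable.
Qed.

Lemma Iab_approx a b f (k e : R) : a <= b -> cont_on a b f ->
  (forall x, a <= x <= b -> `|f x - k| <= e) ->
  `|Iab a b f - k * (b - a)| <= e * (b - a).
Proof.
move=> ab cf fk.
have cc (c : R) : cont_on a b (fun=> c) by move=> x _; exact: cst_continuous.
rewrite ler_norml lerBrDr -mulNr -mulrDl lerBlDr -mulrDl.
rewrite -!Iab_cst //; apply/andP; split; apply: Iab_le => // x /fk.
  by rewrite ler_norml => /andP[]; lra.
by rewrite ler_norml => /andP[]; lra.
Qed.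

Lemma eq_Iab a b f g : (forall x, a <= x <= b -> f x = g x) ->
  Iab a b f = Iab a b g.
Proof.
by move=> fg; apply: eq_Rintegral => x; rewrite inE /= in_itv /=; apply: fg.
Qed.

End interval_integrals.

(** * Goursat's lemma for closed differential forms *)

Section goursat.
Variable R : realType.
Variables P Q : R -> R -> R.

(** First-order expansions of P and Q with equal cross coefficients: the form P dx + Q dy is
    closed in the pointwise sense of Goursat's lemma. *)
Definition closed_form_at (x y : R) := exists p q r : R,
  forall eta : R, 0 < eta -> exists2 d : R, 0 < d &
  forall s t : R, `|s| < d -> `|t| < d ->
   `|P (x + s) (y + t) - P x y - (p * s + q * t)| <= eta * (`|s| + `|t|) /\
   `|Q (x + s) (y + t) - Q x y - (q * s + r * t)| <= eta * (`|s| + `|t|).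

Variables a0 b0 c0 d0 : R.
Hypothesis closedPQ : forall x y, a0 <= x <= b0 -> c0 <= y <= d0 ->
  closed_form_at x y.

(** The integral of P dx + Q dy around a rectangle; opposite sides are paired so that only
    integrals over increasing segments occur. *)
Definition circulation (a c w h : R) :=
  Iab a (a + w) (fun x => P x c - P x (c + h)) +
  Iab c (c + h) (fun y => Q (a + w) y - Q a y).

Lemma closed_form_contP x y : a0 <= x <= b0 -> c0 <= y <= d0 ->
  {for x, continuous (P ^~ y)} /\ {for y, continuous (Q x)}.
Proof.
move=> xab ycd; have [p [q [r H]]] := closedPQ xab ycd.
have [d d0' Hd] := H 1 ltr01.
split; apply: continuous_eps => e e0.
- have M0 : 0 < `|p| + 2 by rewrite ltr_wpDl.
  exists (Num.min d (e / (`|p| + 2))); first by rewrite lt_min d0' divr_gt0.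
  move=> s; rewrite lt_min ltr_pdivlMr // => /andP[sd se].
  have [] := Hd s 0 sd; rewrite ?normr0 //.
  rewrite addr0 mulr0 !addr0 mul1r => + _.
  have := normrM p s; have := ler_norm (p * s); have := ler_norm (- (p * s)).
  rewrite normrN ler_norml => H1 H2 H3 /andP[H4 H5].
  rewrite ler_norml; have := normr_ge0 s; nra.
- have M0 : 0 < `|r| + 2 by rewrite ltr_wpDl.
  exists (Num.min d (e / (`|r| + 2))); first by rewrite lt_min d0' divr_gt0.
  move=> s; rewrite lt_min ltr_pdivlMr // => /andP[sd se].
  have [] := Hd 0 s; rewrite ?normr0 //.
  rewrite addr0 mulr0 !add0r mul1r => _.
  have := normrM r s; have := ler_norm (r * s); have := ler_norm (- (r * s)).
  rewrite normrN ler_norml => H1 H2 H3 /andP[H4 H5].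
  rewrite ler_norml; have := normr_ge0 s; nra.
Qed.

Definition inrect a c w h := [/\ 0 <= w, 0 <= h, a0 <= a, a + w <= b0 &
  c0 <= c /\ c + h <= d0].

Lemma contP a c w h y : inrect a c w h -> c0 <= y <= d0 ->
  cont_on a (a + w) (P ^~ y).
Proof.
move=> [w0 h0 ? ? [? ?]] ycd x /andP[? ?].
by apply: (closed_form_contP _ ycd).1; apply/andP; split; lra.
Qed.

Lemma contQ a c w h x : inrect a c w h -> a0 <= x <= b0 ->
  cont_on c (c + h) (Q x).
Proof.
move=> [w0 h0 ? ? [? ?]] ycd y /andP[? ?].
by apply: (closed_form_contP ycd _).2; apply/andP; split; lra.
Qed.

Lemma circulation_split a c w h : inrect a c (w + w) (h + h) ->
  circulation a c (w + w) (h + h) =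
  circulation a c w h + circulation (a + w) c w h +
  circulation a (c + h) w h + circulation (a + w) (c + h) w h.
Proof.
move=> H; have [w0 h0 ? ? [? ?]] := H.
have [w0' h0'] : 0 <= w /\ 0 <= h by split; lra.
have y1 : c0 <= c <= d0 by lra.
have y2 : c0 <= c + h <= d0 by lra.
have y3 : c0 <= c + (h + h) <= d0 by lra.
have x1 : a0 <= a <= b0 by lra.
have x2 : a0 <= a + w <= b0 by lra.
have x3 : a0 <= a + (w + w) <= b0 by lra.
rewrite /circulation -!addrA.
have cP l r y : a <= l -> r <= a + (w + w) -> c0 <= y <= d0 ->
    cont_on l r (P ^~ y).
  by move=> al ra yc; exact: cont_onS al ra (contP H yc).
have cQ l r x : c <= l -> r <= c + (h + h) -> a0 <= x <= b0 ->
    cont_on l r (Q x).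
  by move=> al ra yc; exact: cont_onS al ra (contQ H yc).
have ? : a <= a + w <= a + (w + w) by lra.
have ? : c <= c + h <= c + (h + h) by lra.
rewrite !IabB; try by [apply: cP => //; lra|apply: cQ => //; lra].
have PE y : c0 <= y <= d0 -> Iab a (a + (w + w)) (P ^~ y) =
   Iab a (a + w) (P ^~ y) + Iab (a + w) (a + (w + w)) (P ^~ y).
  by move=> ycd; apply: Iab_split; [lra|lra|exact: cP].
have QE x : a0 <= x <= b0 -> Iab c (c + (h + h)) (Q x) =
   Iab c (c + h) (Q x) + Iab (c + h) (c + (h + h)) (Q x).
  by move=> ycd; apply: Iab_split; [lra|lra|exact: cQ].
rewrite !PE // !QE //; ring.
Qed.

(** A closed form with constant coefficients plus a linear part has no circulation, so only the
    error terms of the expansion contribute. *)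
Lemma circulation_small x y (e : R) : a0 <= x <= b0 -> c0 <= y <= d0 -> 0 < e ->
  exists2 d, 0 < d & forall a c w h, inrect a c w h -> w + h < d ->
    a <= x <= a + w -> c <= y <= c + h ->
    `|circulation a c w h| <= e * (w + h) ^+ 2.
Proof.
move=> xab ycd e0; have [p [q [r H]]] := closedPQ xab ycd.
have [|d dp Hd] := H (e / 2); first by rewrite divr_gt0.
exists d => // a c w h R1 whd xa yc; have [w0 h0 ? ? [? ?]] := R1.
have E x' y' : a <= x' <= a + w -> c <= y' <= c + h ->
    `|P x' y' - P x y - (p * (x' - x) + q * (y' - y))| <= e / 2 * (w + h) /\
    `|Q x' y' - Q x y - (q * (x' - x) + r * (y' - y))| <= e / 2 * (w + h).
  move=> x'a y'c.
  have xw : `|x' - x| <= w by rewrite ler_norml; lra.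
  have yh : `|y' - y| <= h by rewrite ler_norml; lra.
  have [||A B] := Hd (x' - x) (y' - y); [lra|lra|].
  move: A B; rewrite !subrKC => A B.
  by split; [apply: le_trans A _|apply: le_trans B _];
    apply: ler_wpM2l; lra.
have A1 : `|Iab a (a + w) (fun x => P x c - P x (c + h)) - (- (q * h)) * (a + w - a)|
    <= e * (w + h) * (a + w - a).
  apply: Iab_approx; first lra.
    move=> z za; apply: cvgB; apply: (contP R1) => //; lra.
  move=> z za; have [|H1 _] := E z c za; first lra.
  have [|H2 _] := E z (c + h) za; first lra.
  move: H1 H2; rewrite !ler_norml; lra.
have A2 : `|Iab c (c + h) (fun y => Q (a + w) y - Q a y) - (q * w) * (c + h - c)|
    <= e * (w + h) * (c + h - c).
  apply: Iab_approx; first lra.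
    move=> z za; apply: cvgB; apply: (contQ R1) => //; lra.
  move=> z za; have [|_ H1] := E a z _ za; first lra.
  have [|_ H2] := E (a + w) z _ za; first lra.
  move: H1 H2; rewrite !ler_norml; lra.
move: A1 A2; rewrite /circulation.
have -> : a + w - a = w by ring.
have -> : c + h - c = h by ring.
set X := Iab _ _ _; set Y := Iab _ _ _.
rewrite !ler_norml => /andP[A1 A1'] /andP[A2 A2'].
rewrite expr2; apply/andP; split; lra.
Qed.

Lemma dyadic_limit (a : nat -> R) (w : R) : 0 <= w ->
  (forall n, a n <= a n.+1 /\ a n.+1 + w / 2 ^+ n.+1 <= a n + w / 2 ^+ n) ->
  exists x, forall n, a n <= x <= a n + w / 2 ^+ n.
Proof.
move=> w0 H.
have mon m n : (m <= n)%N -> a m <= a n.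
  by move: m n; apply/nondecreasing_seqP => i; have [] := H i.
have dec m n : (m <= n)%N -> a n + w / 2 ^+ n <= a m + w / 2 ^+ m.
  by move: m n; apply/nonincreasing_seqP => i; have [] := H i.
have ub m n : a m <= a n + w / 2 ^+ n.
  have [mn|/ltnW nm] := leqP m n.
    by rewrite (le_trans (mon _ _ mn))// lerDl divr_ge0// exprn_ge0.
  by apply: le_trans (dec _ _ nm); rewrite lerDl divr_ge0// exprn_ge0.
exists (sup (range a)) => n; apply/andP; split.
  apply: ub_le_sup; last by exists n.
  by exists (a 0%N + w / 2 ^+ 0) => _ [m _ <-].
apply: ge_sup; first by exists (a 0%N), 0%N.
by move=> _ [m _ <-].
Qed.

(** Goursat's bisection: a nonzero circulation would survive, up to the factor 4 ^ n, in nested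
    rectangles, contradicting [circulation_small] at their common point. *)
Lemma circulation0 a c w h : inrect a c w h -> circulation a c w h = 0.
Proof.
move=> R0; have [w0 h0 ? ? [? ?]] := R0.
apply/eqP; rewrite -normr_le0; apply/negP => /negP; rewrite -ltNge => J0.
have wh0 : 0 < w + h.
  rewrite lt_neqAle addr_ge0 // andbT; apply: contraTneq J0 => /esym wh.
  have -> : w = 0 by lra.
  have -> : h = 0 by lra.
  rewrite /circulation !addr0; under eq_Iab do rewrite subrr.
  under [X in _ + X]eq_Iab do rewrite subrr.
  by rewrite !Iab_cst // !mul0r addr0 normr0 ltxx.
pose e := `|circulation a c w h| / (w + h) ^+ 2.
pose bad (p : R * R) (n : nat) :=
  inrect p.1 p.2 (w / 2 ^+ n) (h / 2 ^+ n) /\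
  e * (w / 2 ^+ n + h / 2 ^+ n) ^+ 2 <= `|circulation p.1 p.2 (w / 2 ^+ n) (h / 2 ^+ n)|.
pose sub (p p' : R * R) n :=
  [/\ p.1 <= p'.1 , p'.1 + w / 2 ^+ n.+1 <= p.1 + w / 2 ^+ n ,
    p.2 <= p'.2 & p'.2 + h / 2 ^+ n.+1 <= p.2 + h / 2 ^+ n].
have step p n : exists p', bad p n -> bad p' n.+1 /\ sub p p' n.
  have [[R1 B1]|nb] := pselect (bad p n); last by exists p => /nb.
  pose w' := w / 2 ^+ n.+1; pose h' := h / 2 ^+ n.+1.
  have p2 : (2 : R) ^+ n != 0 by rewrite expf_neq0.
  have wE : w / 2 ^+ n = w' + w' by rewrite /w' exprS; field.
  have hE : h / 2 ^+ n = h' + h' by rewrite /h' exprS; field.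
  have [w'0 h'0] : 0 <= w' /\ 0 <= h'.
    by rewrite /w' /h' !divr_ge0 ?exprn_ge0.
  move: R1 B1; rewrite wE hE => R1 B1; have [? ? pa pb [pc pd]] := R1.
  rewrite circulation_split // in B1.
  pose J1 := circulation p.1 p.2 w' h'.
  pose J2 := circulation (p.1 + w') p.2 w' h'.
  pose J3 := circulation p.1 (p.2 + h') w' h'.
  pose J4 := circulation (p.1 + w') (p.2 + h') w' h'.
  rewrite -/J1 -/J2 -/J3 -/J4 in B1.
  have : `|J1 + J2 + J3 + J4| <= `|J1| + `|J2| + `|J3| + `|J4|.
    apply: (le_trans (ler_normD _ _)); rewrite lerD2r.
    apply: (le_trans (ler_normD _ _)); rewrite lerD2r.
    exact: ler_normD.
  move/(le_trans B1).
  have -> : e * (w' + w' + (h' + h')) ^+ 2 = 4 * (e * (w' + h') ^+ 2) by ring.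
  set k := e * _ => kJ.
  have : [\/ k <= `|J1|, k <= `|J2|, k <= `|J3| | k <= `|J4|].
    have [?|?] := leP k `|J1|; first by constructor 1.
    have [?|?] := leP k `|J2|; first by constructor 2.
    have [?|?] := leP k `|J3|; first by constructor 3.
    by constructor 4; lra.
  rewrite /bad /sub -/w' -/h' wE hE.
  have Hn : [/\ a0 <= p.1 + w', p.1 + w' + w' <= b0, p.1 + w' <= b0,
      c0 <= p.2 + h' & p.2 + h' + h' <= d0 /\ p.2 + h' <= d0].
    by clear - w'0 h'0 pa pb pc pd; repeat split; lra.
  have Hm : [/\ p.1 <= p.1 + w', p.1 + w' <= p.1 + (w' + w'), p.2 <= p.2 + h' &
      p.2 + h' <= p.2 + (h' + h')].
    by clear - w'0 h'0; split; lra.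
  have [n1 n2 n3 n4 [n5 n6]] := Hn; have [m1 m2 m3 m4] := Hm.
  case=> kk; [exists (p.1, p.2)|exists (p.1 + w', p.2)|exists (p.1, p.2 + h')|
    exists (p.1 + w', p.2 + h')] => _ /=; (split; [split; [|exact: kk]|]);
    by repeat split; rewrite ?addrA // -?addrA.
have [nx nxP] := choice (fun pn : (R * R) * nat => step pn.1 pn.2).
pose seq := fix seq n := if n is m.+1 then nx (seq m, m) else (a, c).
have badS n : bad (seq n) n.
  elim: n => [|n IH]; last by have [] := nxP (seq n, n) IH.
  rewrite /bad /= expr0 !divr1; split => //.
  by rewrite /e mulfVK // expf_neq0 // gt_eqF.
have subS n : sub (seq n) (seq n.+1) n by have [] := nxP (seq n, n) (badS n).
have [x xP] := @dyadic_limit (fun n => (seq n).1) w w0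
  (fun n => let: And4 A B _ _ := subS n in conj A B).
have [y yP] := @dyadic_limit (fun n => (seq n).2) h h0
  (fun n => let: And4 _ _ A B := subS n in conj A B).
have e0 : 0 < e by rewrite divr_gt0 // exprn_gt0.
have [|||d dp Hd] := @circulation_small x y (e / 2).
- by have := xP 0%N; rewrite /= expr0 divr1; lra.
- by have := yP 0%N; rewrite /= expr0 divr1; lra.
- by rewrite divr_gt0.
have [n nd] : exists n, (w + h) / 2 ^+ n < d.
  exists (Num.bound ((w + h) / d)).
  rewrite ltr_pdivrMr ?exprn_gt0 // mulrC -ltr_pdivrMr //.
  apply: (lt_le_trans (archi_boundP _)); first by rewrite divr_ge0 // ltW.
  rewrite -natrX ler_nat; exact/ltnW/ltn_expl.
have [Rn Bn] := badS n.
have := Hd _ _ _ _ Rn; rewrite -mulrDl => /(_ nd (xP n) (yP n)).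
move=> /(le_trans Bn); rewrite -mulrDl.
have : 0 < ((w + h) / 2 ^+ n) ^+ 2 by rewrite exprn_gt0 // divr_gt0 // exprn_gt0.
move: (_ ^+ 2) => k k0; rewrite ler_pM2r //; lra.
Qed.

End goursat.

(** * Modulus and complex differentiability *)

Section complex_plane.
Variable R : realType.
Notation C := R[i].
Implicit Types (z w k c : C) (F G : C -> C).
Local Open Scope complex_scope.

Lemma normc_ge0 z : 0 <= normc z.
Proof. by case: z => a b; exact: sqrtr_ge0. Qed.

Lemma normcE z : `|z| = (normc z)%:C. Proof. by []. Qed.

Lemma normcD z w : normc (z + w) <= normc z + normc w.
Proof. by have := ler_normD z w; rewrite !normcE -rmorphD /= lecR. Qed.

Lemma normcN z : normc (- z) = normc z.
Proof. by have := normrN z; rewrite !normcE => /complexI. Qed.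

Lemma normcB z w : normc (z - w) <= normc z + normc w.
Proof. by rewrite -(normcN w) normcD. Qed.

Lemma normc_distC z w : normc (z - w) = normc (w - z).
Proof. by rewrite -normcN opprB. Qed.

Lemma normc_dist z w : normc z - normc w <= normc (z - w).
Proof. by rewrite lerBlDr -{1}(subrK w z) normcD. Qed.

Lemma normc_dist_le z w : `|normc z - normc w| <= normc (z - w).
Proof.
by rewrite ler_norml normc_dist andbT lerNl opprB normc_distC normc_dist.
Qed.

Lemma normcR (x : R) : normc x%:C = `|x|.
Proof. by rewrite /= expr0n /= addr0 sqrtr_sqr. Qed.

Lemma normc_eq0 z : (normc z == 0) = (z == 0).
Proof. by apply/eqP/eqP => [/eq0_normc//|->]; rewrite normc0. Qed.

Lemma normc_gt0 z : (0 < normc z) = (z != 0).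
Proof. by rewrite lt_neqAle normc_ge0 andbT eq_sym normc_eq0. Qed.

Lemma normcX z n : normc (z ^+ n) = normc z ^+ n.
Proof. by elim: n => [|n IH]; rewrite ?expr0 ?normc1 // !exprS normcM IH. Qed.

Lemma normc_sqr z : normc z ^+ 2 = complex.Re z ^+ 2 + complex.Im z ^+ 2.
Proof. by case: z => a b /=; rewrite sqr_sqrtr // addr_ge0 // sqr_ge0. Qed.

Lemma normRe z : `|complex.Re z| <= normc z.
Proof.
case: z => a b /=; rewrite -sqrtr_sqr ler_wsqrtr // lerDl sqr_ge0 //.
Qed.

Lemma normIm z : `|complex.Im z| <= normc z.
Proof.
case: z => a b /=; rewrite -sqrtr_sqr ler_wsqrtr // lerDr sqr_ge0 //.
Qed.

Lemma normc_le z : normc z <= `|complex.Re z| + `|complex.Im z|.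
Proof.
case: z => a b; have -> : a +i* b = a%:C + 'i * b%:C by simpc.
have ni : normc ('i : C) = 1 by rewrite /= expr0n add0r expr1n sqrtr1.
by apply: (le_trans (normcD _ _)); rewrite normcM !normcR ni mul1r; simpc.
Qed.

Definition cis (t : R) : C := cos t +i* sin t.

Lemma normc_cis t : normc (cis t) = 1.
Proof. by rewrite /= cos2Dsin2 sqrtr1. Qed.

Lemma cisD s t : cis (s + t) = cis s * cis t.
Proof. by rewrite /cis cosD sinD; simpc; congr (_ +i* _); rewrite addrC. Qed.

Lemma cis0 : cis 0 = 1.
Proof. by rewrite /cis cos0 sin0. Qed.

Lemma cis2pi : cis (2 * pi) = 1.
Proof. by rewrite /cis mulr_natl cos2pi sin2pi. Qed.

Lemma cis_neq0 t : cis t != 0.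
Proof. by rewrite -normc_gt0 normc_cis. Qed.

Lemma cisMn t n : cis (t *+ n) = cis t ^+ n.
Proof. by elim: n => [|n IH]; rewrite ?cis0 // mulrS cisD IH exprS. Qed.

(** Continuity and differentiability on the plane in terms of the real-valued modulus, so that
    the estimates feed directly into real integrals. *)
Definition ccont F z := forall e : R, 0 < e -> exists2 d : R, 0 < d &
  forall k, normc k < d -> normc (F (z + k) - F z) <= e.

Definition cdiff F z c := forall e : R, 0 < e -> exists2 d : R, 0 < d &
  forall k, normc k < d -> normc (F (z + k) - F z - c * k) <= e * normc k.

Lemma cdiff_cont F z c : cdiff F z c -> ccont F z.
Proof.
move=> /(_ 1 ltr01) [d d0 H] e e0.
have M0 : 0 < normc c + 1 by rewrite ltr_wpDl // normc_ge0.
exists (Num.min d (e / (normc c + 1))); first by rewrite lt_min d0 divr_gt0.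
move=> k; rewrite lt_min ltr_pdivlMr // => /andP[/H kd ke].
rewrite -(subrK (c * k) (_ - _)); apply: (le_trans (normcD _ _)).
rewrite mul1r in kd; rewrite normcM (le_trans _ (ltW ke)) //.
by rewrite mulrDr mulr1 addrC mulrC lerD2l.
Qed.

Lemma cdiff_cst a z : cdiff (fun=> a) z 0.
Proof.
move=> e e0; exists 1 => // k _.
by rewrite mul0r !subrr normc0 mulr_ge0 ?normc_ge0 // ltW.
Qed.

Lemma cdiff_id z : cdiff id z 1.
Proof.
move=> e e0; exists 1 => // k _.
have -> : z + k - z - 1 * k = 0 by ring.
by rewrite normc0 mulr_ge0 ?normc_ge0 // ltW.
Qed.

Lemma cdiffD F G z a b : cdiff F z a -> cdiff G z b ->
  cdiff (fun w => F w + G w) z (a + b).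
Proof.
move=> HF HG e e0; have e2 : 0 < e / 2 by rewrite divr_gt0.
have [d1 d10 H1] := HF _ e2; have [d2 d20 H2] := HG _ e2.
exists (Num.min d1 d2); first by rewrite lt_min d10.
move=> k; rewrite lt_min => /andP[/H1 k1 /H2 k2].
have -> : F (z + k) + G (z + k) - (F z + G z) - (a + b) * k =
  (F (z + k) - F z - a * k) + (G (z + k) - G z - b * k) by ring.
by apply: (le_trans (normcD _ _)); rewrite (splitr e) mulrDl lerD.
Qed.

Lemma cdiffM F G z a b : cdiff F z a -> cdiff G z b ->
  cdiff (fun w => F w * G w) z (a * G z + F z * b).
Proof.
move=> HF HG e e0.
set A := normc (G z) + 1; set B := normc (F z); set D := normc a.
have A0 : 0 < A by rewrite ltr_wpDl ?normc_ge0.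
have B0 : 0 < B + 1 by rewrite ltr_wpDl ?normc_ge0.
have D0 : 0 < D + 1 by rewrite ltr_wpDl ?normc_ge0.
have e1 : 0 < e / 3 / A by rewrite !divr_gt0.
have e2 : 0 < e / 3 / (B + 1) by rewrite !divr_gt0.
have e3 : 0 < e / 3 / (D + 1) by rewrite !divr_gt0.
have [d1 d10 H1] := HF _ e1; have [d2 d20 H2] := HG _ e2.
have [d3 d30 H3] := cdiff_cont HG e3; have [d4 d40 H4] := cdiff_cont HG ltr01.
exists (Num.min (Num.min d1 d2) (Num.min d3 d4)).
  by rewrite !lt_min d10 d20 d30 d40.
move=> k; rewrite !lt_min => /andP[/andP[/H1 k1 /H2 k2] /andP[/H3 k3 /H4 k4]].
have -> : F (z + k) * G (z + k) - F z * G z - (a * G z + F z * b) * k =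
  (F (z + k) - F z - a * k) * G (z + k) + F z * (G (z + k) - G z - b * k)
  + a * k * (G (z + k) - G z) by ring.
apply: (le_trans (normcD _ _)).
have -> : e * normc k = e / 3 / A * normc k * A +
   (B + 1) * (e / 3 / (B + 1) * normc k) + (D + 1) * normc k * (e / 3 / (D + 1)).
  by field; rewrite !gt_eqF.
apply: lerD; last first.
  rewrite !normcM; apply: ler_pM; rewrite ?mulr_ge0 ?normc_ge0 //.
  by rewrite ler_wpM2r ?normc_ge0 // lerDl.
apply: (le_trans (normcD _ _)); rewrite !normcM.
apply: lerD; apply: ler_pM; rewrite ?normc_ge0 //; last by rewrite lerDl.
by rewrite -(subrK (G z) (G (z + k))) (le_trans (normcD _ _)) // addrC lerD2l.
Qed.

Lemma cdiff_comp F G z a b : cdiff G z b -> cdiff F (G z) a ->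
  cdiff (fun w => F (G w)) z (a * b).
Proof.
move=> HG HF e e0.
set B := normc b; set A := normc a.
have B0 : 0 < B + 1 by rewrite ltr_wpDl ?normc_ge0.
have A0 : 0 < A + 1 by rewrite ltr_wpDl ?normc_ge0.
have e1 : 0 < e / 2 / (B + 1) by rewrite !divr_gt0.
have e2 : 0 < e / 2 / (A + 1) by rewrite !divr_gt0.
have [d1 d10 H1] := HF _ e1; have [d2 d20 H2] := HG _ e2.
have [d3 d30 H3] := HG _ ltr01.
exists (Num.min (Num.min d2 d3) (d1 / (B + 1))).
  by rewrite !lt_min d20 d30 divr_gt0.
move=> k; rewrite !lt_min ltr_pdivlMr // => /andP[/andP[/H2 k2 /H3 k3] kd].
set g := G (z + k) - G z in k2 k3.
have gk : normc g <= (B + 1) * normc k.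
  rewrite -(subrK (b * k) g); apply: (le_trans (normcD _ _)).
  by rewrite normcM addrC mulrDl lerD2l.
have /H1 : normc g < d1 by rewrite (le_lt_trans gk) // mulrC.
rewrite subrKC => E.
have -> : F (G (z + k)) - F (G z) - a * b * k =
   (F (G (z + k)) - F (G z) - a * g) + a * (g - b * k) by ring.
apply: (le_trans (normcD _ _)); rewrite normcM.
have -> : e * normc k = e / 2 / (B + 1) * ((B + 1) * normc k) +
  (A + 1) * (e / 2 / (A + 1) * normc k) by field; rewrite !gt_eqF.
apply: lerD; first by rewrite (le_trans E) // ler_wpM2l // ltW.
by apply: ler_pM; rewrite ?normc_ge0 // lerDl.
Qed.

Lemma cdiff_inv z : z != 0 -> cdiff (fun w => w^-1) z (- (z^-1 ^+ 2)).
Proof.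
move=> z0 e e0; have n0 : 0 < normc z by rewrite normc_gt0.
exists (Num.min (normc z / 2) (e * normc z ^+ 3 / 2)).
  by rewrite lt_min !divr_gt0 // mulr_gt0 // exprn_gt0.
move=> k; rewrite lt_min ltr_pdivlMr // => /andP[k1 k2].
have zk : normc z / 2 <= normc (z + k).
  have := normc_dist z (- k); rewrite opprK normcN => H; clear - H k1; lra.
have zk0 : z + k != 0 by rewrite -normc_gt0 (lt_le_trans _ zk) // divr_gt0.
have -> : (z + k)^-1 - z^-1 - - z^-1 ^+ 2 * k = k * (k / (z ^+ 2 * (z + k))).
  by field; rewrite z0 zk0.
rewrite normcM mulrC; apply: ler_wpM2r; rewrite ?normc_ge0 //.
rewrite normcM normcV normcM normcX ler_pdivrMr ?mulr_gt0 ?exprn_gt0 ?normc_gt0 //.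
apply: (@le_trans _ _ (e * (normc z ^+ 2 * (normc z / 2)))).
  by rewrite (le_trans (ltW k2)) // [in leLHS]exprSr !mulrA.
by rewrite ler_wpM2l ?(ltW e0) // ler_wpM2l // exprn_ge0 // ltW.
Qed.

Lemma cdiff_ext F G z a (d : R) : 0 < d -> (forall k, normc k < d -> F (z + k) = G (z + k)) ->
  cdiff F z a -> cdiff G z a.
Proof.
move=> d0 FG H e /H[d' d'0 H']; exists (Num.min d d'); first by rewrite lt_min d0.
move=> k; rewrite lt_min => /andP[/FG <- /H'].
by have := FG 0; rewrite normc0 addr0 => ->.
Qed.

End complex_plane.

Section derivative_eps.
Variable K : numFieldType.
Implicit Types f : K^o -> K^o.

Lemma derivable_eps f x : derivable f x 1 -> forall e : K, 0 < e ->
  exists2 d : K, 0 < d & forall k, `|k| < d ->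
  `|f (x + k) - f x - 'D_1 f x * k| <= e * `|k|.
Proof.
move=> H e e0.
have /cvgrPdist_le /(_ e e0) := H.
rewrite /dnbhs /within /= => /nbhs_ballP[d /= d0 Hd].
exists d => // k kd.
have [->|k0] := eqVneq k 0; first by rewrite addr0 mulr0 subrr subr0 normr0 mulr0.
have /Hd /(_ k0) : ball 0 d k by rewrite /ball /= sub0r normrN.
rewrite -(ler_pM2r (x := `|k|)) ?normr_gt0 // -normrM mulrBl distrC.
by rewrite /GRing.scale /= mulrAC mulVf // mul1r mulr1 [k + x]addrC.
Qed.

Lemma eps_derivable f x (c : K) : (forall e : K, 0 < e ->
  exists2 d : K, 0 < d & forall k, `|k| < d ->
  `|f (x + k) - f x - c * k| <= e * `|k|) -> derivable f x 1 /\ 'D_1 f x = c.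
Proof.
move=> H; set q := fun h : K => h^-1 *: (f (h *: 1 + x) - f x).
have Hc : (q h : K^o) @[h --> 0^'] --> (c : K^o).
  apply/cvgrPdist_le => e /H[d d0 Hd].
  rewrite /dnbhs /within /=; apply/nbhs_ballP; exists d => //= k.
  rewrite /ball /= sub0r normrN => /Hd kd k0.
  rewrite -(ler_pM2r (x := `|k|)) ?normr_gt0 // -normrM mulrBl distrC.
  by rewrite /q /GRing.scale /= mulrAC mulVf // mul1r mulr1 [k + x]addrC.
split; first by apply: (cvgP (c : K^o)); exact: Hc.
by apply: cvg_lim; [exact: norm_hausdorff|exact: Hc].
Qed.

End derivative_eps.

Section bridge.
Variable R : realType.
Notation C := R[i].
Local Open Scope complex_scope.

Lemma derivable_cdiff (f : C^o -> C^o) z : derivable f z 1 ->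
  cdiff f z (f^`()%classic z).
Proof.
move=> H e e0; have [|d d0 Hd] := derivable_eps H (e := e%:C).
  by rewrite (ltcR 0).
have dE : d = (complex.Re d)%:C.
  by move: d0; case: (d) => a b; rewrite ltcE /= => /andP[/eqP -> _].
rewrite dE (ltcR 0) in d0; exists (complex.Re d) => // k kd.
have kd' : (normc k)%:C < d by rewrite dE ltcR.
by rewrite -lecR rmorphM derive1E; exact: Hd kd'.
Qed.

Lemma cdiff_derivable (f : C^o -> C^o) z c : cdiff f z c ->
  derivable f z 1 /\ f^`()%classic z = c.
Proof.
move=> H; rewrite derive1E; apply: eps_derivable => e e0.
have eE : e = (complex.Re e)%:C.
  by move: e0; case: (e) => a b; rewrite ltcE /= => /andP[/eqP -> _].
rewrite eE (ltcR 0) in e0; have [d d0 Hd] := H _ e0.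
exists d%:C; first by rewrite (ltcR 0).
move=> k kd; have kd' : normc k < d by rewrite -ltcR; exact: kd.
by have := Hd k kd'; rewrite -lecR rmorphM /= eE; exact.
Qed.

Lemma is_derive_eps (f : R -> R) (x df : R) : is_derive x (1 : R) f df ->
  forall e : R, 0 < e ->
  exists2 d : R, 0 < d & forall k, `|k| < d ->
  `|f (x + k) - f x - df * k| <= e * `|k|.
Proof. by case=> df1 <-; exact: derivable_eps. Qed.

End bridge.

(** * The mean value property *)

Section mean_value.
Variable R : realType.
Notation C := R[i].
Local Open Scope complex_scope.
Implicit Types (F : C -> C) (z w : C).

Lemma Im_dist (a b k : C) (s t : R) : complex.Im (a - b - k * (s +i* t)) =
  complex.Im a - complex.Im b - (complex.Im k * s + complex.Re k * t).
Proof. by case: a b k => [? ?] [? ?] [? ?] /=; ring. Qed.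

Lemma Re_dist (a b k : C) (s t : R) : complex.Re (a - b - k * (s +i* t)) =
  complex.Re a - complex.Re b - (complex.Re k * s + - complex.Im k * t).
Proof. by case: a b k => [? ?] [? ?] [? ?] /=; ring. Qed.

Lemma Re_sub (a b : C) : complex.Re (a - b) = complex.Re a - complex.Re b.
Proof. by case: a b => [? ?] [? ?]. Qed.

Lemma expcis_diff (e : R) : 0 < e -> exists2 d : R, 0 < d &
  forall s t : R, `|s| < d -> `|t| < d ->
  normc ((expR s)%:C * cis t - 1 - (s +i* t)) <= e * (`|s| + `|t|).
Proof.
move=> e0.
have [a [e1 a1 a8]] : exists a, [/\ 0 < a, a <= 1 & a <= e / 8].
  exists (Num.min 1 (e / 8)).
  by split; rewrite ?lt_min ?ge_min ?ltr01 ?lexx ?orbT ?divr_gt0.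
have [d1 d10 H1] := is_derive_eps (is_derive_expR 0) e1.
have [d2 d20 H2] := is_derive_eps (is_derive_sin 0) e1.
have [d3 d30 H3] := is_derive_eps (is_derive_cos 0) e1.
exists (Num.min (Num.min d1 a) (Num.min d2 d3)).
  by rewrite !lt_min d10 e1 d20 d30.
move=> s t; rewrite !lt_min => /andP[/andP[/H1 s1 sa] _] /andP[_ /andP[/H2 t2 /H3 t3]].
move: s1 t2 t3; rewrite !add0r expR0 sin0 cos0 subr0 oppr0 mul0r subr0 !mul1r.
move=> s1 t2 t3.
have -> : (expR s)%:C * cis t - 1 - (s +i* t) =
    (expR s * cos t - 1 - s) +i* (expR s * sin t - t).
  by rewrite /cis; simpc.
apply: (le_trans (normc_le _)) => /=.
have es : `|expR s - 1| <= 2 * `|s|.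
  rewrite -(subrK s (_ - 1)) (le_trans (ler_normD _ _)) //.
  rewrite mulrDl mul1r lerD2r (le_trans s1) // ler_piMl //.
have e3 : `|expR s| <= 3.
  rewrite -(subrK 1 (expR s)) (le_trans (ler_normD _ _)) // normr1.
  clear - es sa a1; lra.
have -> : expR s * cos t - 1 - s = (expR s - 1 - s) + expR s * (cos t - 1) by ring.
have -> : expR s * sin t - t = expR s * (sin t - t) + (expR s - 1) * t by ring.
have B1 : `|expR s * (cos t - 1)| <= 3 * (a * `|t|) by rewrite normrM ler_pM.
have B2 : `|expR s * (sin t - t)| <= 3 * (a * `|t|) by rewrite normrM ler_pM.
have B3 : `|(expR s - 1) * t| <= 2 * a * `|t|.
  rewrite normrM ler_wpM2r //; clear - es sa; lra.
have B4 := ler_normD (expR s - 1 - s) (expR s * (cos t - 1)).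
have B5 := ler_normD (expR s * (sin t - t)) ((expR s - 1) * t).
have B6 : a * `|s| <= e / 8 * `|s| by rewrite ler_wpM2r.
have B7 : a * `|t| <= e / 8 * `|t| by rewrite ler_wpM2r.
have := normr_ge0 s; clear - B1 B2 B3 B4 B5 B6 B7 s1 e0.
have : 0 <= e * `|s| by rewrite mulr_ge0 // ltW.
lra.
Qed.

(** Logarithmic polar coordinates e^(x + iy) z: circles become segments of length 2 pi and
    punctured discs become half-strips, on which Goursat's lemma for rectangles applies. *)
Definition polar z (x y : R) : C := (expR x)%:C * cis y * z.

Lemma normc_polar z x y : normc (polar z x y) = expR x * normc z.
Proof. by rewrite /polar !normcM normcR normc_cis mulr1 gtr0_norm ?expR_gt0. Qed.

Lemma polarD z x y s t : polar z (x + s) (y + t) = polar (polar z x y) s t.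
Proof. by rewrite /polar expRD cisD rmorphM /=; ring. Qed.

Lemma polar_diff F w c : cdiff F w c -> forall e : R, 0 < e ->
  exists2 d : R, 0 < d & forall s t : R, `|s| < d -> `|t| < d ->
  normc (F (polar w s t) - F w - c * w * (s +i* t)) <= e * (`|s| + `|t|).
Proof.
move=> Fc e e0.
pose W := normc w + 1; pose A := normc c + 1.
have W0 : 0 < W by rewrite ltr_wpDl ?normc_ge0.
have A0 : 0 < A by rewrite ltr_wpDl ?normc_ge0.
have ew : 0 < e / (4 * W) by rewrite divr_gt0 ?mulr_gt0.
have [d1 d10 H1] := Fc _ ew.
have eA : 0 < Num.min 1 (e / (2 * (A * W))).
  by rewrite lt_min ltr01 divr_gt0 ?mulr_gt0.
have [d2 d20 H2] := expcis_diff eA.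
exists (Num.min d2 (d1 / (4 * W))); first by rewrite lt_min d20 divr_gt0 ?mulr_gt0.
move=> s t; rewrite !lt_min => /andP[s2 sW] /andP[t2 tW].
have := H2 s t s2 t2.
set q := (expR s)%:C * cis t - 1 => B.
set n := `|s| + `|t| in B *; have n0 : 0 <= n by rewrite addr_ge0.
have nst : normc (s +i* t) <= n by rewrite (le_trans (normc_le _)).
have B1 : normc (q - (s +i* t)) <= n.
  by rewrite (le_trans B) // ler_piMl // ge_min lexx.
have B2 : normc (q - (s +i* t)) <= e / (2 * (A * W)) * n.
  by rewrite (le_trans B) // ler_wpM2r // ge_min lexx orbT.
have qn : normc q <= 2 * n.
  rewrite -(subrK (s +i* t) q) (le_trans (normcD _ _)) //.
  by clear - B1 nst; lra.
have pE : polar w s t = w + w * q by rewrite /polar /q; ring.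
have wW : normc w <= W by rewrite lerDl.
have wq : normc (w * q) <= W * (2 * n) by rewrite normcM ler_pM ?normc_ge0.
have : normc (w * q) < d1.
  apply: (le_lt_trans wq); rewrite !ltr_pdivlMr ?mulr_gt0 // in sW tW.
  by clear - sW tW; rewrite /n; lra.
move=> /H1; rewrite -pE => B3.
have -> : F (polar w s t) - F w - c * w * (s +i* t) =
  (F (polar w s t) - F w - c * (w * q)) + c * w * (q - (s +i* t)) by ring.
apply: (le_trans (normcD _ _)).
rewrite (_ : e * n = e / (4 * W) * (W * (2 * n)) + A * W * (e / (2 * (A * W)) * n)); last first.
  by field; rewrite !gt_eqF.
apply: lerD; first by rewrite (le_trans B3) // ler_wpM2l // ltW.
by rewrite !normcM; apply: ler_pM => //; rewrite ?mulr_ge0 ?normc_ge0 //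
  ler_pM ?normc_ge0 // lerDl.
Qed.

Variables (F : C -> C) (r : R).
Hypothesis Fdiff : forall w, 0 < normc w -> normc w < r -> exists c, cdiff F w c.
Hypothesis F0 : ccont F 0.

Let P z x y := complex.Im (F (polar z x y)).
Let Q z x y := complex.Re (F (polar z x y)).

(** The Cauchy-Riemann equations in logarithmic coordinates. *)
Lemma polar_closed z x y : z != 0 -> normc z < r -> x <= 0 -> closed_form_at (P z) (Q z) x y.
Proof.
move=> z0 zr x0; set w := polar z x y.
have w0 : 0 < normc w by rewrite normc_polar mulr_gt0 ?expR_gt0 ?normc_gt0.
have wr : normc w < r.
  rewrite normc_polar (le_lt_trans _ zr) // ler_piMl ?normc_ge0 //.
  by rewrite -expR0 ler_expR.
have [c Hc] := Fdiff w0 wr.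
exists (complex.Im (c * w)), (complex.Re (c * w)), (- complex.Im (c * w)) => e e0.
have [d d0 Hd] := polar_diff Hc e0; exists d => // s t sd td.
have := Hd s t sd td; rewrite /P /Q polarD -/w.
rewrite -Im_dist -Re_dist => B.
by split; [apply: le_trans (normIm _) B |apply: le_trans (normRe _) B].
Qed.

(** On the rectangle [a, 0] x [0, 2 pi] the horizontal sides cancel by periodicity, so the mean
    over the circle of radius e^a |z| does not depend on a; then a tends to minus infinity. *)
Lemma mean_value_Re z : normc z < r ->
  Iab 0 (2 * pi) (fun t => complex.Re (F (cis t * z))) = complex.Re (F 0) * (2 * pi).
Proof.
move=> zr; have : 0 < 2 * pi :> R by rewrite mulr_gt0 // pi_gt0.
have := @cis2pi R; move: (2 * pi) => T cT T0; have pi0 := ltW T0.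
have [->|z0] := eqVneq z 0.
  by under eq_Iab do rewrite mulr0; rewrite Iab_cst // subr0.
have nz0 : 0 < normc z by rewrite normc_gt0.
apply/eqP; rewrite -subr_eq0 -normr_le0; apply/ler_addgt0Pl => e e0; rewrite addr0.
have e1 : 0 < e / T by rewrite divr_gt0.
have [d d0 Hd] := F0 e1.
have [a a0 aE] : exists2 a : R, a <= 0 & expR a * normc z < d.
  exists (Num.min 0 (ln (d / 2 / normc z))); first by rewrite ge_min lexx.
  rewrite -ltr_pdivlMr //.
  apply: (@le_lt_trans _ _ (expR (ln (d / 2 / normc z)))).
    by rewrite ler_expR ge_min lexx orbT.
  rewrite lnK ?posrE ?divr_gt0 // ltr_pM2r ?invr_gt0 //.
  by rewrite ltr_pdivrMr // ltr_pMr // ltr1n.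
have cl x y : a <= x <= 0 -> 0 <= y <= T -> closed_form_at (P z) (Q z) x y.
  by move=> /andP[_ x0] _; exact: polar_closed.
have Rk : inrect a 0 0 T a 0 (- a) T.
  by split; rewrite ?lexx ?oppr_ge0 ?subrr // add0r.
have := circulation0 cl Rk; rewrite /circulation addrN add0r.
rewrite [X in X + _](_ : _ = 0); last first.
  under eq_Iab do rewrite /P /polar cT cis0 subrr.
  by rewrite Iab_cst ?mul0r // oppr_ge0.
have cQ' x : a <= x <= 0 -> cont_on 0 T (Q z x).
  by move=> xa y yp; have [_] := closed_form_contP cl xa yp.
rewrite add0r IabB; [|by apply: cQ'; rewrite lexx a0..].
move/eqP; rewrite subr_eq0 => /eqP E.
have -> : Iab 0 T (fun t => complex.Re (F (cis t * z))) = Iab 0 T (Q z 0).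
  by apply: eq_Iab => t _; rewrite /Q /polar expR0 mul1r.
rewrite E; set k := complex.Re (F 0).
have B : `|Iab 0 T (Q z a) - k * (T - 0)| <= e / T * (T - 0).
  apply: (Iab_approx pi0); first by apply: cQ'; rewrite lexx a0.
  move=> y _; rewrite /Q /k -Re_sub; apply: (le_trans (normRe _)).
  by have := Hd (polar z a y); rewrite add0r; apply; rewrite normc_polar.
by move: B; rewrite !subr0 divfK ?gt_eqF.
Qed.

End mean_value.

Section mean_value_inequality.
Variable R : realType.
Notation C := R[i].
Local Open Scope complex_scope.
Implicit Types (F : C -> C) (z w : C).

Definition holo r F := forall w, normc w < r -> exists c, cdiff F w c.

Lemma ccont_cis F z t : ccont F (cis t * z) ->
  forall e : R, 0 < e -> exists2 d : R, 0 < d &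
   forall s, `|s| < d -> normc (F (cis (t + s) * z) - F (cis t * z)) <= e.
Proof.
move=> Fc e /Fc[d d0 Hd].
have [d1 d10 H1] := expcis_diff (@ltr01 R).
have D0 : 0 < Num.min d1 (d / (3 * (normc z + 1))).
  by rewrite lt_min d10 divr_gt0 // mulr_gt0 // ltr_wpDl // normc_ge0.
exists (Num.min d1 (d / (3 * (normc z + 1)))) => // s.
rewrite lt_min => /andP[s1 s2].
rewrite cisD (_ : cis t * cis s * z = cis t * z + cis t * z * (cis s - 1)); last by ring.
apply: Hd; rewrite !normcM normc_cis mul1r.
have := H1 0 s; rewrite normr0 expR0 mul1r add0r mul1r => /(_ d10 s1) B.
have : normc (cis s - 1) <= 2 * `|s|.
  rewrite -(subrK (0 +i* s) (_ - 1)) (le_trans (normcD _ _)) //.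
  have : normc (0 +i* s) <= `|s| by apply: le_trans (normc_le _) _; rewrite /= normr0 add0r.
  by clear - B; lra.
have n0 := normc_ge0 z => B2.
rewrite ltr_pdivlMr ?mulr_gt0 ?ltr_wpDl // in s2.
apply: (le_lt_trans _ s2).
apply: (@le_trans _ _ (normc z * (2 * `|s|))); first by rewrite ler_wpM2l.
have := normr_ge0 s; clear - n0; move: (normc z) `|s| n0 => x y x0 y0; nra.
Qed.

Lemma cont_on_cis F z a b (phi : C -> R) :
  (forall t, ccont F (cis t * z)) ->
  (forall u v, `|phi u - phi v| <= normc (u - v)) ->
  cont_on a b (fun t => phi (F (cis t * z))).
Proof.
move=> Fc phi1 t _; apply: continuous_eps => e e0.
have [d d0 Hd] := ccont_cis (Fc t) e0; exists d => // s /Hd.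
exact: le_trans (phi1 _ _).
Qed.

(** Differentiability off the centre and continuity at it: the case of interest is the difference
    quotient of a holomorphic function. *)
Lemma circle_mean F r z :
  (forall w, 0 < normc w -> normc w < r -> exists c, cdiff F w c) ->
  ccont F 0 -> normc z < r ->
  normc (F 0) * (2 * pi) <= Iab 0 (2 * pi) (fun t => normc (F (cis t * z))).
Proof.
move=> Fd F0 zr; have pi0 : 0 <= 2 * pi :> R by rewrite mulr_ge0 // pi_ge0.
have [F00|F00] := eqVneq (F 0) 0.
  rewrite F00 normc0 mul0r; apply: Rintegral_ge0 => t _; exact: normc_ge0.
have Fc w : normc w < r -> ccont F w.
  have [-> //|w0 wr] := eqVneq w 0.
  by have [|c] := Fd w _ wr; [rewrite normc_gt0|exact: cdiff_cont].
have cisr t : normc (cis t * z) < r by rewrite normcM normc_cis mul1r.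
have n0 : normc (F 0) != 0 by rewrite normc_eq0.
(* rotate F so that its value at the centre is its modulus *)
pose a : C := (normc (F 0))%:C / F 0.
have na : normc a = 1 by rewrite normcM normcV normcR ger0_norm ?normc_ge0 // divff.
have aF : a * F 0 = (normc (F 0))%:C by rewrite /a mulfVK.
pose G w := a * F w.
have Gc w : normc w < r -> ccont G w.
  move=> /Fc H e /H[d d0 Hd]; exists d => // k /Hd.
  by rewrite /G -mulrBr normcM na mul1r.
have -> : normc (F 0) * (2 * pi) = complex.Re (G 0) * (2 * pi) by rewrite /G aF.
have r0 : 0 < r by apply: le_lt_trans zr; exact: normc_ge0.
rewrite -(@mean_value_Re _ G r _ _ z zr); first last.
- by apply: Gc; rewrite normc0.
- move=> w w0 wr; have [c Hc] := Fd w w0 wr.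
  by exists (0 * F w + a * c); apply: cdiffM => //; exact: cdiff_cst.
apply: Iab_le.
- by apply: cont_on_cis => [t|u v]; [exact: Gc|rewrite -Re_sub normRe].
- by apply: cont_on_cis => [t|u v]; [exact: Fc|exact: normc_dist_le].
- move=> t _; apply: le_trans (ler_norm _) _; apply: le_trans (normRe _) _.
  by rewrite /G normcM na mul1r.
Qed.

Lemma circle_mean_le F r z : holo r F -> normc z < r ->
  normc (F 0) * (2 * pi) <= Iab 0 (2 * pi) (fun t => normc (F (cis t * z))).
Proof.
move=> Fh zr; apply: (circle_mean (r := r)) => //; first by move=> w _; exact: Fh.
have [|c] := Fh 0; last exact: cdiff_cont.
by rewrite normc0 (le_lt_trans _ zr) // normc_ge0.
Qed.

Lemma circle_deriv_le F r z c : holo r F -> normc z < r -> cdiff F 0 c ->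
  normc c * normc z * (2 * pi) <=
  Iab 0 (2 * pi) (fun t => normc (F (cis t * z) - F 0)).
Proof.
move=> Fh zr Fc.
have [->|z0] := eqVneq z 0.
  rewrite normc0 mulr0 mul0r; apply: Rintegral_ge0 => t _; exact: normc_ge0.
have nz : 0 < normc z by rewrite normc_gt0.
pose G w := if w == 0 then c else (F w - F 0) / w.
have GE w : w != 0 -> G w = (F w - F 0) / w by rewrite /G => /negbTE ->.
have Gd w : 0 < normc w -> normc w < r -> exists c, cdiff G w c.
  move=> w0 wr; have [b Hb] := Fh w wr; have w0' := w0; rewrite normc_gt0 in w0'.
  exists ((b + 0) * w^-1 + (F w - F 0) * - (w^-1 ^+ 2)).
  apply: (@cdiff_ext _ (fun w => (F w - F 0) * w^-1) _ _ _ (normc w)) => //.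
    move=> k kw; rewrite GE //; apply: contraTneq kw => /eqP.
    by rewrite addr_eq0 => /eqP ->; rewrite normcN ltxx.
  apply: cdiffM; last exact: cdiff_inv.
  by apply: cdiffD => //; exact: cdiff_cst.
have G0 : G 0 = c by rewrite /G eqxx.
have Gc : ccont G 0.
  move=> e e0; have [d d0 Hd] := Fc e e0; exists d => // k kd; rewrite add0r G0.
  have [->|k0] := eqVneq k 0.
    by rewrite G0 subrr normc0 ltW.
  rewrite GE // -(ler_pM2r (x := normc k)) ?normc_gt0 // -normcM mulrBl divfK //.
  by have := Hd k kd; rewrite add0r.
have := circle_mean Gd Gc zr; rewrite G0 mulrAC => H.
apply: le_trans (ler_wpM2r (ltW nz) H) _.
rewrite mulrC /Iab -RintegralZl //; last first.
  apply: cont_on_integrable; apply: cont_on_cis => [t|u v]; last exact: normc_dist_le.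
  have [||c' Hc'] := Gd (cis t * z); rewrite ?normcM ?normc_cis ?mul1r //.
  exact: cdiff_cont Hc'.
apply: le_of_eq; apply: eq_Rintegral => t _.
rewrite GE ?mulf_neq0 ?cis_neq0 // normcM normcV normcM normc_cis mul1r.
by rewrite mulrC divfK // gt_eqF.
Qed.

End mean_value_inequality.

Local Arguments normc : simpl never.

(** * Area integrals *)

Section integral_monotone.
Local Open Scope ereal_scope.
Import HBNNSimple.

(** Holds for arbitrary nonnegative functions, because the integral of such a function is a
    supremum over the simple functions below it. *)
Lemma le_integral_ge0 d (T : measurableType d) (R : realType)
  (mu : {measure set T -> \bar R}) (f g : T -> \bar R) :
  (forall x, 0 <= f x) -> (forall x, f x <= g x) ->
  \int[mu]_x f x <= \int[mu]_x g x.
Proof.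
move=> f0 fg; rewrite !ge0_integralTE //; last first.
  by move=> x; rewrite (le_trans (f0 x)).
by apply: le_ereal_sup => _ [h hf <-]; exists h => // x; rewrite (le_trans (hf x)).
Qed.

End integral_monotone.

Section affine_change.
Variable R : realType.
Notation mu := (@lebesgue_measure R).
Local Open Scope ereal_scope.

Lemma lebesgue_affine (a b : R) (f : R -> \bar R) : (0 < a)%R ->
  measurable_fun [set: R] f -> (forall x, 0 <= f x) ->
  \int[mu]_x f (a * x + b)%R = (a^-1)%:E * \int[mu]_x f x.
Proof.
move=> a0 mf f0.
pose phi (x : measurableTypeR R) : measurableTypeR R := (a * x + b)%R.
have mphi : measurable_fun setT phi.
  by apply: measurable_funD; [exact: mulrl_measurable|exact: measurable_cst].
have ai0 : (0 <= a^-1)%R by rewrite invr_ge0 ltW.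
pose am : {nonneg R} := NngNum (ltW a0).
pose nu : {measure set _ -> \bar R} :=
  mscale am (measure_function_pushforward__canonical__measure_function_Measure mu mphi).
have E : \int[mu]_x f x = a%:E * \int[mu]_x f (a * x + b)%R.
  transitivity (\int[nu]_x f x).
    apply: eq_measure_integral => A mA _.
    apply: lebesgue_measure_unique => // _ [[c e] _ <-].
    have E : phi @^-1` `]c, e] = `]((c - b) / a)%R, ((e - b) / a)%R]%classic.
      apply/seteqP; split=> x; rewrite /phi /= !in_itv /= ltr_pdivrMr // ler_pdivlMr //
        ltrBlDr lerBrDr ![(a * x)%R]mulrC //.
    transitivity (a%:E * mu (phi @^-1` `]c, e])); last by [].
    rewrite E !lebesgue_measure_itv /= !lte_fin.
    rewrite ltr_pM2r ?invr_gt0 // ltrBlDr subrK.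
    case: ifP => _; last by rewrite mule0.
    by rewrite -!EFinD -EFinM; congr EFin; field; rewrite gt_eqF.
  rewrite ge0_integral_mscale //; congr (_ * _).
  by rewrite ge0_integral_pushforward.
by rewrite E muleA -EFinM mulVf ?gt_eqF // mul1e.
Qed.
End affine_change.

Section plane_integral.
Variable R : realType.
Notation mu := (@lebesgue_measure R).
Notation dA := (@lebesgue_measure R \x @lebesgue_measure R)%E.
Local Open Scope complex_scope.
Local Open Scope ereal_scope.
Notation C := R[i].

(** Functions on the complex plane are integrated, and tested for measurability, in the
    coordinates (x, y). *)
Definition cx (u : R * R) : C := u.1 +i* u.2.
Definition area_int (phi : C -> \bar R) : \bar R := \int[dA]_u phi (cx u).
Definition mC d (T : measurableType d) (phi : C -> T) :=
  measurable_fun [set: R * R] (fun u => phi (cx u)).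

Implicit Types phi psi : C -> \bar R.

Lemma affine_x (a : R) (b : R -> R) (f : R * R -> \bar R) : (0 < a)%R ->
  measurable_fun [set: R] b ->
  measurable_fun [set: R * R] f -> (forall u, 0 <= f u) ->
  \int[dA]_u f (a * u.1 + b u.2, u.2)%R = (a^-1)%:E * \int[dA]_u f u.
Proof.
move=> a0 mb mf f0; rewrite [in RHS]fubini_tonelli2 //.
pose h (u : R * R) := f (a * u.1 + b u.2, u.2)%R; have h0 u : 0 <= h u by exact: f0.
have mh : measurable_fun [set: R * R] h.
  apply: measurableT_comp mf _; apply: measurable_fun_pair => //.
  apply: measurable_funD; first by apply: measurable_funM.
  exact: measurableT_comp.
rewrite -/(\int[dA]_u h u) [LHS]fubini_tonelli2 //.
rewrite -ge0_integralZl //; [|exact: measurable_fun_fubini_tonelli_G|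
  by move=> y _; exact: integral_ge0|by rewrite lee_fin invr_ge0 ltW].
apply: eq_integral => y _; rewrite /fubini_G /=.
rewrite (@lebesgue_affine R a (b y) (fun x => f (x, y))) //.
exact: measurable_fun_pair1.
Qed.

Lemma affine_y (a : R) (b : R -> R) (f : R * R -> \bar R) : (0 < a)%R ->
  measurable_fun [set: R] b ->
  measurable_fun [set: R * R] f -> (forall u, 0 <= f u) ->
  \int[dA]_u f (u.1, a * u.2 + b u.1)%R = (a^-1)%:E * \int[dA]_u f u.
Proof.
move=> a0 mb mf f0; rewrite [in RHS]fubini_tonelli1 //.
pose h (u : R * R) := f (u.1, a * u.2 + b u.1)%R; have h0 u : 0 <= h u by exact: f0.
have mh : measurable_fun [set: R * R] h.
  apply: measurableT_comp mf _; apply: measurable_fun_pair => //.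
  apply: measurable_funD; first by apply: measurable_funM.
  exact: measurableT_comp.
rewrite -/(\int[dA]_u h u) [LHS]fubini_tonelli1 //.
rewrite -ge0_integralZl //; [|exact: measurable_fun_fubini_tonelli_F|
  by move=> y _; exact: integral_ge0|by rewrite lee_fin invr_ge0 ltW].
apply: eq_integral => x _; rewrite /fubini_F /=.
rewrite (@lebesgue_affine R a (b x) (fun y => f (x, y))) //.
exact: measurable_fun_pair2.
Qed.

Lemma mC_linear d (T : measurableType d) (phi : C -> T) (a b : C) : mC phi ->
  mC (fun z => phi (a * z + b)%R).
Proof.
move=> mphi; rewrite /mC.
pose h (u : R * R) := (complex.Re a * u.1 - complex.Im a * u.2 + complex.Re b,
  complex.Re a * u.2 + complex.Im a * u.1 + complex.Im b)%R.
rewrite (_ : (fun u => _) = (fun u => phi (cx u)) \o h); last first.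
  by apply/funext => u; rewrite /cx /h /=; congr phi; case: (a) (b) => [? ?] [? ?]; simpc.
apply: measurableT_comp mphi _.
by apply: measurable_fun_pair; apply: measurable_funD => //;
  [apply: measurable_funB|apply: measurable_funD]; apply: measurable_funM.
Qed.

Lemma area_int_trans phi (c : C) : mC phi -> (forall z, 0 <= phi z) ->
  area_int (fun z => phi (z + c)%R) = area_int phi.
Proof.
move=> mphi phi0; rewrite /area_int.
pose f u := phi (cx u); have mf : measurable_fun [set: R * R] f := mphi.
have f0 u : 0 <= f u by exact: phi0.
transitivity (\int[dA]_u f (u.1, 1 * u.2 + complex.Im c)%R); last first.
  by rewrite (affine_y (b := cst (complex.Im c))) // invr1 mul1e.
pose g u := f (u.1, 1 * u.2 + complex.Im c)%R.
have g0 u : 0 <= g u by exact: f0.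
have mg : measurable_fun [set: R * R] g.
  apply: measurableT_comp mf _; apply: measurable_fun_pair => //.
  by apply: measurable_funD => //; apply: measurable_funM.
transitivity (\int[dA]_u g (1 * u.1 + complex.Re c, u.2)%R).
  apply: eq_integral => -[x y] _; rewrite /g /f /cx /=; congr phi.
  by rewrite !mul1r; case: (c) => ? ?; simpc.
by rewrite (affine_x (b := cst (complex.Re c))) // invr1 mul1e.
Qed.

Lemma area_int_dil phi (t : R) : (0 < t)%R -> mC phi -> (forall z, 0 <= phi z) ->
  area_int (fun z => phi (t%:C * z)%R) = ((t ^+ 2)^-1)%:E * area_int phi.
Proof.
move=> t0 mphi phi0; rewrite /area_int.
pose f u := phi (cx u); have mf : measurable_fun [set: R * R] f := mphi.
have f0 u : 0 <= f u by exact: phi0.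
pose g u := f (u.1, t * u.2 + 0)%R.
have g0 u : 0 <= g u by exact: f0.
have mg : measurable_fun [set: R * R] g.
  apply: measurableT_comp mf _; apply: measurable_fun_pair => //.
  by apply: measurable_funD => //; apply: measurable_funM.
transitivity (\int[dA]_u g (t * u.1 + 0, u.2)%R).
  apply: eq_integral => -[x y] _; rewrite /g /f /cx /=; congr phi.
  by apply/eqP; rewrite eq_complex /=; apply/andP; split; apply/eqP; ring.
rewrite (affine_x (b := cst 0%R)) //.
rewrite /g (affine_y (b := cst 0%R)) // muleA -EFinM; congr (_%:E * _).
by rewrite expr2 invfM.
Qed.

(** When cos t > 0 the rotation is a composition of two maps, each affine in one coordinate
    with the other one fixed; their scaling factors cos t and 1 / cos t cancel. *)
Lemma area_int_rot0 phi (t : R) : (0 < cos t)%R -> mC phi -> (forall z, 0 <= phi z) ->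
  area_int (fun z => phi (cis t * z)%R) = area_int phi.
Proof.
move=> t0 mphi phi0; rewrite /area_int.
pose f u := phi (cx u); have mf : measurable_fun [set: R * R] f := mphi.
have f0 u : 0 <= f u by exact: phi0.
pose g u := f (u.1, (cos t)^-1 * u.2 + (sin t / cos t * u.1))%R.
have g0 u : 0 <= g u by exact: f0.
have mg : measurable_fun [set: R * R] g.
  apply: measurableT_comp mf _; apply: measurable_fun_pair => //.
  by apply: measurable_funD => //; apply: measurable_funM.
transitivity (\int[dA]_u g (cos t * u.1 + (- sin t * u.2), u.2)%R).
  apply: eq_integral => -[x y] _; rewrite /g /f /cx /=; congr phi.
  apply/eqP; rewrite eq_complex /=; apply/andP; split; apply/eqP; first by ring.
  have -> : ((cos t)^-1 * y = (cos t ^+ 2 + sin t ^+ 2) / cos t * y)%R.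
    by rewrite cos2Dsin2 mul1r.
  by field; rewrite gt_eqF.
have mlin (k : R) : measurable_fun [set: R] (fun x => k * x)%R by exact: mulrl_measurable.
rewrite (affine_x (b := fun y => - sin t * y)%R) //.
rewrite /g (affine_y (b := fun x => sin t / cos t * x)%R) ?invr_gt0 //.
by rewrite muleA -EFinM invrK mulVf ?gt_eqF // mul1e.
Qed.

(** Every rotation is a power of one with positive cosine. *)
Lemma area_int_rot phi (t : R) : mC phi -> (forall z, 0 <= phi z) ->
  area_int (fun z => phi (cis t * z)%R) = area_int phi.
Proof.
move=> mphi phi0; pose n := (Num.bound `|t|%R).
have tn : (`|t / n.+1%:R| < 1)%R.
  rewrite normrM normfV [X in (_ / X)%R]ger0_norm ?ler0n // ltr_pdivrMr ?ltr0n // mul1r.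
  by rewrite (lt_trans (archi_boundP (normr_ge0 t))) // ltr_nat.
have cn : (0 < cos (t / n.+1%:R))%R.
  apply: cos_gt0_pihalf; move: tn; rewrite ltr_norml => /andP[t1 t2].
  have p2 : (1 <= pi / 2 :> R)%R by rewrite ler_pdivlMr // mul1r pi_ge2.
  by rewrite (le_lt_trans _ t1) ?lerN2 // (lt_le_trans t2).
rewrite (_ : cis t = cis (t / n.+1%:R) ^+ n.+1)%R; last first.
  by rewrite -cisMn; congr cis; rewrite -[RHS]mulr_natr divfK // pnatr_eq0.
move: (t / _)%R cn => s cs; elim: n.+1 => [|k IH].
  by rewrite /area_int; under eq_integral do rewrite expr0 mul1r.
rewrite -[RHS]IH -(@area_int_rot0 (fun z => phi (cis s ^+ k * z)%R) s) //.
  by rewrite /area_int; apply: eq_integral => u _; rewrite exprSr mulrA.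
have := @mC_linear _ _ phi (cis s ^+ k)%R 0%R mphi; rewrite /mC.
by under eq_fun do rewrite addr0.
Qed.

(** An open set is the union of the countably many rational squares that it contains. *)
Lemma open_measurable_plane (A : set C) :
  (forall z, A z -> exists2 d : R, (0 < d)%R & forall k, (normc k < d)%R -> A (z + k)%R) ->
  measurable [set u : R * R | A (cx u)].
Proof.
move=> oA.
pose box (i : rat * rat * rat) : set (R * R) :=
  `](ratr i.1.1 - ratr i.2)%R, (ratr i.1.1 + ratr i.2)%R[ `*`
  `](ratr i.1.2 - ratr i.2)%R, (ratr i.1.2 + ratr i.2)%R[.
rewrite (_ : [set u | _] = \bigcup_(i in [set i | box i `<=` [set u | A (cx u)]]) box i).
  rewrite bigcup_mkcond; apply: countable_bigcupT_measurable => // i.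
  by case: ifP => _; [exact: measurableX|exact: measurable0].
apply/seteqP; split => [u Au|u [i /= iA] /iA] //.
have [d d0 Hd] := oA _ Au.
have d4 : (0 < d / 4)%R by rewrite divr_gt0.
have [q] := rat_in_itvoo d4; rewrite in_itv /= => /andP[q0 qd].
have qu (x : R) : (x - ratr q < x + ratr q)%R by rewrite ltrD2l gtrN.
have [a] := rat_in_itvoo (qu u.1); have [b] := rat_in_itvoo (qu u.2).
rewrite !in_itv /= => /andP[b1 b2] /andP[a1 a2].
exists (a, b, q); last first.
  rewrite ltrBlDr in a1; rewrite ltrBlDr in b1.
  by split; rewrite /= in_itv /= ltrBlDr ?a1 ?a2 ?b1 ?b2.
move=> [x y] [] /=; rewrite !in_itv /= => /andP[x1 x2] /andP[y1 y2].
have -> : cx (x, y) = (cx u + ((x - u.1) +i* (y - u.2)))%R.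
  by apply/eqP; rewrite eq_complex /= !subrKC !eqxx.
apply: Hd; apply: (le_lt_trans (normc_le _)) => /=.
have : (`|x - u.1| < ratr q + ratr q)%R.
  by rewrite ltr_norml; clear - x1 x2 a1 a2; lra.
have : (`|y - u.2| < ratr q + ratr q)%R.
  by rewrite ltr_norml; clear - y1 y2 b1 b2; lra.
by clear - qd; lra.
Qed.

Lemma measurable_cont_on_disk (r : R) (phi : C -> R) :
  (forall z, (normc z < r)%R -> forall e : R, (0 < e)%R ->
     exists2 d : R, (0 < d)%R & forall k, (normc k < d)%R -> (`|phi (z + k) - phi z| <= e)%R) ->
  (forall z, (0 <= phi z)%R) ->
  mC (fun z => (normc z < r)%R%:R * phi z)%R.
Proof.
move=> cphi phi0; apply: (measurability _ (RGenOInfty.measurableE R)) => //.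
move=> _ [_ [a ->] <-]; rewrite setTI.
have [a0|a0] := ltP a 0%R.
  rewrite (_ : _ @^-1` _ = setT) //; apply/seteqP; split => // u _ /=.
  by rewrite in_itv /= andbT (lt_le_trans a0) // mulr_ge0 ?phi0 // ler0n.
rewrite (_ : _ @^-1` _ = [set u | [set z | (normc z < r)%R /\ (a < phi z)%R] (cx u)]).
  apply: open_measurable_plane => z [z1 az].
  have e0 : (0 < (phi z - a) / 2)%R by rewrite divr_gt0 // subr_gt0.
  have [d d0 Hd] := cphi z z1 _ e0.
  exists (Num.min d (r - normc z)%R); first by rewrite lt_min d0 subr_gt0.
  move=> k; rewrite lt_min => /andP[/Hd kd kz]; split.
    by rewrite (le_lt_trans (normcD _ _)) // addrC -ltrBrDr.
  by move: kd; rewrite ler_norml => /andP[+ _]; clear - az; lra.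
apply/seteqP; split => u; rewrite /preimage /mkset in_itv andbT /Order.lteif.
  by case: (ltP (normc (cx u)) r%R) => _; rewrite ?mul1r // mul0r ltNge a0.
by case=> -> H; rewrite mul1r.
Qed.

Lemma measurable_normc : mC (@normc R).
Proof.
apply: (measurability _ (RGenOInfty.measurableE R)) => //.
move=> _ [_ [a ->] <-]; rewrite setTI.
rewrite (_ : _ @^-1` _ = [set u | [set z | (a < normc z)%R] (cx u)]).
  apply: open_measurable_plane => z az; exists (normc z - a)%R; first by rewrite subr_gt0.
  move=> k kz; rewrite /mkset; have := normc_dist z (- k)%R; rewrite opprK normcN.
  by apply: lt_le_trans; rewrite ltrBrDr addrC -ltrBrDr.
by apply/seteqP; split => u; rewrite /preimage /mkset in_itv andbT /Order.lteif.
Qed.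

Lemma measurable_bool_real d (T : measurableType d) (b : T -> bool) :
  measurable_fun [set: T] b -> measurable_fun [set: T] (fun u => (b u)%:R%R : R).
Proof.
move=> mb; rewrite (_ : (fun u => _) = (fun u => if b u then 1%R else 0%R)).
  by apply: measurable_fun_ifT.
by apply/funext => u; case: (b u).
Qed.

Definition disk (a : C) (r : R) (z : C) : R := (normc (z - a) < r)%R%:R.

Lemma disk_ge0 a r z : (0 <= disk a r z)%R. Proof. exact: ler0n. Qed.
Lemma disk_le1 a r z : (disk a r z <= 1)%R. Proof. by rewrite /disk; case: (_ < _)%R. Qed.

Lemma measurable_disk a r : mC (disk a r).
Proof.
apply: (@measurable_bool_real _ (R * R)%type); apply: measurable_fun_ltr; last first.
  exact: measurable_cst.
have := @mC_linear _ _ (@normc R) 1%R (- a)%R measurable_normc; rewrite /mC.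
by under eq_fun do rewrite mul1r.
Qed.

Lemma area_int_ge0 phi : (forall z, 0 <= phi z) -> 0 <= area_int phi.
Proof. by move=> H; apply: integral_ge0 => u _; exact: H. Qed.

Lemma area_int_le phi psi : (forall z, 0 <= phi z) -> (forall z, phi z <= psi z) ->
  area_int phi <= area_int psi.
Proof. by move=> H1 H2; apply: le_integral_ge0. Qed.

Lemma area_intZ phi (k : R) : (0 <= k)%R -> mC phi -> (forall z, 0 <= phi z) ->
  area_int (fun z => k%:E * phi z) = k%:E * area_int phi.
Proof. by move=> k0 mphi H; apply: ge0_integralZl_EFin => // u _; exact: H. Qed.

Lemma area_intD phi psi : mC phi -> mC psi ->
  (forall z, 0 <= phi z) -> (forall z, 0 <= psi z) ->
  area_int (fun z => phi z + psi z) = area_int phi + area_int psi.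
Proof. by move=> mphi mpsi H1 H2; apply: ge0_integralD => // u _. Qed.

Lemma area_sigma_finite : sigma_finite setT dA.
Proof.
pose I n : set R := `[(- n%:R)%R, n%:R%R]%classic.
exists (fun n => I n `*` I n).
  apply/esym/seteqP; split => // -[x y] _.
  have [m xm] : exists m, (`|x| + `|y| <= m%:R)%R.
    by exists (Num.bound (`|x| + `|y|)%R); apply/ltW/archi_boundP; exact: addr_ge0.
  have := normr_ge0 x; have := normr_ge0 y => y0 x0.
  by exists m => //; split; rewrite /I /= in_itv /= -ler_norml;
    apply: le_trans xm; rewrite ?lerDl ?lerDr.
move=> n; split; first by apply: measurableX; exact: measurable_itv.
rewrite [ltLHS](_ : _ = (mu (I n) * mu (I n))%E); last first.
  by apply: product_measure1E; exact: measurable_itv.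
rewrite /I lebesgue_measure_itv /=; case: ifP => _; last by rewrite mule0 ltry.
by rewrite -EFinD -EFinM ltry.
Qed.

Definition dAs : {sigma_finite_measure set (measurableTypeR R * measurableTypeR R)%type -> \bar R} :=
  HB.pack dA (@Measure_isSigmaFinite.Build _ _ _ dA area_sigma_finite).

Lemma area_int_swap (K : C -> C -> \bar R) :
  measurable_fun [set: (R * R) * (R * R)] (fun w => K (cx w.1) (cx w.2)) ->
  (forall z w, 0 <= K z w) ->
  area_int (fun z => area_int (K z)) = area_int (fun w => area_int (K ^~ w)).
Proof.
move=> mK K0.
exact: (@fubini_tonelli _ _ _ _ R dAs dAs (fun w => K (cx w.1) (cx w.2)) mK (fun w => K0 _ _)).
Qed.

Lemma area_int_swap_line (K : R -> C -> \bar R) :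
  measurable_fun [set: R * (R * R)] (fun w => K w.1 (cx w.2)) ->
  (forall t z, 0 <= K t z) ->
  \int[mu]_t area_int (K t) = area_int (fun z => \int[mu]_t K t z).
Proof.
move=> mK K0.
exact: (@fubini_tonelli _ _ _ _ R mu dAs (fun w => K w.1 (cx w.2)) mK (fun w => K0 _ _)).
Qed.

Lemma area_int_swap1 (T : R) (K : R -> C -> \bar R) :
  measurable_fun [set: R * (R * R)] (fun w => K w.1 (cx w.2)) ->
  (forall z w, 0 <= K z w) ->
  \int[mu]_(t in `[0%R, T]) area_int (K t) =
  area_int (fun w => \int[mu]_(t in `[0%R, T]) K t w).
Proof.
move=> mK K0.
pose K' (t : R) z := K t z * (\1_(`[0%R, T]%classic) t)%:E.
have mK' : measurable_fun [set: R * (R * R)] (fun w => K' w.1 (cx w.2)).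
  apply: emeasurable_funM => //; apply/measurable_EFinP.
  by apply: measurableT_comp.
have K'0 t w : 0 <= K' t w by rewrite mule_ge0 // lee_fin.
rewrite integral_mkcond; transitivity (\int[mu]_x \int[dA]_y K' x (cx y)); last first.
  transitivity (\int[dA]_y \int[mu]_x K' x (cx y)).
    exact: (area_int_swap_line mK' K'0).
   apply: eq_integral => u _; rewrite [RHS]integral_mkcond.
  apply: eq_integral => t _; rewrite /K' /patch indicE.
  by case: ifP => _; rewrite ?mule1 ?mule0.
apply: eq_integral => t _; rewrite /K' /patch indicE; case: ifP => _.
  by apply: eq_integral => u _; rewrite mule1.
by rewrite integral0_eq // => u _; rewrite mule0.
Qed.

End plane_integral.

(** * Means of holomorphic functions over discs *)

Section compact_lebesgue_number.
Variable R : realType.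

(** Lebesgue number argument: a local property that persists when its parameter d decreases
    holds on a compact set with one d. *)
Lemma compact_uniform (T : topologicalType) (K : set T) (D : T -> R -> Prop) :
  compact K ->
  (forall x d d', d' <= d -> D x d -> D x d') ->
  (forall x, K x -> exists2 d, 0 < d & \forall y \near x, D y d) ->
  exists2 d, 0 < d & forall x, K x -> D x d.
Proof.
move=> cK Dd Dloc.
have /compact_near_coveringP H := cK.
have := H R (0^'+) (fun d x => D x d) _ => /(_ _)[].
  move=> x /Dloc[d d0 Hd]; exists ([set y | D y d], [set e | 0 < e < d]).
    split => //=; near=> e; apply/andP; split; near: e; [exact: nbhs_right_gt|exact: nbhs_right_lt].
  by move=> [y e] /= [Dy /andP[_ /ltW ed]]; exact: Dd Dy.
move=> e /= e0 He.
exists (e / 2); first by rewrite divr_gt0.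
apply: He; rewrite /ball /= ?sub0r ?normrN ?gtr0_norm ?divr_gt0 //.
by rewrite ltr_pdivrMr // ltr_pMr // ltr1n.
Unshelve. all: by end_near.
Qed.

End compact_lebesgue_number.

Section powR_facts.
Variable R : realType.
Implicit Types p x t : R.

(** The graph of x ^ p lies above its tangent at t. *)
Lemma young_tangent p x t : 1 <= p -> 0 <= x -> 0 <= t ->
  p * (t `^ (p - 1) * x) <= x `^ p + (p - 1) * t `^ p.
Proof.
rewrite le_eqVlt => /predU1P[<- x0 t0|p1 x0 t0].
  by rewrite subrr powRr0 !mul1r powRr1 // mul0r addr0.
have p0 : 0 < p by rewrite (lt_trans ltr01).
have q0 : 0 < p / (p - 1) by rewrite divr_gt0 // subr_gt0.
have H := @conjugate_powR R x (t `^ (p - 1)) p (p / (p - 1)) x0 (powR_ge0 _ _) p0 q0.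
have p1' : p - 1 != 0 by rewrite subr_eq0 gt_eqF.
have {}H : x * t `^ (p - 1) <= x `^ p / p + (t `^ (p - 1)) `^ (p / (p - 1)) / (p / (p - 1)).
  by apply: H; field; rewrite (gt_eqF p0) p1'.
rewrite -powRrM in H.
rewrite (_ : (p - 1) * (p / (p - 1)) = p) in H; last by field.
rewrite -(ler_pM2l p0) in H; rewrite mulrC [_ * x]mulrC mulrC; apply: le_trans H _.
apply: le_of_eq; field.
by rewrite p1' gt_eqF.
Qed.

End powR_facts.

Section area_means.
Variable R : realType.
Notation mu := (@lebesgue_measure R).
Notation dA := (@lebesgue_measure R \x @lebesgue_measure R)%E.
Local Open Scope complex_scope.
Notation C := R[i].
Implicit Types (phi : C -> R) (F : C -> C).

Definition darea (r : R) : \bar R := area_int (fun z => (disk 0 r z)%:E).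

Lemma mC_EFin phi : mC phi -> mC (fun z => (phi z)%:E).
Proof. by move=> H; apply/measurable_EFinP. Qed.

Lemma mCM phi psi : mC phi -> mC psi -> mC (fun z => phi z * psi z).
Proof. by move=> H1 H2; apply: measurable_funM. Qed.

Lemma darea_ge (r : R) : 0 < r -> ((r ^+ 2)%:E <= darea r)%E.
Proof.
move=> r0; have r2 : - (r / 2) < r / 2 by rewrite gtrN // divr_gt0.
pose I : set R := `](- (r/2)), (r/2)[%classic; set S : set (R * R) := I `*` I.
have mS : measurable S by apply: measurableX; exact: measurable_itv.
have -> : ((r ^+ 2)%:E = dA S)%E.
  transitivity (mu I * mu I)%E; last first.
    by apply/esym/product_measure1E; exact: measurable_itv.
  rewrite /I lebesgue_measure_itv /= lte_fin ifT; last exact: r2.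
  by rewrite -EFinD -EFinM; congr EFin; field.
rewrite -[S]setIT -integral_indic // /darea /area_int.
apply: le_integral_ge0 => [u|[x y]]; first by rewrite lee_fin.
rewrite lee_fin indicE; case: (boolP (_ \in _)) => [|_]; last exact: disk_ge0.
rewrite inE /S /I /= !in_itv /= => -[/andP[x1 x2] /andP[y1 y2]].
rewrite /disk subr0 (le_lt_trans (normc_le _)) // /cx /=.
have : `|x| < r / 2 by rewrite ltr_norml x1.
have : `|y| < r / 2 by rewrite ltr_norml y1.
by clear; lra.
Qed.

Lemma darea_le (r : R) : 0 < r -> (darea r <= (4 * r ^+ 2)%:E)%E.
Proof.
move=> r0; have r2 : - r < r by rewrite gtrN.
pose I : set R := `](- r), r[%classic; set S : set (R * R) := I `*` I.
have mS : measurable S by apply: measurableX; exact: measurable_itv.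
have -> : ((4 * r ^+ 2)%:E = dA S)%E.
  transitivity (mu I * mu I)%E; last first.
    by apply/esym/product_measure1E; exact: measurable_itv.
  rewrite /I lebesgue_measure_itv /= lte_fin ifT; last exact: r2.
  by rewrite -EFinD -EFinM; congr EFin; ring.
rewrite -[S]setIT -integral_indic // /darea /area_int.
apply: le_integral_ge0 => [u|[x y]]; first by rewrite lee_fin disk_ge0.
rewrite lee_fin indicE /disk subr0; case: ltP => [H|_]; last exact: ler0n.
rewrite mem_set // /S /I /= !in_itv /= -!ltr_norml; split.
  exact: le_lt_trans (normRe (cx (x, y))) H.
exact: le_lt_trans (normIm (cx (x, y))) H.
Qed.

Lemma darea_fin (r : R) : 0 < r -> darea r = (fine (darea r))%:E /\
  r ^+ 2 <= fine (darea r) <= 4 * r ^+ 2.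
Proof.
move=> r0; have H1 := darea_ge r0; have H2 := darea_le r0.
have E : darea r = (fine (darea r))%:E.
  by rewrite fineK // fin_numE; apply/andP; split; apply/eqP => E; rewrite E in H1 H2.
by split=> //; rewrite E !lee_fin in H1 H2; rewrite H1.
Qed.

Lemma rot_average (phi : C -> R) : mC phi -> (forall z, 0 <= phi z) ->
  (area_int (fun z => \int[mu]_(t in `[0%R, (2 * pi)%R]) (phi (cis t * z))%:E) =
   (2 * pi)%:E * area_int (fun z => (phi z)%:E))%E.
Proof.
move=> mphi phi0.
rewrite -(@area_int_swap1 R (2 * pi) (fun t z => (phi (cis t * z))%:E)); last 2 first.
- apply/measurable_EFinP.
  pose h (w : R * (R * R)) := (cos w.1 * w.2.1 - sin w.1 * w.2.2,
     cos w.1 * w.2.2 + sin w.1 * w.2.1).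
  rewrite (_ : (fun w => _) = (fun u => phi (cx u)) \o h); last first.
    by apply/funext => w; congr phi; apply/eqP; rewrite eq_complex /= !eqxx.
  have mcos : measurable_fun [set: R * (R * R)] (fun w : R * (R * R) => cos w.1).
    apply: measurableT_comp => //; apply: continuous_measurable_fun; exact: continuous_cos.
  have msin : measurable_fun [set: R * (R * R)] (fun w : R * (R * R) => sin w.1).
    apply: measurableT_comp => //; apply: continuous_measurable_fun; exact: continuous_sin.
  have m1 : measurable_fun [set: R * (R * R)] (fun w : R * (R * R) => w.2.1).
    exact: measurableT_comp.
  have m2 : measurable_fun [set: R * (R * R)] (fun w : R * (R * R) => w.2.2).
    exact: measurableT_comp.
  apply: measurableT_comp mphi _; apply: measurable_fun_pair.
    by apply: measurable_funB; apply: measurable_funM.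
  by apply: measurable_funD; apply: measurable_funM.
- by move=> t z; rewrite lee_fin.
rewrite (eq_integral (fun=> area_int (fun z => (phi z)%:E))); last first.
  move=> t _; rewrite (@area_int_rot R (fun z => (phi z)%:E) t) //; exact: mC_EFin.
rewrite integral_cst //= lebesgue_measure_itv /= lte_fin ifT ?mulr_gt0 ?pi_gt0 //.
by rewrite sube0 muleC.
Qed.

(** Averaging over rotations does not change an area integral, so bounds by circular means
    integrate to bounds over the disk. *)
Lemma circle_to_disk (r : R) (k : C -> R) (H : C -> R) :
  mC k -> (forall z, 0 <= k z) -> (forall z, 0 <= H z) ->
  mC (fun z => disk 0 r z * H z) ->
  (forall z, normc z < r -> cont_on 0 (2 * pi) (fun t => H (cis t * z))) ->
  (forall z, normc z < r -> k z * (2 * pi) <= Iab 0 (2 * pi) (fun t => H (cis t * z))) ->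
  (area_int (fun z => (disk 0 r z * k z)%:E) <= area_int (fun z => (disk 0 r z * H z)%:E))%E.
Proof.
move=> mk k0 H0 mH cH kH.
have p0 : 0 < 2 * pi :> R by rewrite mulr_gt0 // pi_gt0.
rewrite -(@lee_pmul2l _ (2 * pi)%:E) ?ltry ?lte_fin //.
have dH0 z : 0 <= disk 0 r z * H z by rewrite mulr_ge0 ?disk_ge0.
rewrite -(rot_average mH dH0) -area_intZ; first last.
- by move=> z; rewrite lee_fin mulr_ge0 ?disk_ge0.
- by apply: mC_EFin; apply: mCM => //; exact: measurable_disk.
- exact: ltW.
apply: area_int_le => z.
  by rewrite -EFinM lee_fin mulr_ge0 ?(ltW p0) // mulr_ge0 ?disk_ge0.
have dE t : disk 0 r (cis t * z) = disk 0 r z.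
  by rewrite /disk !subr0 normcM normc_cis mul1r.
under eq_integral do rewrite dE.
rewrite /disk subr0; case: ltP => zr; last first.
  by rewrite mul0r mule0; apply: integral_ge0 => t _; rewrite mul0r.
rewrite mul1r; under eq_integral do rewrite mul1r.
apply: (@le_trans _ _ (Iab 0 (2 * pi) (fun t => H (cis t * z)))%:E).
  by rewrite -EFinM lee_fin mulrC; exact: kH.
rewrite /Iab /Rintegral fineK //.
have := cont_on_integrable (cH z zr) => /integrable_fin_num; exact.
Qed.

Definition holo_cont (F : C -> C) (r : R) (Fh : holo r F) w (wr : normc w < r) : ccont F w :=
  let: ex_intro c Hc := Fh w wr in cdiff_cont Hc.

Lemma measurable_disk_holo (F : C -> C) (r : R) (phi : C -> R) : holo r F ->
  (forall u v, `|phi u - phi v| <= normc (u - v)) -> (forall u, 0 <= phi u) ->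
  mC (fun z => disk 0 r z * phi (F z)).
Proof.
move=> Fh phi1 phi0.
rewrite (_ : (fun z => _) = (fun z => (normc z < r)%R%:R * phi (F z))).
  apply: measurable_cont_on_disk => // z zr e e0.
  have [d d0 Hd] := holo_cont Fh zr e0; exists d => // k /Hd.
  exact: le_trans (phi1 _ _).
by apply/funext => z; rewrite /disk subr0.
Qed.

Lemma disk_mean_le (F : C -> C) (r : R) : holo r F ->
  ((normc (F 0))%:E * darea r <= area_int (fun z => (disk 0 r z * normc (F z))%:E))%E.
Proof.
move=> Fh; rewrite /darea -area_intZ ?normc_ge0 //; last 2 first.
- by apply: mC_EFin; exact: measurable_disk.
- by move=> z; rewrite lee_fin disk_ge0.
under [X in (area_int X <= _)%E]eq_fun do rewrite -EFinM mulrC.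
apply: (circle_to_disk (k := fun=> normc (F 0)) (H := fun z => normc (F z))).
- exact: measurable_cst.
- by move=> z; exact: normc_ge0.
- by move=> z; exact: normc_ge0.
- by apply: measurable_disk_holo => // [u v|u]; [exact: normc_dist_le|exact: normc_ge0].
- move=> z zr; apply: cont_on_cis; last exact: normc_dist_le.
  by move=> t; apply: (holo_cont Fh); rewrite normcM normc_cis mul1r.
- by move=> z; exact: circle_mean_le.
Qed.

Lemma disk_deriv_le (F : C -> C) (r : R) c : 0 < r -> holo r F -> cdiff F 0 c ->
  ((normc c * r ^+ 3 / 16)%:E <= area_int (fun z => (disk 0 r z * normc (F z - F 0))%:E))%E.
Proof.
move=> r0 Fh Fc.
apply: (@le_trans _ _ (area_int (fun z => (disk 0 r z * (normc c * normc z))%:E))); last first.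
  apply: (circle_to_disk (k := fun z => normc c * normc z) (H := fun z => normc (F z - F 0))).
  - by apply: measurable_funM; [exact: measurable_cst|exact: measurable_normc].
  - by move=> z; rewrite mulr_ge0 ?normc_ge0.
  - by move=> z; exact: normc_ge0.
  - apply: (@measurable_disk_holo F r (fun u => normc (u - F 0))) => //.
      move=> u v; apply: le_trans (normc_dist_le _ _) _.
      by rewrite (_ : _ - _ = u - v) //; ring.
    by move=> u; exact: normc_ge0.
  - move=> z zr; apply: (@cont_on_cis _ F z _ _ (fun u => normc (u - F 0))).
      by move=> t; apply: (holo_cont Fh); rewrite normcM normc_cis mul1r.
    move=> u v; apply: le_trans (normc_dist_le _ _) _.
    by rewrite (_ : _ - _ = u - v) //; ring.
  - by move=> z zr; exact: (circle_deriv_le Fh zr Fc).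
have r2 : - (r / 2) < r / 2 by rewrite gtrN // divr_gt0.
(* |z| >= r / 4 on a rectangle of area r ^ 2 / 4 inside the disk *)
have r4 : r / 4 < r / 2 by rewrite ltr_pM2l // ltf_pV2 ?posrE // ltr_nat.
pose I : set R := `](r / 4), (r / 2)[%classic; pose J : set R := `](- (r/2)), (r/2)[%classic.
set S : set (R * R) := I `*` J.
have mS : measurable S by apply: measurableX; exact: measurable_itv.
have SE : (dA S = (r ^+ 2 / 4)%:E)%E.
  transitivity (mu I * mu J)%E.
    by apply: product_measure1E; exact: measurable_itv.
  rewrite /I /J !lebesgue_measure_itv /= !lte_fin ifT; last exact: r4.
  rewrite ifT; last exact: r2.
  by rewrite -!EFinD -EFinM; congr EFin; field.
have -> : ((normc c * r ^+ 3 / 16)%:E = \int[dA]_u ((normc c * (r / 4))%:E * (\1_S u)%:E))%E.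
  rewrite ge0_integralZl_EFin //; last 2 first.
  - by apply/measurable_EFinP; exact: measurable_indic.
  - by rewrite mulr_ge0 ?normc_ge0 // divr_ge0 // ltW.
  rewrite integral_indic // setIT [X in (_ * X)%E](_ : _ = (r ^+ 2 / 4)%:E); last exact: SE.
  by rewrite -EFinM; congr EFin; field.
apply: le_integral_ge0 => [u|[x y]].
  by rewrite -EFinM lee_fin mulr_ge0 // mulr_ge0 ?normc_ge0 // divr_ge0 // ltW.
rewrite -EFinM lee_fin indicE; case: (boolP (_ \in _)) => [|_]; last first.
  by rewrite mulr0 mulr_ge0 ?disk_ge0 // mulr_ge0 ?normc_ge0.
rewrite inE /S /I /J /= !in_itv /= => -[/andP[x1 x2] /andP[y1 y2]].
have x0 : 0 < x by rewrite (lt_trans _ x1) // divr_gt0.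
have d1 : normc (cx (x, y) - 0) < r.
  rewrite subr0 (le_lt_trans (normc_le _)) // /cx /= (gtr0_norm x0).
  have : `|y| < r / 2 by rewrite ltr_norml y1.
  by move: x2; clear; lra.
rewrite /disk d1 mul1r mulr1 ler_wpM2l ?normc_ge0 //.
by have := normRe (cx (x, y)); rewrite /= (gtr0_norm x0); apply: le_trans; exact: ltW.
Qed.

End area_means.

Section holomorphic_area_estimates.
Variable R : realType.
Notation mu := (@lebesgue_measure R).
Notation dA := (@lebesgue_measure R \x @lebesgue_measure R)%E.
Local Open Scope complex_scope.
Notation C := R[i].
Implicit Types (phi : C -> R) (F : C -> C).

Lemma mCp phi (p : R) : mC phi -> mC (fun z => phi z `^ p).
Proof. by move=> mphi; exact: (measurableT_comp (measurable_powR p) mphi). Qed.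

Lemma mC_EFinZ phi (k : R) : mC phi -> mC (fun z => k%:E * (phi z)%:E)%E.
Proof.
move=> mphi; rewrite (_ : (fun z => _) = (fun z => (k * phi z)%:E)).
  by apply: mC_EFin; apply: mCM => //; exact: measurable_cst.
by apply/funext => z; rewrite EFinM.
Qed.

(** Jensen's inequality, integrating the tangent bound at theta. The mass of chi
    enters with a negative sign there, so that an upper bound N of it serves. *)
Lemma jensen_integral d (T : measurableType d) (m : {measure set T -> \bar R})
    (p theta N : R) (chi h : T -> R) : 1 <= p -> 0 <= theta ->
  measurable_fun setT chi -> measurable_fun setT h ->
  (forall x, 0 <= chi x) -> (forall x, 0 <= h x) ->
  (\int[m]_x (chi x)%:E <= N%:E)%E ->
  ((theta * N)%:E <= \int[m]_x (chi x * h x)%:E)%E ->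
  ((theta `^ p * N)%:E <= \int[m]_x (chi x * h x `^ p)%:E)%E.
Proof.
move=> p1 t0 mchi mh chi0 h0 chiN H.
have p0 : 0 <= p by rewrite (le_trans ler01).
have ch0 x : 0 <= chi x * h x `^ p by rewrite mulr_ge0 // powR_ge0.
have mhp : measurable_fun setT (fun x => h x `^ p).
  exact: (measurableT_comp (measurable_powR p) mh).
have mchi' : measurable_fun setT (fun x => (chi x)%:E) by apply/measurable_EFinP.
have mchh : measurable_fun setT (fun x => (chi x * h x)%:E).
  by apply/measurable_EFinP; exact: measurable_funM.
have mchp : measurable_fun setT (fun x => (chi x * h x `^ p)%:E).
  by apply/measurable_EFinP; exact: measurable_funM.
have [oo|fin] := eqVneq (\int[m]_x (chi x * h x `^ p)%:E)%E +oo%E.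
  by rewrite oo leey.
set X := (\int[m]_x (chi x * h x `^ p)%:E)%E in fin *.
have X0 : (0 <= X)%E by apply: integral_ge0 => x _; rewrite lee_fin.
have XE : X = (fine X)%:E by rewrite fineK // ge0_fin_numE // lt_neqAle fin leey.
have pt0 : 0 <= p * theta `^ (p - 1) by rewrite mulr_ge0 ?powR_ge0.
have qt0 : 0 <= (p - 1) * theta `^ p by rewrite mulr_ge0 ?powR_ge0 // subr_ge0.
have K : ((p * theta `^ (p - 1))%:E * (\int[m]_x (chi x * h x)%:E) <=
   X + ((p - 1) * theta `^ p)%:E * (\int[m]_x (chi x)%:E))%E.
  rewrite -ge0_integralZl_EFin //; last by move=> x _; rewrite lee_fin mulr_ge0.
  rewrite -ge0_integralZl_EFin //; last by move=> x _; rewrite lee_fin.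
  rewrite -ge0_integralD //; last 3 first.
  - by move=> x _; rewrite lee_fin.
  - by move=> x _; rewrite -EFinM lee_fin mulr_ge0.
  - by apply: emeasurable_funM => //; exact: measurable_cst.
  apply: le_integral_ge0 => x; first by rewrite -EFinM lee_fin mulr_ge0 // mulr_ge0.
  rewrite -!EFinM -EFinD lee_fin.
  have := ler_wpM2l (chi0 x) (young_tangent p1 (h0 x) t0); clear.
  move: (theta `^ _) (h x `^ p) (theta `^ _) => u y w; lra.
have pt0' : (0 <= (p * theta `^ (p - 1))%:E)%E by rewrite lee_fin.
have qt0' : (0 <= ((p - 1) * theta `^ p)%:E)%E by rewrite lee_fin.
have K' := le_trans (lee_wpmul2l pt0' H) (le_trans K (leeD2l X (lee_wpmul2l qt0' chiN))).
move: K'; rewrite XE -!EFinM -EFinD !lee_fin.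
have tE : theta `^ (p - 1) * theta = theta `^ p.
  by rewrite mulrC mulr_powRB1 // (lt_le_trans ltr01).
rewrite (_ : p * _ * _ = p * (theta `^ (p - 1) * theta) * N); last by ring.
rewrite tE; clear; move: (theta `^ p) (fine X) => a b; lra.
Qed.

Lemma jensen_area (p theta A : R) (chi h : C -> R) : 1 <= p -> 0 <= theta ->
  mC chi -> mC h -> (forall z, 0 <= chi z) -> (forall z, 0 <= h z) ->
  area_int (fun z => (chi z)%:E) = A%:E ->
  ((theta * A)%:E <= area_int (fun z => (chi z * h z)%:E))%E ->
  ((theta `^ p * A)%:E <= area_int (fun z => (chi z * h z `^ p)%:E))%E.
Proof.
move=> p1 t0 mchi mh chi0 h0 chiA H.
apply: (@jensen_integral _ _ dA p theta A (fun u => chi (cx u)) (fun u => h (cx u))) => //.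
by rewrite -chiA.
Qed.

Lemma holo_shift F a (r : R) : holo 1 F -> normc a + r <= 1 ->
  holo r (fun z => F (a + z)).
Proof.
move=> Fh ar z zr; have [|c Hc] := Fh (a + z).
  by rewrite (le_lt_trans (normcD _ _)) // (lt_le_trans _ ar) // ltrD2l.
exists (c * (0 + 1)); apply: (cdiff_comp (F := F) (G := fun z => a + z)) => //.
by apply: cdiffD; [exact: cdiff_cst|exact: cdiff_id].
Qed.

Lemma cdiff_shift F a c : cdiff F a c -> cdiff (fun z => F (a + z)) 0 c.
Proof.
move=> H e /H[d d0 Hd]; exists d => // k /Hd; by rewrite add0r addr0.
Qed.

Lemma disk_shift a (r : R) (phi : C -> R) : mC (fun z => disk 0 r z * phi (a + z)) ->
  (forall z, 0 <= phi z) ->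
  area_int (fun z => (disk 0 r z * phi (a + z))%:E) =
  area_int (fun z => (disk a r z * phi z)%:E).
Proof.
move=> mphi phi0.
pose psi z := (disk a r z * phi z)%:E.
have E z : (disk 0 r z * phi (a + z))%:E = psi (z + a).
  by rewrite /psi /disk subr0 addrK [a + z]addrC.
have E' z : psi z = (disk 0 r (z - a) * phi (a + (z - a)))%:E.
  by rewrite E subrK.
under eq_fun do rewrite E.
rewrite area_int_trans // => [|z]; last by rewrite lee_fin mulr_ge0 // disk_ge0.
have := @mC_linear R _ _ (fun z => (disk 0 r z * phi (a + z))%:E) 1 (- a) (mC_EFin mphi).
rewrite /mC; under eq_fun do rewrite mul1r -E'; exact.
Qed.

Lemma darea_shift a (r : R) : area_int (fun z => (disk a r z)%:E) = darea r.
Proof.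
have m1 : mC (fun z : C => disk 0 r z * 1 : R).
  by under eq_fun do rewrite mulr1; exact: measurable_disk.
have := @disk_shift a r (fun=> 1) m1 (fun=> ler01); rewrite /darea.
by under eq_fun do rewrite mulr1; under [in RHS]eq_fun do rewrite mulr1.
Qed.

Lemma measurable_disk_shift F a (r : R) (phi : C -> R) : holo 1 F -> normc a + r <= 1 ->
  (forall u v, `|phi u - phi v| <= normc (u - v)) -> (forall u, 0 <= phi u) ->
  mC (fun z => disk 0 r z * phi (F (a + z))).
Proof. by move=> Fh ar; apply: measurable_disk_holo; exact: holo_shift. Qed.

Lemma mC_disk_powR (r p : R) (H : C -> R) : (forall z, 0 <= H z) -> 0 < p ->
  mC (fun z => disk 0 r z * H z) -> mC (fun z => disk 0 r z * H z `^ p).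
Proof.
move=> H0 p0 /(mCp p) mH; rewrite (_ : (fun z => _) = (fun z => (disk 0 r z * H z) `^ p)) //.
apply/funext => z; rewrite /disk; case: (_ < _)%R; first by rewrite !mul1r.
by rewrite !mul0r powR0 // gt_eqF.
Qed.

Lemma jensen_disk F a (p theta r : R) : 1 <= p -> 0 <= theta -> holo 1 F -> 0 < r ->
  normc a + r <= 1 ->
  (theta%:E * darea r <= area_int (fun z => (disk 0 r z * normc (F (a + z)))%:E))%E ->
  ((theta `^ p)%:E * darea r <= area_int (fun z => (disk a r z * normc (F z) `^ p)%:E))%E.
Proof.
move=> p1 t0 Fh r0 ar H.
have p0 : 0 < p by rewrite (lt_le_trans ltr01).
have [E _] := darea_fin r0; rewrite E -EFinM in H *.
have mH : mC (fun z => disk 0 r z * normc (F (a + z))).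
  by apply: measurable_disk_shift => // [u v|u]; [exact: normc_dist_le|exact: normc_ge0].
have n0 z : 0 <= normc (F (a + z)) by exact: normc_ge0.
rewrite -disk_shift; last 2 first.
- exact: mC_disk_powR.
- by move=> z; exact: powR_ge0.
have dd z : disk 0 r z * disk 0 r z = disk 0 r z.
  by rewrite /disk; case: (_ < _)%R; rewrite ?mul1r ?mul0r.
have := @jensen_area p theta (fine (darea r)) (disk 0 r)
   (fun z => disk 0 r z * normc (F (a + z))) p1 t0 (@measurable_disk R 0 r) mH.
move=> /(_ (disk_ge0 0 r) (fun z => mulr_ge0 (disk_ge0 0 r z) (n0 z)) E).
under eq_fun do rewrite mulrA dd.
move=> /(_ H) /le_trans; apply.
apply: area_int_le => z; first by rewrite lee_fin mulr_ge0 ?disk_ge0 ?powR_ge0.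
rewrite lee_fin /disk; case: (_ < _)%R; last by rewrite !mul0r.
by rewrite !mul1r.
Qed.

(** Cauchy's estimate in the mean: the derivative at a is controlled by the mean of |F - F a|,
    hence by that of |F| and by |F a|, and |F a| is itself at most the mean of |F|. Jensen's
    inequality then passes to the power p. *)
Lemma deriv_powR F a c (p r : R) : 1 <= p -> holo 1 F -> 0 < r -> normc a + r <= 1 ->
  cdiff F a c ->
  (((normc c * r / 128) `^ p * r ^+ 2)%:E <= area_int (fun z => (disk a r z * normc (F z) `^ p)%:E))%E.
Proof.
move=> p1 Fh r0 ar Fc.
have [E /andP[A1 A2]] := darea_fin r0.
have H0 : 0 <= normc c * r / 128 by rewrite divr_ge0 // mulr_ge0 ?normc_ge0 // ltW.
apply: (@le_trans _ _ (((normc c * r / 128) `^ p)%:E * darea r)%E).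
  by rewrite E -EFinM lee_fin ler_wpM2l // powR_ge0.
apply: jensen_disk => //.
have B1 := disk_deriv_le r0 (holo_shift Fh ar) (cdiff_shift Fc); rewrite addr0 in B1.
have B2 := disk_mean_le (holo_shift Fh ar); rewrite addr0 in B2.
set X := area_int (fun z => (disk 0 r z * normc (F (a + z)))%:E) in B2 *.
have mH : mC (fun z => disk 0 r z * normc (F (a + z))).
  by apply: measurable_disk_shift => // [u v|u]; [exact: normc_dist_le|exact: normc_ge0].
have B3 : (area_int (fun z => (disk 0 r z * normc (F (a + z) - F a))%:E) <=
   X + (normc (F a))%:E * darea r)%E.
  rewrite /darea -area_intZ ?normc_ge0 //; last 2 first.
  - by apply: mC_EFin; exact: measurable_disk.
  - by move=> z; rewrite lee_fin disk_ge0.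
  rewrite -area_intD; last 4 first.
  - exact: mC_EFin.
  - by apply: mC_EFinZ; exact: measurable_disk.
  - by move=> z; rewrite lee_fin mulr_ge0 ?disk_ge0 ?normc_ge0.
  - by move=> z; rewrite -EFinM lee_fin mulr_ge0 ?disk_ge0 ?normc_ge0.
  apply: area_int_le => z; first by rewrite lee_fin mulr_ge0 ?disk_ge0 ?normc_ge0.
  by rewrite -EFinM -EFinD lee_fin [normc (F a) * _]mulrC -mulrDr ler_wpM2l ?disk_ge0 // normcB.
have [oo|fin] := eqVneq X +oo%E; first by rewrite oo leey.
have X0 : (0 <= X)%E by apply: area_int_ge0 => z; rewrite lee_fin mulr_ge0 ?disk_ge0 ?normc_ge0.
have XE : X = (fine X)%:E by rewrite fineK // ge0_fin_numE // lt_neqAle fin leey.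
have := le_trans B1 B3; move: B2; rewrite XE E -!EFinM -EFinD !lee_fin.
move: (fine X) (fine _) A1 A2 => x A A1 A2 B2 B4.
have cr : 0 <= normc c * r by rewrite mulr_ge0 ?normc_ge0 // ltW.
have : normc c * r * A <= normc c * r * (4 * r ^+ 2) by rewrite ler_wpM2l.
by clear - B2 B4; rewrite !exprS expr0 in B4 *; lra.
Qed.

End holomorphic_area_estimates.

(** * Continuity of the derivative *)

Section continuity_of_derivative.
Variable R : realType.
Local Open Scope complex_scope.
Notation C := R[i].
Implicit Types (F : C -> C).

Lemma cx_near (u : R * R) (d : R) : 0 < d ->
  \forall v \near u, normc (cx v - cx u) < d.
Proof.
move=> d0; have d2 : 0 < d / 2 by rewrite divr_gt0.
apply/nbhs_ballP; exists (d / 2) => //= v [].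
rewrite /ball /= => h1 h2; apply: (le_lt_trans (normc_le _)); rewrite /cx /=.
by rewrite (splitr d) ltrD // distrC.
Qed.

Lemma uniform_cont_square F (u : R * R) (r : R) : 0 < r ->
  (forall v, `|v.1 - u.1| <= r -> `|v.2 - u.2| <= r -> ccont F (cx v)) ->
  forall e : R, 0 < e -> exists2 d : R, 0 < d &
  forall v k, `|v.1 - u.1| <= r -> `|v.2 - u.2| <= r -> normc k < d ->
     normc (F (cx v + k) - F (cx v)) <= e.
Proof.
move=> r0 Fc e e0; have e2 : 0 < e / 2 by rewrite divr_gt0.
pose K : set (R * R) := `[u.1 - r, u.1 + r] `*` `[u.2 - r, u.2 + r].
have cK : compact K by apply: compact_setX; exact: segment_compact.
have KE v : K v <-> `|v.1 - u.1| <= r /\ `|v.2 - u.2| <= r.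
  by rewrite /K /= !in_itv /= !ler_distl.
have [|x Kx|d d0 Hd] := @compact_uniform R _ K
   (fun v d => forall k, normc k < d -> normc (F (cx v + k) - F (cx v)) <= e) cK.
- by move=> x d d' dd H k kd; apply: H; exact: lt_le_trans kd dd.
- have [/Fc h1 /h1] := (KE x).1 Kx; move/(_ _ e2) => [d d0 Hd].
  have d2 : 0 < d / 2 by rewrite divr_gt0.
  exists (d / 2) => //; have := cx_near x d2; apply: filterS => y yx k kd.
  have -> : F (cx y + k) - F (cx y) =
     (F (cx x + (cx y - cx x + k)) - F (cx x)) - (F (cx x + (cx y - cx x)) - F (cx x)).
    by rewrite addrA !subrKC; ring.
  apply: (le_trans (normcB _ _)); rewrite (splitr e); apply: lerD; apply: Hd.
    by rewrite (le_lt_trans (normcD _ _)) // (splitr d) ltrD.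
  by rewrite (lt_trans yx) // ltr_pdivrMr // ltr_pMr // ltr1n.
by exists d => // v k v1 v2; apply: Hd; apply/KE.
Qed.

(** Cauchy's estimate for z |-> F (z + k) - F z, which is uniformly small for small k. *)
Lemma cdiff_deriv_cont F (F1 : C -> C) (a : C) :
  (forall z, normc z < 1 -> cdiff F z (F1 z)) -> normc a < 1 -> ccont F1 a.
Proof.
move=> HF a1; pose r := (1 - normc a) / 4.
have r0 : 0 < r by rewrite divr_gt0 // subr_gt0.
have Fh : holo 1 F by move=> w /HF; exists (F1 w).
pose u : R * R := (complex.Re a, complex.Im a).
have uE : cx u = a by rewrite /cx /u; case: (a).
have dist v : `|v.1 - u.1| <= r -> `|v.2 - u.2| <= r -> normc (cx v) < 1.
  move=> v1 v2; have : normc (cx v - a) <= r + r.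
    by rewrite -uE (le_trans (normc_le _)) // lerD.
  have := normc_dist (cx v) a; have : 1 - normc a = 4 * r by rewrite /r; field.
  by clear - r0; lra.
move=> e e0; have e1 : 0 < e * r / 128 by rewrite divr_gt0 // mulr_gt0.
have [|d d0 Hd] := @uniform_cont_square F u r r0 _ _ e1.
  by move=> v v1 v2; apply: cdiff_cont; apply: HF; exact: dist.
exists (Num.min d r); first by rewrite lt_min d0.
move=> k; rewrite lt_min => /andP[kd kr].
pose G z := F (a + k + z) + (- 1) * F (a + z).
have ar : normc a + r <= 1.
  have : 1 - normc a = 4 * r by rewrite /r; field.
  by clear - r0; lra.
have akr : normc (a + k) + r <= 1.
  have := normcD a k; have : 1 - normc a = 4 * r by rewrite /r; field.
  by clear - r0 kr; lra.
have Gh : holo r G.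
  move=> z zr; have [c1 H1] := holo_shift Fh akr zr; have [c2 H2] := holo_shift Fh ar zr.
  eexists; apply: cdiffD; first exact: H1.
  by apply: cdiffM; [exact: cdiff_cst|exact: H2].
have ak1 : normc (a + k) < 1.
  by rewrite (lt_le_trans _ akr) // ltrDl.
have Gd : cdiff G 0 (F1 (a + k) - F1 a).
  have -> : F1 (a + k) - F1 a = F1 (a + k) + (0 * F (a + 0) + (- 1) * F1 a) by ring.
  apply: cdiffD; first exact/cdiff_shift/HF.
  by apply: cdiffM; [exact: cdiff_cst|exact/cdiff_shift/HF].
have := disk_deriv_le r0 Gh Gd.
have Gsmall z : normc z < r -> normc (G z) <= e * r / 128.
  move=> zr; have -> : G z = F (cx (complex.Re (a + z), complex.Im (a + z)) + k) -
     F (cx (complex.Re (a + z), complex.Im (a + z))).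
    have -> : cx (complex.Re (a + z), complex.Im (a + z)) = a + z by rewrite /cx; case: (a + z).
    by rewrite /G [a + z + k]addrAC mulN1r.
  have zE : a + z - a = z by ring.
  apply: Hd => //=.
    by rewrite -Re_sub zE; apply: le_trans (normRe z) _; exact: ltW.
  have -> : complex.Im (a + z) - complex.Im a = complex.Im z.
    by case: (a) (z) => [? ?] [? ?] /=; ring.
  by apply: le_trans (normIm z) _; exact: ltW.
move/le_trans => /(_ ((2 * (e * r / 128)) * (4 * r ^+ 2))%:E).
rewrite lee_fin => H.
have {H} : normc (F1 (a + k) - F1 a) * r ^+ 3 / 16 <= 2 * (e * r / 128) * (4 * r ^+ 2).
  apply: H; have [E /andP[_ A2]] := darea_fin r0.
  apply: (@le_trans _ _ ((2 * (e * r / 128))%:E * darea r)%E).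
    rewrite /darea -area_intZ; last 3 first.
    - by rewrite mulr_ge0 // ltW.
    - by apply: mC_EFin; exact: measurable_disk.
    - by move=> z; rewrite lee_fin disk_ge0.
    apply: area_int_le => z; first by rewrite lee_fin mulr_ge0 ?disk_ge0 ?normc_ge0.
    rewrite -EFinM lee_fin mulrC /disk subr0; case: ltP => zr; last by rewrite !mulr0.
    rewrite !mulr1 (le_trans (normcB _ _)) //.
    have := Gsmall 0; rewrite normc0 => /(_ r0); have := Gsmall z zr.
    by clear; lra.
  by rewrite E -EFinM lee_fin ler_wpM2l // mulr_ge0 // ltW.
have r3 : 0 < r ^+ 3 by rewrite exprn_gt0.
have -> : 2 * (e * r / 128) * (4 * r ^+ 2) = e * r ^+ 3 / 16 by field.
by rewrite ler_pM2r // ler_pM2r.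
Qed.

End continuity_of_derivative.

(** * Sublevel sets of holomorphic functions *)

Section riemann_sums.
Variable R : realType.
Notation mu := (@lebesgue_measure R).
Implicit Types (f psi : R -> R).

Lemma Iab_shift (T a b : R) psi : continuous psi -> (forall t, 0 <= psi t) ->
  (forall t, psi (t + T) = psi t) -> Iab (a + T) (b + T) psi = Iab a b psi.
Proof.
move=> cpsi psi0 per; rewrite /Iab /Rintegral; congr fine.
rewrite [LHS]integral_mkcond [RHS]integral_mkcond.
have mp : measurable_fun [set: R] psi by exact: continuous_measurable_fun.
rewrite -[LHS]mul1e -{1}[1%R]invr1 -(@lebesgue_affine R 1 T) //.
- apply: eq_integral => x _; rewrite /patch mul1r.
  have -> : (x + T \in `[a + T, b + T]%classic) = (x \in `[a, b]%classic).
    by apply/idP/idP; rewrite !inE /= !in_itv /= !lerD2r.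
  by rewrite per.
- apply/(measurable_restrictT _ _).1 => //; apply/measurable_EFinP.
  exact: measurable_funS mp.
- by move=> x; rewrite /patch; case: ifP => _ //; rewrite lee_fin.
Qed.

Lemma Iab_periodic (T t : R) psi : continuous psi -> (forall t, 0 <= psi t) ->
  (forall t, psi (t + T) = psi t) -> 0 <= t <= T -> Iab t (t + T) psi = Iab 0 T psi.
Proof.
move=> cpsi psi0 per /andP[t0 tT].
have c a b : cont_on a b psi by move=> x _; exact: cpsi.
rewrite (@Iab_split _ t T (t + T)) ?lerDr // ?(le_trans t0 tT) //.
rewrite (@Iab_split _ 0 t T) //.
by rewrite -{2}[T]add0r Iab_shift // addrC.
Qed.

Lemma riemann_sum_le (t h e : R) (N : nat) psi : 0 <= h -> continuous psi ->
  (forall k, (k < N)%N -> forall s, 0 <= s <= h ->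
     `|psi (t + k%:R * h + s) - psi (t + k%:R * h)| <= e) ->
  (\sum_(k < N) (psi (t + k%:R * h) - e)) * h <= Iab t (t + N%:R * h) psi.
Proof.
move=> h0 cpsi; elim: N => [|N IH] H.
  by rewrite big_ord0 !mul0r addr0 /Iab set_itv1 Rintegral_set1.
have c a b : cont_on a b psi by move=> x _; exact: cpsi.
have sh : t + N.+1%:R * h = t + N%:R * h + h by rewrite -natr1 mulrDl mul1r addrA.
rewrite big_ord_recr /= mulrDl sh (@Iab_split _ t (t + N%:R * h)) ?lerDl ?mulr_ge0 ?ler0n //.
apply: lerD; first by apply: IH => k kN; apply: H; exact: ltnW.
have le1 : t + N%:R * h <= t + N%:R * h + h by rewrite lerDl.
have := @Iab_approx R _ _ psi (psi (t + N%:R * h)) e le1 (c _ _) _.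
rewrite (_ : t + N%:R * h + h - (t + N%:R * h) = h); last by ring.
rewrite ler_norml => H1.
have {H1} /H1/andP[+ _] : forall x, t + N%:R * h <= x <= t + N%:R * h + h ->
    `|psi x - psi (t + N%:R * h)| <= e.
  move=> x /andP[x1 x2]; have := H N (ltnSn N) (x - (t + N%:R * h)).
  by rewrite subrKC subr_ge0 x1 lerBlDl; exact.
by rewrite mulrBl; clear; lra.
Qed.

End riemann_sums.

Section real_area_integrals.
Variable R : realType.
Implicit Types (f g : R[i] -> R).

Lemma mCD f g : mC f -> mC g -> mC (fun z => f z + g z).
Proof. by move=> mf mg; exact: measurable_funD. Qed.

Lemma mCZ f (k : R) : mC f -> mC (fun z => k * f z).
Proof. by move=> mf; apply: mCM => //; exact: measurable_cst. Qed.

Lemma area_intDr f g : mC f -> mC g -> (forall z, 0 <= f z) -> (forall z, 0 <= g z) ->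
  area_int (fun z => (f z + g z)%:E) =
  (area_int (fun z => (f z)%:E) + area_int (fun z => (g z)%:E))%E.
Proof.
move=> mf mg f0 g0; rewrite -area_intD //; exact: mC_EFin.
Qed.

Lemma area_intZr f (k : R) : 0 <= k -> mC f -> (forall z, 0 <= f z) ->
  area_int (fun z => (k * f z)%:E) = (k%:E * area_int (fun z => (f z)%:E))%E.
Proof.
move=> k0 mf f0; rewrite -area_intZ //; exact: mC_EFin.
Qed.

Lemma area_int_ler f g : (forall z, 0 <= f z) -> (forall z, f z <= g z) ->
  (area_int (fun z => (f z)%:E) <= area_int (fun z => (g z)%:E))%E.
Proof. by move=> f0 fg; apply: area_int_le => z; rewrite lee_fin. Qed.

End real_area_integrals.

Section log_submean.
Variable R : realType.
Notation mu := (@lebesgue_measure R).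
Local Open Scope complex_scope.
Notation C := R[i].
Implicit Types (F : C -> C).

(** A substitute for log |u|, namely lambda log (1 + |u| / lambda): it is nonnegative and
    1-Lipschitz, so zeros of the function under the logarithm cause no singularity. *)
Definition logp (lam : R) (u : C) : R := lam * ln (1 + normc u / lam).

Lemma logp_ge0 lam u : 0 < lam -> 0 <= logp lam u.
Proof.
move=> l0; rewrite mulr_ge0 ?(ltW l0) // ln_ge0 // lerDl divr_ge0 ?normc_ge0 //.
exact: ltW.
Qed.

Lemma logp_lip lam u v : 0 < lam -> `|logp lam u - logp lam v| <= normc (u - v).
Proof.
move=> l0.
suff H x y : logp lam x - logp lam y <= normc (x - y).
  by rewrite ler_norml H andbT lerNl opprB normc_distC H.
have pos w : 0 < 1 + normc w / lam.
  by rewrite ltr_pwDl // divr_ge0 ?normc_ge0 // ltW.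
rewrite /logp -mulrBr -ln_div ?posrE // -ler_pdivlMl //.
have q0 : 0 < (1 + normc x / lam) / (1 + normc y / lam) by rewrite divr_gt0.
apply: (@le_trans _ _ ((1 + normc x / lam) / (1 + normc y / lam) - 1)).
  have := @le_ln1Dx R ((1 + normc x / lam) / (1 + normc y / lam) - 1) _.
  by rewrite subrKC; apply; rewrite ltrBrDr addNr.
rewrite -[X in _ - X](divff (lt0r_neq0 (pos y))) -mulrBl ler_pdivrMr //.
rewrite opprD addrACA subrr add0r -mulrBl.
apply: (@le_trans _ _ (lam^-1 * normc (x - y))).
  by rewrite mulrC ler_wpM2l ?invr_ge0 ?(ltW l0) // normc_dist.
rewrite ler_peMr // ?mulr_ge0 ?invr_ge0 ?normc_ge0 ?(ltW l0) //.
by rewrite lerDl divr_ge0 ?normc_ge0 // ltW.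
Qed.

Lemma logp_exp lam u : 0 < lam -> normc u <= expR (logp lam u / lam + ln lam).
Proof.
move=> l0; have p0 : 0 < 1 + normc u / lam.
  by rewrite ltr_pwDl // divr_ge0 ?normc_ge0 // ltW.
rewrite expRD lnK ?posrE // /logp mulrAC divff ?gt_eqF // mul1r lnK ?posrE //.
by rewrite mulrDl divfK ?gt_eqF // lerDr mul1r ltW.
Qed.

Lemma holo_prod F (r h : R) N : holo r F ->
  holo r (fun w => \prod_(k < N) F (cis (k%:R * h) * w)).
Proof.
move=> Fh; elim: N => [|N IH] w wr.
  exists 0; under eq_fun do rewrite big_ord0; exact: cdiff_cst.
have [c1 H1] := IH w wr; have [|c2 H2] := Fh (cis (N%:R * h) * w).
  by rewrite normcM normc_cis mul1r.
exists (c1 * F (cis (N%:R * h) * w) + (\prod_(k < N) F (cis (k%:R * h) * w)) *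
  (c2 * (0 * w + cis (N%:R * h) * 1))).
rewrite (_ : (fun w => _) = (fun w => (\prod_(k < N) F (cis (k%:R * h) * w)) *
    F (cis (N%:R * h) * w))); last by apply/funext => w'; rewrite big_ord_recr.
apply: cdiffM; first exact: H1.
apply: (cdiff_comp (F := F) (G := fun w => cis (N%:R * h) * w)); last exact: H2.
by apply: cdiffM; [exact: cdiff_cst|exact: cdiff_id].
Qed.

(** Jensen's inequality for log |F| by way of Riemann sums: a sum of logarithms over N equally
    spaced points is the logarithm of a product of N rotates of F. This product is holomorphic
    and has modulus 1 at the centre, so it is not small at every point of the circle. *)
Lemma log_circle_mean F (r lam : R) z : holo r F -> normc (F 0) = 1 -> normc z < r ->
  0 < lam ->
  - (lam * ln lam) * (2 * pi) <= Iab 0 (2 * pi) (fun t => logp lam (F (cis t * z))).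
Proof.
move=> Fh F01 zr l0.
have pi2 : 0 < 2 * pi :> R by rewrite mulr_gt0 // pi_gt0.
pose psi t := logp lam (F (cis t * z)).
have cr t : normc (cis t * z) < r by rewrite normcM normc_cis mul1r.
have cpsi : continuous psi.
  move=> t; apply: (@cont_on_cis R F z t t (logp lam)) => [s|u v|].
  - exact: (holo_cont Fh).
  - exact: logp_lip.
  - by rewrite lexx.
have psi0 t : 0 <= psi t by exact: logp_ge0.
have per t : psi (t + 2 * pi) = psi t by rewrite /psi cisD cis2pi mulr1.
rewrite -/psi; apply/ler_addgt0Pl => e' e'0.
pose e := e' / (4 * pi); have e0 : 0 < e by rewrite divr_gt0 // mulr_gt0 // pi_gt0.
have [|x d d' dd H s sd|x _|d d0 Hd] := @compact_uniform R R `[0, 4 * pi]%classic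
   (fun t d => forall s, `|s| < d -> `|psi (t + s) - psi t| <= e).
- exact: segment_compact.
- by apply: H; exact: lt_le_trans sd dd.
- have e2 : 0 < e / 2 by rewrite divr_gt0.
  have /cvgrPdist_le/(_ _ e2)/nbhs_ballP[d /= d0 Hd] := cpsi x.
  have d2 : 0 < d / 2 by rewrite divr_gt0.
  exists (d / 2) => //; apply/nbhs_ballP; exists (d / 2) => //= y xy s sd.
  rewrite (_ : psi (y + s) - psi y = (psi x - psi y) - (psi x - psi (y + s))); last by ring.
  rewrite (splitr e); apply: (le_trans (ler_normB _ _)); apply: lerD; apply: Hd.
    by rewrite /ball /= (lt_trans xy) // ltr_pdivrMr // ltr_pMr // ltr1n.
  rewrite /ball /= (splitr d) opprD addrA (le_lt_trans (ler_normB _ _)) // ltrD //.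
have [N hN] : exists N : nat, 2 * pi / N.+1%:R < d.
  exists (Num.bound (2 * pi / d)).
  rewrite ltr_pdivrMr ?ltr0n // [d * _]mulrC -ltr_pdivrMr //.
  apply: (lt_trans (archi_boundP _)); first by rewrite divr_ge0 // ltW.
  by rewrite ltr_nat.
set h := 2 * pi / N.+1%:R in hN; have h0 : 0 < h by rewrite divr_gt0 ?ltr0n.
have Nh : N.+1%:R * h = 2 * pi by rewrite /h mulrC divfK // pnatr_eq0.
pose P w := \prod_(k < N.+1) F (cis (k%:R * h) * w).
have Ph : holo r P by exact: holo_prod.
have P0 : normc (P 0) = 1.
  rewrite /P; elim/big_ind: _ => [|x y|i _]; rewrite ?normc1 ?normcM ?mulr0 //.
  by move=> -> ->; rewrite mulr1.
pose q := expR (- (N.+1%:R * e / lam)).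
have q1 : q < 1 by rewrite -expR0 ltr_expR oppr_lt0 divr_gt0 // mulr_gt0 // ltr0n.
have [t /andP[t0 t2] Pt] : exists2 t, 0 <= t <= 2 * pi & q < normc (P (cis t * z)).
  apply/not_exists2P => H; have := circle_mean_le Ph zr; rewrite P0 mul1r leNgt => /negP; apply.
  apply: (@le_lt_trans _ _ (Iab 0 (2 * pi) (fun=> q))); last first.
    by rewrite Iab_cst ?(ltW pi2) // subr0 gtr_pMl.
  apply: Iab_le.
  - apply: cont_on_cis => [s|u v]; last exact: normc_dist_le.
    exact: (holo_cont Ph).
  - by move=> s _; exact: cst_continuous.
  - by move=> s s2; rewrite leNgt; apply/negP => ?; have [|] := H s.
have PE : normc (P (cis t * z)) <= expR (\sum_(k < N.+1) (psi (t + k%:R * h) / lam + ln lam)).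
  rewrite /P; elim: N.+1 => [|n IH]; first by rewrite !big_ord0 normc1 expR0.
  rewrite !big_ord_recr /= normcM expRD ler_pM ?normc_ge0 //.
  by rewrite /psi mulrA -cisD addrC; exact: logp_exp.
have {Pt PE} := lt_le_trans Pt PE; rewrite ltr_expR big_split /= -mulr_suml.
rewrite sumr_const card_ord -[ln lam *+ _]mulr_natl => S1.
have S2 : - (N.+1%:R * e) - N.+1%:R * (lam * ln lam) <= \sum_(k < N.+1) psi (t + k%:R * h).
  move: S1; set S := \sum_(k < _) _ => S1.
  have : lam * (- (N.+1%:R * e / lam)) < lam * (S / lam + N.+1%:R * ln lam) by rewrite ltr_pM2l.
  rewrite mulrN mulrDr ![lam * (_ / lam)]mulrC !divfK ?gt_eqF //.
  by move=> /ltW; rewrite lerBlDr [N.+1%:R * (lam * _)]mulrCA.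
have RS : (\sum_(k < N.+1) (psi (t + k%:R * h) - e)) * h <= Iab t (t + N.+1%:R * h) psi.
  apply: riemann_sum_le => // [|k kN s /andP[s0 sh]]; first exact: ltW.
  apply: Hd; last by rewrite ger0_norm // (le_lt_trans sh).
  rewrite /= in_itv /=; apply/andP; split.
    by rewrite addr_ge0 // mulr_ge0 ?ler0n // ltW.
  have : k%:R * h <= 2 * pi by rewrite -Nh ler_pM2r // ler_nat ltnW.
  by move: t2; clear; lra.
rewrite Nh Iab_periodic ?t0 // in RS.
rewrite sumrB sumr_const card_ord -[e *+ _]mulr_natl mulrBl in RS.
have S3 : (- (N.+1%:R * e) - N.+1%:R * (lam * ln lam)) * h <=
   (\sum_(k < N.+1) psi (t + k%:R * h)) * h by rewrite ler_wpM2r // ltW.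
have eT : e * (2 * pi) = e' / 2.
  by rewrite /e; move: (pi_gt0 R); move: (@pi R) => x x0; field; rewrite gt_eqF.
rewrite mulrBl mulNr ![N.+1%:R * _ * h]mulrAC Nh in S3 RS.
by move: S3 RS eT; clear; lra.
Qed.

Lemma log_area_mean F (r lam : R) : holo r F -> normc (F 0) = 1 -> 0 < lam -> lam <= 1 ->
  ((- (lam * ln lam))%:E * darea r <= area_int (fun z => (disk 0 r z * logp lam (F z))%:E))%E.
Proof.
move=> Fh F01 l0 l1.
have k0 : 0 <= - (lam * ln lam) by rewrite -mulrN mulr_ge0 ?(ltW l0) // oppr_ge0 ln_le0.
rewrite /darea -area_intZ //; last 2 first.
- by apply: mC_EFin; exact: measurable_disk.
- by move=> z; rewrite lee_fin disk_ge0.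
under [X in (area_int X <= _)%E]eq_fun do rewrite -EFinM mulrC.
apply: (circle_to_disk (k := fun=> - (lam * ln lam)) (H := fun z => logp lam (F z))).
- exact: measurable_cst.
- by [].
- by move=> z; exact: logp_ge0.
- by apply: measurable_disk_holo => // [u v|u]; [exact: logp_lip|exact: logp_ge0].
- move=> z zr; apply: cont_on_cis; last by move=> u v; exact: logp_lip.
  by move=> t; apply: (holo_cont Fh); rewrite normcM normc_cis mul1r.
- by move=> z zr; apply: (log_circle_mean Fh).
Qed.

(** A Remez-type estimate. If F were much smaller than F a on a large set, the mean of
    log |F / F a| would be very negative; it is at least zero, and its positive part is controlled
    by the mean of |F| ^ p. The factor ln lam makes the exceptional set as small as desired. *)
Lemma small_values F a (p r lam M : R) : 1 <= p -> holo 1 F -> 0 < r -> normc a + r <= 1 ->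
  0 < lam -> lam <= 1 -> F a != 0 ->
  (area_int (fun z => (disk a r z * normc (F z) `^ p)%:E) <=
     (M * normc (F a) `^ p)%:E * darea r)%E ->
  (((- ln lam) - ln 2)%:E *
     area_int (fun z => (disk a r z * (normc (F z) < lam * normc (F a))%R%:R)%:E) <=
   (1 + M)%:E * darea r)%E.
Proof.
move=> p1 Fh r0 ar l0 l1 Fa0 HM.
have nF : 0 < normc (F a) by rewrite normc_gt0.
have [E /andP[A1 _]] := darea_fin r0.
set A := fine _ in E A1; have A0 : 0 <= A by rewrite (le_trans _ A1) // sqr_ge0.
have p0 : 0 <= p by rewrite (le_trans ler01).
pose G z := (F a)^-1 * F (a + z).
have Gh : holo r G.
  move=> z zr; have [c Hc] := holo_shift Fh ar zr.
  by eexists; apply: cdiffM; [exact: cdiff_cst|exact: Hc].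
have G0 : normc (G 0) = 1 by rewrite /G addr0 mulVf // normc1.
have HL := log_area_mean Gh G0 l0 l1; rewrite E in HL.
have nG z : normc (G z) = normc (F (a + z)) / normc (F a).
  by rewrite /G normcM normcV mulrC.
pose b z : R := (normc (F z) < lam * normc (F a))%R%:R.
have b0 z : 0 <= b z by exact: ler0n.
have bE z : b (a + z) = (normc (G z) < lam)%R%:R.
  by rewrite nG ltr_pdivrMr.
have mF : mC (fun z => disk 0 r z * normc (F (a + z))).
  by apply: measurable_disk_shift => // [u v|u]; [exact: normc_dist_le|exact: normc_ge0].
have mFp : mC (fun z => disk 0 r z * normc (F (a + z)) `^ p).
  by apply: mC_disk_powR => //; [move=> z; exact: normc_ge0|rewrite (lt_le_trans ltr01)].
have dd z : disk 0 r z = 0 \/ disk 0 r z = 1.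
  by rewrite /disk; case: (_ < _)%R; [right|left].
have mb : mC (fun z => disk 0 r z * b (a + z)).
  rewrite (_ : (fun z => _) = (fun z => disk 0 r z *
      (disk 0 r z * normc (F (a + z)) < lam * normc (F a))%R%:R)).
    apply: mCM; first exact: measurable_disk.
    apply: (@measurable_bool_real R _ (R * R)%type); apply: measurable_fun_ltr => //.
  apply/funext => z; have [->|->] := dd z; first by rewrite !mul0r.
  by rewrite !mul1r.
rewrite -(@disk_shift R a r b mb b0).
rewrite -(@disk_shift R a r (fun z => normc (F z) `^ p) mFp) in HM; last by move=> z; exact: powR_ge0.
rewrite E -EFinM in HM *.
set X := area_int (fun z => (disk 0 r z * normc (F (a + z)) `^ p)%:E) in HM.
set B := area_int (fun z => (disk 0 r z * b (a + z))%:E).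
have X0 : (0 <= X)%E by apply: area_int_ge0 => z; rewrite lee_fin mulr_ge0 ?disk_ge0 ?powR_ge0.
have B0 : (0 <= B)%E by apply: area_int_ge0 => z; rewrite lee_fin mulr_ge0 ?disk_ge0.
have XE : X = (fine X)%:E by rewrite fineK // ge0_fin_numE // (le_lt_trans HM) ?ltry.
have BE : B = (fine B)%:E.
  rewrite fineK // ge0_fin_numE // (@le_lt_trans _ _ A%:E) ?ltry // -E.
  apply: area_int_le => z; first by rewrite lee_fin mulr_ge0 ?disk_ge0.
  by rewrite lee_fin ler_piMr ?disk_ge0 // /b; case: (_ < _)%R.
have mD := @measurable_disk R 0 r.
pose L := - ln lam; have L0 : 0 <= L by rewrite oppr_ge0 ln_le0.
have ln20 : 0 <= ln 2 :> R by rewrite ln_ge0 // ler1n.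
pose k := (normc (F a) `^ p)^-1.
have k0 : 0 <= k by rewrite invr_ge0 powR_ge0.
have ml : mC (fun z => disk 0 r z * logp lam (G z)).
  by apply: measurable_disk_holo => // [u v|u]; [exact: logp_lip|exact: logp_ge0].
have db0 z : 0 <= disk 0 r z * b (a + z) by rewrite mulr_ge0 ?disk_ge0.
have dl0 z : 0 <= disk 0 r z * logp lam (G z) by rewrite mulr_ge0 ?disk_ge0 ?logp_ge0.
have dp0 z : 0 <= disk 0 r z * normc (F (a + z)) `^ p by rewrite mulr_ge0 ?disk_ge0 ?powR_ge0.
have lL : 0 <= lam * L by rewrite mulr_ge0 // ltW.
have ll : 0 <= lam * ln 2 by rewrite mulr_ge0 // ltW.
have lk : 0 <= lam * k by rewrite mulr_ge0 // ltW.
have lL1 : 0 <= lam * (L + 1) by rewrite mulr_ge0 ?addr_ge0 // ltW.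
have main : (area_int (fun z => (disk 0 r z * logp lam (G z) +
      lam * L * (disk 0 r z * b (a + z)))%:E) <=
   area_int (fun z => (lam * (L + 1) * disk 0 r z + (lam * ln 2 * (disk 0 r z * b (a + z))
     + lam * k * (disk 0 r z * normc (F (a + z)) `^ p)))%:E))%E.
  apply: area_int_ler => z; first by rewrite addr_ge0 // mulr_ge0.
  have [->|->] := dd z; first by rewrite !(mul0r, mulr0) !addr0.
  have GP : k * normc (F (a + z)) `^ p = normc (G z) `^ p.
    by rewrite nG powRM ?normc_ge0 ?invr_ge0 ?normc_ge0 // -[(normc (F a))^-1]powR_inv1 ?normc_ge0 // -powRrM mulN1r powRN mulrC.
  rewrite !mul1r mulr1 -[lam * k * _]mulrA GP bE /logp -!mulrA -!mulrDr ler_pM2l //.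
  have g0 : 0 <= normc (G z) `^ p by exact: powR_ge0.
  have n0 : 0 <= normc (G z) by exact: normc_ge0.
  case: ltP => gl; rewrite ?mulr1 ?mulr0 ?addr0 ?add0r.
    have : ln (1 + normc (G z) / lam) <= ln 2.
      rewrite ler_ln ?posrE ?ltr_pwDl ?divr_ge0 ?(ltW l0) //.
      by rewrite -[2]/(1 + 1) lerD2l ler_pdivrMr // mul1r ltW.
    by move: g0; clear; lra.
  have : ln (1 + normc (G z) / lam) <= L + normc (G z).
    rewrite (_ : 1 + _ / _ = (lam + normc (G z)) / lam); last by field; rewrite gt_eqF.
    have gl0 : 0 < lam + normc (G z) by rewrite ltr_pwDl.
    rewrite ln_div ?posrE // addrC lerD2l.
    apply: (@le_trans _ _ (ln (1 + normc (G z)))).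
      by rewrite ler_ln ?posrE ?lerD2r // ltr_pwDl.
    by apply: le_ln1Dx; rewrite (lt_le_trans _ n0) // oppr_lt0.
  have : normc (G z) <= 1 + normc (G z) `^ p.
    have [g1|g1] := leP (normc (G z)) 1; first by rewrite (le_trans g1) // lerDl.
    by rewrite (le_trans (le1r_powR (ltW g1) p1)) // lerDr.
  by clear; lra.
rewrite !area_intDr ?area_intZr // in main; try solve [exact: mCZ
  | by apply: mCD; exact: mCZ | by move=> z; exact: mulr_ge0
  | by move=> z; rewrite mulr_ge0 // disk_ge0 | by move=> z; rewrite addr_ge0 // mulr_ge0].
have dE : area_int (fun z : C => (disk 0 r z)%:E) = A%:E by exact: E.
rewrite dE -/B -/X in main.
have := le_trans (leeD2r ((lam * L)%:E * B)%E HL) main.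
rewrite BE XE -!EFinM -!EFinD !lee_fin in HM *.
have kM : k * fine X <= M * A.
  have fp : 0 < normc (F a) `^ p by rewrite powR_gt0.
  by rewrite /k mulrC ler_pdivrMr // mulrAC.
have lX : lam * k * fine X <= lam * (M * A) by rewrite -mulrA ler_pM2l.
move=> H; rewrite -(ler_pM2l l0) -/L.
by move: H lX; rewrite -mulrN -/L; clear; lra.
Qed.

End log_submean.

(** * Weighted area of thin sets *)

Section dyadic_sums.
Variable R : realType.
Notation dA := (@lebesgue_measure R \x @lebesgue_measure R)%E.
Notation C := R[i].

Lemma dyadic_scale (y : R) : 1 <= y -> exists k : nat, 2 ^+ k <= y < 2 ^+ k.+1.
Proof.
move=> y1; have ex : exists k, y < 2 ^+ k.+1.
  exists (Num.bound y); apply: (lt_trans (archi_boundP _)); first by rewrite (le_trans ler01).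
  by rewrite -natrX ltr_nat (ltn_trans (ltn_expl _ (ltnSn 1))) // ltn_exp2l.
exists (ex_minn ex); case: ex_minnP => k -> kmin; rewrite andbT.
case: k kmin => [|k] kmin; first by rewrite expr0.
by rewrite leNgt; apply/negP => /kmin; rewrite ltnn.
Qed.

(** The common pattern of the estimates with a singular power: every point lies in some dyadic
    layer, on which phi is below f k, and the masses of the layers decrease geometrically. *)
Lemma integral_dyadic_sum d (T : measurableType d) (m : {measure set T -> \bar R})
    (phi : T -> R) (f : nat -> T -> R) (B q : R) :
  (forall x, 0 <= phi x) -> (forall k, measurable_fun setT (f k)) -> (forall k x, 0 <= f k x) ->
  (forall x, phi x = 0 \/ exists k, phi x <= f k x) ->
  0 <= B -> 0 <= q < 1 ->
  (forall k, (\int[m]_x (f k x)%:E <= (B * q ^+ k)%:E)%E) ->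
  (\int[m]_x (phi x)%:E <= (B / (1 - q))%:E)%E.
Proof.
move=> phi0 mf f0 phif B0 /andP[q0 q1] fB.
apply: (@le_trans _ _ (\int[m]_x (\sum_(k <oo) (f k x)%:E))%E).
  apply: le_integral_ge0 => u; first by rewrite lee_fin.
  have [->|[k fk]] := phif u; first by apply: nneseries_ge0 => n _ _; rewrite lee_fin.
  apply: (@le_trans _ _ (f k u)%:E); first by rewrite lee_fin.
  rewrite (@nneseriesD1 _ _ k) //; last by move=> n _; rewrite lee_fin.
  by rewrite leeDl //; apply: nneseries_ge0 => n _ _; rewrite lee_fin.
rewrite integral_nneseries //; last 2 first.
- by move=> k; apply/measurable_EFinP; exact: mf.
- by move=> k u _; rewrite lee_fin.
apply: lime_le.
  by apply: is_cvg_nneseries => n _ _; apply: integral_ge0 => u _; rewrite lee_fin.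
apply: nearW => n.
apply: (@le_trans _ _ (\sum_(0 <= k < n) (B * q ^+ k)%:E)%E).
  by apply: lee_sum => k _; exact: fB.
rewrite sumEFin lee_fin -mulr_sumr ler_wpM2l //.
rewrite -div1r ler_pdivlMr ?subr_gt0 //.
have -> : (\sum_(0 <= i < n) q ^+ i) * (1 - q) = 1 - q ^+ n.
  elim: n => [|n IH]; first by rewrite big_geq // expr0 subrr mul0r.
  by rewrite big_nat_recr //= mulrDl IH exprSr; ring.
by rewrite gerBl exprn_ge0.
Qed.

Lemma area_int_dyadic_sum (phi : C -> R) (f : nat -> C -> R) (B q : R) :
  (forall z, 0 <= phi z) -> (forall k, mC (f k)) -> (forall k z, 0 <= f k z) ->
  (forall z, phi z = 0 \/ exists k, phi z <= f k z) ->
  0 <= B -> 0 <= q < 1 ->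
  (forall k, (area_int (fun z => (f k z)%:E) <= (B * q ^+ k)%:E)%E) ->
  (area_int (fun z => (phi z)%:E) <= (B / (1 - q))%:E)%E.
Proof.
move=> phi0 mf f0 phif B0 q01 fB.
exact: (@integral_dyadic_sum _ _ dA (fun u => phi (cx u)) (fun k u => f k (cx u))).
Qed.

(** One constant for both signs of the exponent. *)
Lemma powR_comparable (al c s x : R) : 1 <= c -> 0 < s -> s / c <= x -> x <= c * s ->
  x `^ al <= c `^ `|al| * s `^ al.
Proof.
move=> c1 s0 sx xc; have c0 : 0 < c by rewrite (lt_le_trans ltr01).
have x0 : 0 < x by rewrite (lt_le_trans _ sx) // divr_gt0.
have [a0|a0] := leP 0 al.
  by rewrite ger0_norm // -powRM ?(ltW c0) ?(ltW s0) // ge0_ler_powR ?nnegrE ?(ltW x0) // mulr_ge0 // ltW.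
have [be be0 E] : exists2 be, 0 <= be & al = - be.
  by exists (- al); rewrite ?opprK // oppr_ge0 ltW.
rewrite ltr0_norm // {}E opprK !powRN -[leLHS]mul1r ler_pdivrMr ?powR_gt0 //.
rewrite mulrAC ler_pdivlMr ?powR_gt0 // mul1r -powRM ?(ltW c0) ?(ltW x0) //.
rewrite ge0_ler_powR ?nnegrE ?(ltW s0) //; first by rewrite mulr_ge0 // ltW.
by rewrite mulrC -ler_pdivrMr.
Qed.

End dyadic_sums.

Section thin_sets.
Variable R : realType.
Notation mu := (@lebesgue_measure R).
Notation dA := (@lebesgue_measure R \x @lebesgue_measure R)%E.
Local Open Scope complex_scope.
Notation C := R[i].

Definition collar (s : R) (z : C) : R := disk 0 1 z * (1 - s < normc z)%R%:R.

Lemma mC_lt_normc (s : R) : mC (fun z : C => (s < normc z)%R%:R : R).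
Proof.
apply: (@measurable_bool_real R _ (R * R)%type); apply: measurable_fun_ltr.
  exact: measurable_cst.
exact: measurable_normc.
Qed.

Lemma mC_collar s : mC (collar s).
Proof. by apply: mCM; [exact: measurable_disk|exact: mC_lt_normc]. Qed.

Lemma collar_ge0 s z : 0 <= collar s z.
Proof. by rewrite mulr_ge0 ?disk_ge0 // ler0n. Qed.

Lemma darea_dil (s : R) : 0 < s -> darea s = ((s ^+ 2)%:E * darea 1)%E.
Proof.
move=> s0; have := @area_int_dil R (fun z => (disk 0 s z)%:E) s s0.
have E z : disk 0 s (s%:C * z) = disk 0 1 z.
  rewrite /disk !subr0 normcM normcR gtr0_norm //.
  by rewrite -[X in _ < X](mulr1 s) ltr_pM2l // mulr1.
have -> : area_int (fun z => (disk 0 s (s%:C * z))%:E) = darea 1.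
  by congr area_int; apply/funext => z; rewrite E.
move=> ->; last 2 first.
- by apply: mC_EFin; exact: measurable_disk.
- by move=> z; rewrite lee_fin disk_ge0.
by rewrite muleA -EFinM divff ?mul1e // gt_eqF // exprn_gt0.
Qed.

Lemma annulus_area (s : R) : 0 < s -> (area_int (fun z => (collar s z)%:E) <= (8 * s)%:E)%E.
Proof.
move=> s0; have [E1 /andP[A0 A1]] := darea_fin (@ltr01 R).
have [s1|s1] := leP 1 s.
  apply: (@le_trans _ _ (darea 1)).
    apply: area_int_ler => z; first exact: collar_ge0.
    by rewrite /collar ler_piMr ?disk_ge0 //; case: (_ < _).
  by rewrite E1 lee_fin; move: A1 s1; rewrite expr1n; clear; lra.
have s0' : 0 < 1 - s by rewrite subr_gt0.
have : (area_int (fun z => (collar s z + disk 0 (1 - s) z)%:E) <= darea 1)%E.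
  apply: area_int_ler => z; first by rewrite addr_ge0 ?collar_ge0 ?disk_ge0.
  rewrite /collar /disk !subr0; case: (ltP (1 - s)) => [h|h].
    by rewrite (le_gtF (ltW h)) addr0 mulr1.
  rewrite mulr0 add0r; case: (ltP (normc z) (1 - s)) => h1; last exact: ler0n.
  by rewrite (lt_trans h1) // gtrBl.
rewrite area_intDr; [|exact: mC_collar|exact: measurable_disk|exact: collar_ge0|exact: disk_ge0].
rewrite -/(darea (1 - s)) darea_dil //.
set X := area_int _; have X0 : (0 <= X)%E by apply: area_int_ge0 => z; rewrite lee_fin collar_ge0.
rewrite E1; case: X X0 => [x| |] //; rewrite -EFinM -EFinD !lee_fin => x0.
move: A0 A1; rewrite expr1n; move: (fine _) => A A0 A1 H.
have h1 : 0 <= A * (s * s) by rewrite !mulr_ge0 ?(ltW s0) ?(le_trans ler01 A0).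
have h2 : 0 <= s * (4 - A) by rewrite mulr_ge0 ?(ltW s0) // subr_ge0; move: A1; rewrite mulr1.
by move: H h1 h2; rewrite expr2; clear; lra.
Qed.

Lemma unit_cis (zeta : C) : normc zeta = 1 -> exists t : R, cis t = zeta.
Proof.
case: zeta => x y H; have : x ^+ 2 + y ^+ 2 = 1.
  by have := normc_sqr (x +i* y); rewrite H expr1n.
move=> xy; have x1 : -1 <= x <= 1.
  rewrite -ler_norml -(@ler_pXn2r _ 2) ?nnegrE // expr1n real_normK ?num_real //.
  by rewrite -xy lerDl sqr_ge0.
have y2 : 1 - x ^+ 2 = y ^+ 2 by rewrite -xy; ring.
have [y0|y0] := leP 0 y.
  exists (acos x); rewrite /cis acosK ?in_itv //= sin_acos // y2 sqrtr_sqr ger0_norm //.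
exists (- acos x); rewrite /cis cosN sinN acosK ?in_itv //= sin_acos // y2 sqrtr_sqr.
by rewrite ltr0_norm // opprK.
Qed.

Lemma area_int_unit (zeta : C) (phi : C -> R) : normc zeta = 1 -> mC phi ->
  (forall z, 0 <= phi z) ->
  area_int (fun z => (phi (zeta * z))%:E) = area_int (fun z => (phi z)%:E).
Proof.
move=> /unit_cis[t <-] mphi phi0.
by rewrite (@area_int_rot R (fun z => (phi z)%:E)) //; exact: mC_EFin.
Qed.

(** Over each height y the collar near the point 1 is an interval of length at most 2 s ending
    on the circle; sliding it horizontally to the origin gives a rectangle of area 4 s t. *)
Lemma strip_area1 (s t : R) : 0 < s -> 0 < t -> t <= 2^-1 ->
  (area_int (fun z => (collar s z * disk 1 t z)%:E) <= (4 * s * t)%:E)%E.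
Proof.
move=> s0 t0 t2.
pose I : set R := `](- (2 * s)), 0[%classic; pose J : set R := `](- t), t[%classic.
pose S : set (R * R) := I `*` J.
have mS : measurable S by apply: measurableX; exact: measurable_itv.
have SE : (dA S = (4 * s * t)%:E)%E.
  transitivity (mu I * mu J)%E.
    by apply: product_measure1E; exact: measurable_itv.
  have i1 : - (2 * s) < 0 by rewrite oppr_lt0 mulr_gt0.
  have i2 : - t < t by rewrite gtrN.
  rewrite /I /J !lebesgue_measure_itv /= !lte_fin ifT; last exact: i1.
  rewrite ifT; last exact: i2.
  by rewrite -!EFinD -EFinM; congr EFin; ring.
pose X (y : R) : R := Num.sqrt (1 - y ^+ 2).
have mX : measurable_fun [set: R] (fun y => - X y).
  apply: measurableT_comp => //; apply: (@measurableT_comp _ _ _ _ _ _ (@Num.sqrt R)).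
    by apply: continuous_measurable_fun; exact: sqrt_continuous.
  by apply: measurable_funB => //; exact: exprn_measurable.
have m1 : measurable_fun [set: R * R] (fun u => (\1_S u)%:E : \bar R).
  by apply/measurable_EFinP; exact: measurable_indic.
have p1 u : (0 <= (\1_S u)%:E :> \bar R)%E by rewrite lee_fin.
have := affine_x (f := fun u => (\1_S u)%:E) ltr01 mX m1 p1; rewrite invr1 mul1e => E.
have key (x y : R) : collar s (cx (x, y)) * disk 1 t (cx (x, y)) <= \1_S (1 * x - X y, y).
  rewrite /collar /disk subr0.
  case: ltP => h1; last by rewrite !mul0r.
  case: ltP => h2; last by rewrite mulr0 mul0r.
  case: ltP => h3; last by rewrite mulr0.
  rewrite !mul1r indicE mem_set //= /S /I /J /= !in_itv /=.
  have yt : `|y| < t.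
    by apply: le_lt_trans h3; have := normIm (cx (x, y) - 1); rewrite /= subr0.
  have xt : `|x - 1| < t.
    by apply: le_lt_trans h3; exact: (normRe (cx (x, y) - 1)).
  have nE : normc (cx (x, y)) ^+ 2 = x ^+ 2 + y ^+ 2 by rewrite normc_sqr.
  have n0 := normc_ge0 (cx (x, y)).
  have y1 : y ^+ 2 < 1.
    rewrite -(expr1n _ 2) -[y ^+ 2]real_normK ?num_real // ltr_pXn2r ?nnegrE //.
    by move: yt t2; clear; lra.
  have X0 : 0 <= X y by exact: sqrtr_ge0.
  have XE : X y ^+ 2 = 1 - y ^+ 2 by rewrite sqr_sqrtr // subr_ge0 ltW.
  have x2 : 2^-1 < x by move: xt t2; rewrite ltr_norml => /andP[]; clear; lra.
  split; last by rewrite -ltr_norml.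
  have hx : x < X y.
    rewrite -(@ltr_pXn2r _ 2) ?nnegrE // ?XE.
      by move: nE h1 n0; clear; nra.
    by move: x2; clear; lra.
  have hs : (X y - x) * (X y + x) < 2 * s.
    have : 1 - 2 * s < normc (cx (x, y)) ^+ 2 by move: h2 h1 n0 s0; clear; nra.
    by rewrite -subr_sqr XE nE; clear; lra.
  apply/andP; split; last by rewrite subr_lt0.
  by move: hs hx x2; clear; nra.
rewrite -SE -[S]setIT -integral_indic // -E.
apply: le_integral_ge0 => [u|[x y]]; first by rewrite lee_fin mulr_ge0 ?collar_ge0 ?disk_ge0.
by rewrite lee_fin; exact: key.
Qed.

Lemma collar_unit (s : R) (zeta z : C) : normc zeta = 1 -> collar s (zeta * z) = collar s z.
Proof. by move=> z1; rewrite /collar /disk !subr0 normcM z1 mul1r. Qed.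

Lemma disk_unit (t : R) (zeta a z : C) : normc zeta = 1 ->
  disk (zeta * a) t (zeta * z) = disk a t z.
Proof. by move=> z1; rewrite /disk -mulrBr normcM z1 mul1r. Qed.

Lemma strip_area (s t : R) (zeta : C) : 0 < s -> 0 < t -> t <= 2^-1 -> normc zeta = 1 ->
  (area_int (fun z => (collar s z * disk zeta t z)%:E) <= (4 * s * t)%:E)%E.
Proof.
move=> s0 t0 t2 z1.
rewrite -(@area_int_unit zeta) //; last 2 first.
- by apply: mCM; [exact: mC_collar|exact: measurable_disk].
- by move=> z; rewrite mulr_ge0 ?collar_ge0 ?disk_ge0.
under eq_fun do rewrite collar_unit // -{1}[zeta]mulr1 disk_unit //.
exact: strip_area1.
Qed.

Definition weight (al : R) (z : C) : R := (1 - normc z ^+ 2) `^ al.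

Lemma weight_ge0 al z : 0 <= weight al z. Proof. exact: powR_ge0. Qed.

Lemma mC_weight al : mC (weight al).
Proof.
apply: mCp; apply: measurable_funB; first exact: measurable_cst.
by apply: measurable_funX; exact: measurable_normc.
Qed.

Lemma weight_comparable al (s : R) z : normc z < 1 -> 0 < s -> s / 2 <= 1 - normc z <= s ->
  weight al z <= 2 `^ `|al| * s `^ al.
Proof.
move=> z1 s0 /andP[h1 h2]; apply: powR_comparable => //; first by rewrite ler1n.
  by move: h1 z1 (normc_ge0 z); clear; nra.
by move: h2 z1 (normc_ge0 z); clear; nra.
Qed.

Lemma pow2_ratio (b : R) : 0 < b -> 0 <= (2 : R) `^ (- b) < 1.
Proof.
move=> b0; have q1 : 1 < 2 `^ b :> R.
  have E1 : 1 `^ b = 1 :> R by rewrite powR1.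
  rewrite -[X in X < _]E1; apply: gt0_ltr_powR => //.
  - by rewrite nnegrE ler01.
  - by rewrite nnegrE ler0n.
  - by rewrite ltr1n.
by rewrite powR_ge0 /= powRN invf_lt1 // (lt_trans ltr01).
Qed.

(** On the layer where 1 - |z| is of order s the weight is of order s ^ al, and the layer has
    area O(s); the sum over dyadic s converges because al + 1 > 0. *)
Lemma weighted_area (al M tau : R) (chi : C -> R) : -1 < al -> 0 <= M -> 0 < tau ->
  mC chi -> (forall z, 0 <= chi z <= 1) ->
  (forall z, chi z != 0 -> normc z < 1 /\ 1 - normc z <= tau) ->
  (forall s, 0 < s -> (area_int (fun z => (chi z * collar s z)%:E) <= (M * s)%:E)%E) ->
  (area_int (fun z => (chi z * weight al z)%:E) <=
    (2 `^ `|al| * 2 * M * tau `^ (al + 1) / (1 - 2 `^ (- (al + 1))))%:E)%E.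
Proof.
move=> al1 M0 tau0 mchi chi01 chi1 H.
have chi0 z : 0 <= chi z by have /andP[] := chi01 z.
pose s k : R := tau / 2 ^+ k.
have s0 k : 0 < s k by rewrite divr_gt0 // exprn_gt0.
pose K := 2 `^ `|al| : R; have K0 : 0 <= K by exact: powR_ge0.
pose f k z := K * s k `^ al * (chi z * collar (2 * s k) z).
apply: (@area_int_dyadic_sum R (fun z => chi z * weight al z) f (2 `^ `|al| * 2 * M * tau `^ (al + 1))
  (2 `^ (- (al + 1)))).
- by move=> z; rewrite mulr_ge0 ?weight_ge0.
- by move=> k; apply: mCZ; apply: mCM => //; exact: mC_collar.
- by move=> k z; rewrite !mulr_ge0 ?powR_ge0 ?collar_ge0.
- move=> z; have [->|cz] := eqVneq (chi z) 0; first by left; rewrite mul0r.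
  have [z1 zt] := chi1 z cz; right.
  have z0 : 0 < 1 - normc z by rewrite subr_gt0.
  have [|k /andP[k1 k2]] := @dyadic_scale R (tau / (1 - normc z)).
    by rewrite ler_pdivlMr // mul1r.
  have p2 n : 0 < 2 ^+ n :> R by rewrite exprn_gt0.
  have B1 : 1 - normc z <= s k.
    by rewrite /s ler_pdivlMr // mulrC -ler_pdivlMr.
  have B2 : s k / 2 <= 1 - normc z.
    rewrite /s -mulrA -invfM -exprSr ler_pdivrMr // mulrC -ler_pdivrMr //; exact: ltW.
  exists k; rewrite /f mulrCA ler_wpM2l //.
  rewrite /collar /disk subr0 z1 mul1r.
  have -> : 1 - 2 * s k < normc z by move: B1 (s0 k); clear; lra.
  by rewrite mulr1; apply: weight_comparable => //; rewrite B2.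
- by rewrite !mulr_ge0 ?powR_ge0.
- by apply: pow2_ratio; move: al1; clear; lra.
- move=> k; rewrite /f area_intZr; last 3 first.
  + by rewrite mulr_ge0 ?powR_ge0.
  + by apply: mCM => //; exact: mC_collar.
  + by move=> z; rewrite mulr_ge0 ?collar_ge0.
  apply: le_trans (lee_wpmul2l _ (H (2 * s k) _)) _; first by rewrite lee_fin mulr_ge0 ?powR_ge0.
    by rewrite mulr_gt0.
  rewrite -EFinM lee_fin.
  have -> : 2 `^ (- (al + 1)) ^+ k = (2 ^+ k) `^ (- (al + 1)).
    by rewrite -powR_mulrn ?powR_ge0 // powRAC powR_mulrn.
  have skE : s k `^ (al + 1) = tau `^ (al + 1) * (2 ^+ k) `^ (- (al + 1)).
    by rewrite /s powRM ?(ltW tau0) ?invr_ge0 ?exprn_ge0 // -powR_inv1 ?exprn_ge0 // -powRrM mulN1r.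
  rewrite -[leRHS]mulrA -skE powRD; last by rewrite (gt_eqF (s0 k)) implybT.
  rewrite powRr1 ?(ltW (s0 k)) //; apply: le_of_eq; rewrite -/K; ring.
Qed.

End thin_sets.

(** * Integrals of powers of the Cauchy kernel *)

Section kernel.
Variable R : realType.
Local Open Scope complex_scope.
Notation C := R[i].

(** This is |1 - conj(a) z| for a = r zeta, the conjugate of zeta being its inverse. *)
Definition kdist (r : R) (zeta z : C) : R := normc (1 - r%:C * zeta^-1 * z).

Lemma unit_inv (zeta : C) : normc zeta = 1 -> [/\ zeta != 0, normc zeta^-1 = 1 & zeta^-1 * zeta = 1].
Proof.
move=> z1; have z0 : zeta != 0 by rewrite -normc_gt0 z1 ltr01.
by split=> //; [rewrite normcV z1 invr1|rewrite mulVf].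
Qed.

Lemma kdist_ge r zeta z : 0 <= r < 1 -> normc zeta = 1 -> normc z < 1 ->
  [/\ 1 - r <= kdist r zeta z, 1 - normc z <= kdist r zeta z & kdist r zeta z <= 2].
Proof.
move=> /andP[r0 r1] /unit_inv[_ zi _] z1; rewrite /kdist.
have E : normc (r%:C * zeta^-1 * z) = r * normc z.
  by rewrite !normcM normcR ger0_norm // zi mulr1.
have H1 := normc_dist (1 : C) (r%:C * zeta^-1 * z).
have H2 := normcB (1 : C) (r%:C * zeta^-1 * z).
have n1 : normc (1 : C) = 1 by exact: normc1.
move: H1 H2; rewrite n1 E => H1 H2.
have n0 := normc_ge0 z.
by split; move: H1 H2 n0 r0 r1 z1; clear; nra.
Qed.

Lemma kdist_near r zeta z : 0 <= r < 1 -> normc zeta = 1 -> normc z < 1 ->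
  normc (z - zeta) <= 2 * kdist r zeta z.
Proof.
move=> r01 z1 zz; have [k1 k2 k3] := kdist_ge r01 z1 zz.
have /andP[r0 r1] := r01; have [z0 zi zz1] := unit_inv z1.
have -> : normc (z - zeta) = normc (1 - zeta^-1 * z).
  rewrite -[RHS]mul1r -z1 -normcM mulrBr mulr1 mulrA divff // mul1r.
  exact: normc_distC.
have -> : 1 - zeta^-1 * z = (1 - r%:C * zeta^-1 * z) + (r%:C - 1) * (zeta^-1 * z).
  by ring.
apply: (le_trans (normcD _ _)); rewrite !normcM zi mul1r -/(kdist r zeta z).
have -> : normc (r%:C - 1) = 1 - r.
  by rewrite normc_distC (_ : 1 - r%:C = (1 - r)%:C) ?normcR ?ger0_norm ?subr_ge0 ?(ltW r1) // rmorphB rmorph1.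
have n0 := normc_ge0 z.
by move: n0 zz k1 r1; clear; nra.
Qed.

Lemma kdist_self r (zeta : C) : 0 <= r < 1 -> normc zeta = 1 ->
  kdist r zeta (r%:C * zeta) = 1 - r ^+ 2.
Proof.
move=> /andP[r0 r1] /unit_inv[z0 _ E]; rewrite /kdist.
have -> : 1 - r%:C * zeta^-1 * (r%:C * zeta) = (1 - r ^+ 2)%:C.
  by rewrite mulrACA E mulr1 -rmorphM -expr2 rmorphB rmorph1.
by rewrite normcR ger0_norm // subr_ge0 expr_le1 // ltW.
Qed.

Lemma mC_kdist r zeta : mC (kdist r zeta).
Proof.
have := mC_linear (- (r%:C * zeta^-1)) 1 (@measurable_normc R).
by congr mC; apply/funext => z; rewrite /kdist mulNr addrC.
Qed.

Lemma mC_disk_bool (b : C -> bool) : mC (fun z => (b z)%:R : R) ->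
  mC (fun z => disk 0 1 z * (b z)%:R).
Proof. by move=> mb; apply: mCM => //; exact: measurable_disk. Qed.

Lemma mC_kdist_lt r zeta (t : R) : mC (fun z => (kdist r zeta z < t)%R%:R : R).
Proof.
apply: (@measurable_bool_real R _ (R * R)%type); apply: measurable_fun_ltr.
  exact: mC_kdist.
exact: measurable_cst.
Qed.

(** For t at least of order 1 - r this is a Carleson box of size t at zeta, up to constants. *)
Definition kbox r zeta t z : R := disk 0 1 z * (kdist r zeta z < t)%R%:R.

Lemma kbox01 r zeta t z : 0 <= kbox r zeta t z <= 1.
Proof.
rewrite mulr_ge0 ?disk_ge0 ?ler0n //= mulr_ile1 ?disk_ge0 ?disk_le1 ?ler0n //.
Qed.

Lemma mC_kbox r zeta t : mC (kbox r zeta t).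
Proof. by apply: mC_disk_bool; exact: mC_kdist_lt. Qed.

Lemma kbox_neq0 r zeta t z : 0 <= r < 1 -> normc zeta = 1 -> kbox r zeta t z != 0 ->
  [/\ normc z < 1, kdist r zeta z < t & 1 - normc z <= t].
Proof.
move=> r01 z1; rewrite /kbox /disk subr0.
case: (ltP (normc z) 1) => h1; last by rewrite mul0r eqxx.
case: (ltP (kdist r zeta z) t) => h2; last by rewrite mulr0 eqxx.
move=> _; split => //; have [_ h _] := kdist_ge r01 z1 h1.
by rewrite (le_trans h) // ltW.
Qed.

Lemma kbox_collar r zeta (t s : R) : 0 <= r < 1 -> normc zeta = 1 -> 0 < t -> t <= 4^-1 -> 0 < s ->
  (area_int (fun z => (kbox r zeta t z * collar s z)%:E) <= (8 * t * s)%:E)%E.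
Proof.
move=> r01 z1 t0 t4 s0.
apply: (@le_trans _ _ (area_int (fun z => (collar s z * disk zeta (2 * t) z)%:E))).
  apply: area_int_ler => z; first by have /andP[? _] := kbox01 r zeta t z; rewrite mulr_ge0 ?collar_ge0.
  rewrite mulrC ler_wpM2l ?collar_ge0 //.
  have [->|/(kbox_neq0 r01 z1)[h1 h2 h3]] := eqVneq (kbox r zeta t z) 0; first exact: disk_ge0.
  have /andP[_ h] := kbox01 r zeta t z; apply: (le_trans h).
  rewrite /disk (le_lt_trans (kdist_near r01 z1 h1)) //.
  by rewrite ltr_pM2l.
have t20 : 0 < 2 * t by rewrite mulr_gt0.
have t22 : 2 * t <= 2^-1 by move: t4; clear; lra.
apply: (le_trans (strip_area s0 t20 t22 z1)).
by rewrite lee_fin; apply: le_of_eq; ring.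
Qed.

Lemma disk_weight_area (al : R) : -1 < al ->
  exists2 K : R, 0 < K & (area_int (fun z => (disk 0 1 z * weight al z)%:E) <= K%:E)%E.
Proof.
move=> al1.
pose K := 2 `^ `|al| * 2 * 8 * 1 `^ (al + 1) / (1 - 2 `^ (- (al + 1))) : R.
have [|q0 q1] := andP (@pow2_ratio R (al + 1) _); first by move: al1; clear; lra.
exists K.
  by rewrite divr_gt0 ?subr_gt0 // !mulr_gt0 ?powR_gt0 //.
apply: weighted_area => //.
- exact: measurable_disk.
- by move=> z; rewrite disk_ge0 disk_le1.
- move=> z; rewrite /disk subr0; case: ltP => //; rewrite ?eqxx // => h _.
  by split=> //; rewrite gerBl normc_ge0.
- move=> s s0; apply: le_trans (annulus_area s0).
  apply: area_int_ler => z; first by rewrite mulr_ge0 ?disk_ge0 ?collar_ge0.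
  by rewrite ler_piMl ?collar_ge0 ?disk_le1.
Qed.

Lemma kbox_area (al : R) : -1 < al -> exists2 K : R, 0 < K &
  forall r zeta t, 0 <= r < 1 -> normc zeta = 1 -> 0 < t ->
  (area_int (fun z => (kbox r zeta t z * weight al z)%:E) <= (K * t `^ (al + 2))%:E)%E.
Proof.
move=> al1; have [K1 K10 HK1] := disk_weight_area al1.
have [|q0 q1] := andP (@pow2_ratio R (al + 1) _); first by move: al1; clear; lra.
pose K2 := 2 `^ `|al| * 2 * 8 / (1 - 2 `^ (- (al + 1))) : R.
have K20 : 0 < K2 by rewrite divr_gt0 ?subr_gt0 // !mulr_gt0 ?powR_gt0.
pose K3 := K1 * 4 `^ (al + 2); have K30 : 0 < K3 by rewrite mulr_gt0 ?powR_gt0.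
exists (K2 + K3); first by rewrite addr_gt0.
move=> r zeta t r01 z1 t0.
have a2 : 0 <= al + 2 by move: al1; clear; lra.
have [t4|t4] := leP t 4^-1.
  apply: (le_trans (@weighted_area R al (8 * t) t (kbox r zeta t) al1 _ t0 _ _ _ _)).
  - by rewrite mulr_ge0 // ltW.
  - exact: mC_kbox.
  - exact: kbox01.
  - by move=> z /(kbox_neq0 r01 z1)[].
  - by move=> s s0; exact: kbox_collar.
  rewrite lee_fin; have -> : t `^ (al + 2) = t * t `^ (al + 1).
    rewrite (_ : al + 2 = 1 + (al + 1)); last by ring.
    rewrite [LHS]powRD; last by rewrite (gt_eqF t0) implybT.
    by rewrite powRr1 // ltW.
  apply: (@le_trans _ _ (K2 * (t * t `^ (al + 1)))).
    by apply: le_of_eq; rewrite /K2; ring.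
  by rewrite ler_wpM2r ?mulr_ge0 ?powR_ge0 ?(ltW t0) // lerDl ltW.
apply: (@le_trans _ _ K1%:E).
  apply: le_trans HK1; apply: area_int_ler => z.
    by rewrite mulr_ge0 ?weight_ge0 //; have /andP[] := kbox01 r zeta t z.
  rewrite ler_wpM2r ?weight_ge0 // /kbox ler_piMr ?disk_ge0 //; by case: (_ < _).
rewrite lee_fin; apply: (@le_trans _ _ (K3 * t `^ (al + 2))); last first.
  by rewrite ler_wpM2r ?powR_ge0 // lerDr ltW.
rewrite /K3 -mulrA -powRM ?(ltW t0) // ler_peMr ?(ltW K10) //.
have E1 : 1 `^ (al + 2) = 1 :> R by rewrite powR1.
have t1 : 1 <= 4 * t by move: t4; clear; lra.
rewrite -[X in X <= _]E1; apply: ge0_ler_powR => //; rewrite nnegrE ?ler01 //.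
by rewrite (le_trans ler01).
Qed.

(** A Forelli-Rudin estimate off a box of size H: on the layers 2 ^ k H <= kdist < 2 ^ (k + 1) H
    the power of the kernel outweighs the mass of the boxes. *)
Lemma kernel_tail (al s : R) : -1 < al -> al + 2 < s -> exists2 K : R, 0 < K &
  forall r zeta H, 0 <= r < 1 -> normc zeta = 1 -> 0 < H ->
  (area_int (fun z => (disk 0 1 z * (H <= kdist r zeta z)%R%:R *
      (kdist r zeta z `^ (- s) * weight al z))%:E) <= (K * H `^ (al + 2 - s))%:E)%E.
Proof.
move=> al1 als; have [K1 K10 HK1] := kbox_area al1.
have b0 : 0 < s - (al + 2) by rewrite subr_gt0.
have [q0 q1] := andP (@pow2_ratio R (s - (al + 2)) b0).
set q := 2 `^ _ in q0 q1.
have s0 : 0 <= s by move: al1 als; clear; lra.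
exists (K1 * 2 `^ (al + 2) / (1 - q)).
  by rewrite divr_gt0 ?subr_gt0 // mulr_gt0 ?powR_gt0.
move=> r zeta H r01 z1 H0.
have p2 k : 0 < 2 ^+ k :> R by rewrite exprn_gt0.
have Hk k : 0 < 2 ^+ k * H by rewrite mulr_gt0.
pose f k z := (2 ^+ k * H) `^ (- s) * (kbox r zeta (2 ^+ k.+1 * H) z * weight al z).
rewrite -mulrA [_^-1 * _]mulrC mulrA.
apply: (@area_int_dyadic_sum R (fun z => disk 0 1 z * (H <= kdist r zeta z)%R%:R *
      (kdist r zeta z `^ (- s) * weight al z)) f _ q).
- by move=> z; rewrite !mulr_ge0 ?disk_ge0 ?ler0n ?powR_ge0 ?weight_ge0.
- by move=> k; apply: mCZ; apply: mCM; [exact: mC_kbox|exact: mC_weight].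
- by move=> k z; have /andP[h _] := kbox01 r zeta (2 ^+ k.+1 * H) z; rewrite !mulr_ge0 ?powR_ge0.
- move=> z; rewrite /f /kbox /disk subr0.
  case: (ltP (normc z) 1) => h1; last by left; rewrite !mul0r.
  case: (leP H (kdist r zeta z)) => h2; last by left; rewrite mulr0 mul0r.
  right; have [|k /andP[k1 k2]] := @dyadic_scale R (kdist r zeta z / H).
    by rewrite ler_pdivlMr // mul1r.
  exists k; move: k1 k2; rewrite ler_pdivlMr // ltr_pdivrMr // => k1 ->.
  rewrite !mul1r ler_wpM2r ?weight_ge0 //.
  rewrite !powRN lef_pV2 ?posrE ?powR_gt0 //; last by rewrite (lt_le_trans H0).
  by apply: ge0_ler_powR => //; rewrite nnegrE ?(ltW (Hk k)) // (le_trans (ltW H0)).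
- by rewrite !mulr_ge0 ?powR_ge0 ?(ltW K10).
- by rewrite q0.
- move=> k; rewrite /f area_intZr; last 3 first.
  + exact: powR_ge0.
  + by apply: mCM; [exact: mC_kbox|exact: mC_weight].
  + by move=> z; have /andP[h _] := kbox01 r zeta (2 ^+ k.+1 * H) z; rewrite mulr_ge0 ?weight_ge0.
  apply: le_trans (lee_wpmul2l _ (HK1 r zeta (2 ^+ k.+1 * H) r01 z1 _)) _.
  + by rewrite lee_fin powR_ge0.
  + exact: Hk.
  rewrite -EFinM lee_fin.
  have -> : q ^+ k = (2 ^+ k) `^ (al + 2 - s).
    by rewrite -powR_mulrn ?powR_ge0 // /q powRAC powR_mulrn // opprB.
  rewrite exprS -mulrA.
  have -> : (2 * (2 ^+ k * H)) `^ (al + 2) = 2 `^ (al + 2) * (2 ^+ k * H) `^ (al + 2).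
    by rewrite powRM ?ler0n ?(ltW (Hk k)).
  have -> : K1 * 2 `^ (al + 2) * H `^ (al + 2 - s) * (2 ^+ k) `^ (al + 2 - s) =
    K1 * 2 `^ (al + 2) * (2 ^+ k * H) `^ (al + 2 - s).
    by rewrite powRM ?(ltW H0) ?(ltW (p2 k)) // -mulrA [_ `^ _ * _ `^ _]mulrC.
  rewrite [_ `^ (al + 2 - s)]powRD; last by rewrite (gt_eqF (Hk k)) implybT.
  by apply: le_of_eq; ring.
Qed.

End kernel.

(** * A Hardy inequality along radii *)

Section line_kernels.
Variable R : realType.
Notation mu := (@lebesgue_measure R).
Notation dA := (@lebesgue_measure R \x @lebesgue_measure R)%E.
Local Open Scope complex_scope.
Notation C := R[i].

Definition segment_ind (a b t : R) : R := \1_(`[a, b]%classic) t.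

Lemma segment_ind_ge0 a b t : 0 <= segment_ind a b t. Proof. by rewrite /segment_ind indicE ler0n. Qed.

Lemma segment_indE a b t : segment_ind a b t = (a <= t <= b)%R%:R.
Proof. by rewrite /segment_ind indicE mem_setE in_itv. Qed.

Lemma measurable_segment_ind a b : measurable_fun setT (segment_ind a b).
Proof. by apply: measurable_indic; exact: measurable_itv. Qed.

Lemma integral_segment_ind a b : a <= b -> (\int[mu]_t (segment_ind a b t)%:E)%E = (b - a)%:E.
Proof.
move=> ab; pose I : set R := `[a, b]%classic.
transitivity (mu (I `&` setT)); first by apply: integral_indic => //; exact: measurable_itv.
rewrite setIT /I lebesgue_measure_itv /= lte_fin.
by move: ab; case: ltgtP => // -> _; rewrite subrr.
Qed.

Lemma pole_integral (e : R) : -1 < e -> exists2 K : R, 0 < K & forall x, x < 1 ->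
  (\int[mu]_t ((x < t <= 1)%R%:R * (t - x) `^ e)%:E <= (K * (1 - x) `^ (e + 1))%:E)%E.
Proof.
move=> e1; have [|q0 q1] := andP (@pow2_ratio R (e + 1) _); first by move: e1; clear; lra.
set q := 2 `^ _ in q0 q1.
exists (2 `^ `|e| / (1 - q)); first by rewrite divr_gt0 ?subr_gt0 ?powR_gt0.
move=> x x1; have L0 : 0 < 1 - x by rewrite subr_gt0.
pose s k : R := (1 - x) / 2 ^+ k.
have p2 k : 0 < 2 ^+ k :> R by rewrite exprn_gt0.
have s0 k : 0 < s k by rewrite divr_gt0.
pose f k t := 2 `^ `|e| * s k `^ e * segment_ind x (x + s k) t.
have f0 k t : 0 <= f k t by rewrite mulr_ge0 ?segment_ind_ge0 // mulr_ge0 ?powR_ge0.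
rewrite mulrAC; apply: (@integral_dyadic_sum _ _ _ mu _ f _ q) => //.
- by move=> t; rewrite mulr_ge0 ?ler0n ?powR_ge0.
- move=> k; apply: measurable_funM; first exact: measurable_cst.
  exact: measurable_segment_ind.
- move=> t; case: (ltP x t) => h1 /=; last by left; rewrite mul0r.
  case: (leP t 1) => h2 /=; last by left; rewrite mul0r.
  have t0 : 0 < t - x by rewrite subr_gt0.
  right; have [|k /andP[k1 k2]] := @dyadic_scale R ((1 - x) / (t - x)).
    by rewrite ler_pdivlMr // mul1r lerD2r.
  have B1 : t - x <= s k by rewrite /s ler_pdivlMr // mulrC -ler_pdivlMr.
  have B2 : s k / 2 <= t - x.
    rewrite /s -mulrA -invfM -exprSr ler_pdivrMr // mulrC -ler_pdivrMr //; exact: ltW.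
  exists k; rewrite /f mul1r.
  have -> : segment_ind x (x + s k) t = 1.
    by rewrite /segment_ind indicE mem_set //= in_itv /= (ltW h1) /= -lerBlDl.
  rewrite mulr1; apply: powR_comparable => //; first by rewrite ler1n.
  by rewrite (le_trans B1) // ler_peMl ?ler1n // ltW.
- by rewrite mulr_ge0 ?powR_ge0.
- by rewrite q0.
- move=> k; rewrite /f; under eq_integral do rewrite EFinM.
  rewrite ge0_integralZl_EFin //; last 3 first.
  + by move=> t _; rewrite lee_fin segment_ind_ge0.
  + by apply/measurable_EFinP; exact: measurable_segment_ind.
  + by rewrite mulr_ge0 ?powR_ge0.
  rewrite integral_segment_ind; last by rewrite lerDl ltW.
  rewrite -EFinM lee_fin [x + _]addrC addrK.
  have -> : q ^+ k = (2 ^+ k) `^ (- (e + 1)).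
    by rewrite -powR_mulrn ?powR_ge0 // /q powRAC powR_mulrn.
  have skE : s k `^ (e + 1) = (1 - x) `^ (e + 1) * (2 ^+ k) `^ (- (e + 1)).
    by rewrite /s powRM ?(ltW L0) ?invr_ge0 ?exprn_ge0 // -powR_inv1 ?exprn_ge0 // -powRrM mulN1r.
  rewrite -[leRHS]mulrA -skE [_ `^ (e + 1)]powRD; last by rewrite (gt_eqF (s0 k)) implybT.
  by rewrite powRr1 ?(ltW (s0 k)) // mulrA.
Qed.

Lemma line_kernel_integral (kap : R) : 1 < kap -> exists2 K : R, 0 < K & forall x, 0 <= x < 1 ->
  (\int[mu]_t (segment_ind 0 1 t * (1 - t * x) `^ (- kap))%:E <= (K * (1 - x) `^ (1 - kap))%:E)%E.
Proof.
move=> k1; have [|q0 q1] := andP (@pow2_ratio R (kap - 1) _); first by rewrite subr_gt0.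
set q := 2 `^ _ in q0 q1.
exists (2 / (1 - q)); first by rewrite divr_gt0 ?subr_gt0.
move=> x /andP[x0 x1]; have L0 : 0 < 1 - x by rewrite subr_gt0.
have p2 k : 0 < 2 ^+ k :> R by rewrite exprn_gt0.
pose s k : R := 2 ^+ k * (1 - x).
have s0 k : 0 < s k by rewrite mulr_gt0.
pose f k t := s k `^ (- kap) * segment_ind (1 - 2 * s k) 1 t.
rewrite mulrAC; apply: (@integral_dyadic_sum _ _ _ mu _ f _ q) => //.
- by move=> t; rewrite mulr_ge0 ?segment_ind_ge0 ?powR_ge0.
- move=> k; apply: measurable_funM; first exact: measurable_cst.
  exact: measurable_segment_ind.
- by move=> k t; rewrite mulr_ge0 ?segment_ind_ge0 ?powR_ge0.
- move=> t; have [/andP[t0 t1]|h] := boolP (0 <= t <= 1); last first.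
    by left; rewrite segment_indE (negbTE h) mul0r.
  have tx : 1 - x <= 1 - t * x by rewrite lerB // ler_piMl.
  right; have [|k /andP[h1 h2]] := @dyadic_scale R ((1 - t * x) / (1 - x)).
    by rewrite ler_pdivlMr // mul1r.
  move: h1 h2; rewrite ler_pdivlMr // ltr_pdivrMr // => h1 h2.
  exists k; rewrite /f [segment_ind 0 1 t]segment_indE t0 t1 mul1r.
  have -> : segment_ind (1 - 2 * s k) 1 t = 1.
    rewrite /segment_ind indicE mem_set //= in_itv /= t1 andbT.
    have : t * x <= t by rewrite ler_piMr // ltW.
    by move: h2; rewrite exprS -mulrA -/(s k); clear; lra.
  have y0 : 0 < 1 - t * x by rewrite (lt_le_trans L0).
  rewrite mulr1 !powRN lef_pV2 ?posrE ?powR_gt0 //.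
  apply: ge0_ler_powR; rewrite ?nnegrE ?(ltW (s0 k)) ?(ltW y0) //.
  by rewrite (ltW (lt_trans ltr01 k1)).
- by rewrite mulr_ge0 ?powR_ge0.
- by rewrite q0.
- move=> k; rewrite /f; under eq_integral do rewrite EFinM.
  rewrite ge0_integralZl_EFin //; last 3 first.
  + by move=> t _; rewrite lee_fin segment_ind_ge0.
  + by apply/measurable_EFinP; exact: measurable_segment_ind.
  + exact: powR_ge0.
  rewrite integral_segment_ind; last by rewrite gerBl mulr_ge0 // ltW.
  rewrite -EFinM lee_fin opprB addrC subrK.
  have -> : q ^+ k = (2 ^+ k) `^ (1 - kap).
    by rewrite -powR_mulrn ?powR_ge0 // /q powRAC powR_mulrn // opprB.
  rewrite -mulrA [_ `^ _ * _ `^ _]mulrC -powRM ?(ltW L0) ?(ltW (p2 k)) // -/(s k).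
  rewrite addrC powRD; last by rewrite (gt_eqF (s0 k)) implybT.
  by rewrite powRr1 ?(ltW (s0 k)) // mulrCA.
Qed.

(** Jensen's inequality on the radius for the weight (1 - t x) ^ (- kap), whose integral is of
    order (1 - x) ^ (1 - kap). *)
Lemma line_holder (p kap : R) : 1 <= p -> 1 < kap -> exists2 K : R, 0 < K &
  forall x (G : R -> R) v, 0 <= x < 1 -> measurable_fun setT G -> (forall t, 0 <= G t) -> 0 <= v ->
  (v%:E <= \int[mu]_t (segment_ind 0 1 t * G t)%:E)%E ->
  ((v `^ p * (1 - x) `^ ((kap - 1) * (p - 1)))%:E <=
   K%:E * \int[mu]_t (segment_ind 0 1 t * (G t `^ p * (1 - t * x) `^ (kap * (p - 1))))%:E)%E.
Proof.
move=> p1 k1; have [K1 K10 HK1] := line_kernel_integral k1.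
exists (K1 `^ (p - 1)); first by rewrite powR_gt0.
move=> x G v x01 mG G0 v0 Hv; have /andP[x0 x1] := x01.
have L0 : 0 < 1 - x by rewrite subr_gt0.
pose N := K1 * (1 - x) `^ (1 - kap); have N0 : 0 < N by rewrite mulr_gt0 ?powR_gt0.
have my : measurable_fun setT (fun t : R => 1 - t * x).
  by apply: measurable_funB => //; apply: measurable_funM.
have mpow b : measurable_fun setT (fun t : R => (1 - t * x) `^ b).
  exact: (measurableT_comp (measurable_powR b) my).
have y0 t : 0 <= t <= 1 -> 0 < 1 - t * x.
  by move=> /andP[t0 t1]; rewrite (lt_le_trans L0) // lerB // ler_piMl.
have := @jensen_integral R _ _ mu p (v / N) N (fun t => segment_ind 0 1 t * (1 - t * x) `^ (- kap))
  (fun t => G t * (1 - t * x) `^ kap) p1.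
have -> : (\int[mu]_t (segment_ind 0 1 t * (1 - t * x) `^ (- kap) * (G t * (1 - t * x) `^ kap))%:E =
    \int[mu]_t (segment_ind 0 1 t * G t)%:E)%E.
  apply: eq_integral => t _; rewrite segment_indE; case: (boolP (0 <= t <= 1)) => [/y0 yt|_].
    by congr EFin; rewrite powRN; field; rewrite gt_eqF // powR_gt0.
  by rewrite !mul0r.
have -> : (\int[mu]_t (segment_ind 0 1 t * (1 - t * x) `^ (- kap) * (G t * (1 - t * x) `^ kap) `^ p)%:E =
    \int[mu]_t (segment_ind 0 1 t * (G t `^ p * (1 - t * x) `^ (kap * (p - 1))))%:E)%E.
  apply: eq_integral => t _; rewrite segment_indE; case: (boolP (0 <= t <= 1)) => [/y0 yt|_].
    congr EFin; rewrite powRM ?powR_ge0 // -powRrM !mul1r mulrCA; congr (_ * _).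
    rewrite -powRD; last by rewrite (gt_eqF yt) implybT.
    by congr powR; ring.
  by rewrite !mul0r.
move=> J; have {}J := J _ _ _ _ _ (HK1 x x01) _.
have {}J : (((v / N) `^ p * N)%:E <= \int[mu]_t (segment_ind 0 1 t *
    (G t `^ p * (1 - t * x) `^ (kap * (p - 1))))%:E)%E.
  apply: J.
  - by rewrite divr_ge0 // ltW.
  - by apply: measurable_funM; [exact: measurable_segment_ind|exact: mpow].
  - by apply: measurable_funM; [exact: mG|exact: mpow].
  - by move=> t; rewrite mulr_ge0 ?segment_ind_ge0 ?powR_ge0.
  - by move=> t; rewrite mulr_ge0 ?powR_ge0.
  - by rewrite divfK // gt_eqF.
apply: le_trans (lee_wpmul2l _ J); last by rewrite lee_fin powR_ge0.
rewrite -EFinM lee_fin; apply: le_of_eq.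
rewrite powRM ?invr_ge0 ?(ltW N0) // -(powR_inv1 (ltW N0)) -powRrM.
have {2}-> : N = N `^ 1 by rewrite powRr1 // ltW.
rewrite mulrCA -!mulrA; congr (_ * _); rewrite [RHS]mulrCA.
rewrite -powRD; last by rewrite (gt_eqF N0) implybT.
rewrite /N powRM ?powR_ge0 ?(ltW K10) // -powRrM mulrA -powRD; last by rewrite (gt_eqF K10) implybT.
rewrite (_ : p - 1 + (-1 * p + 1) = 0); last by ring.
by rewrite powRr0 mul1r; congr powR; ring.
Qed.

Lemma measurable_scaled (phi : C -> R) : mC phi ->
  measurable_fun [set: R * (R * R)] (fun w => phi (w.1%:C * cx w.2)).
Proof.
move=> mphi; pose h (w : R * (R * R)) : R * R := (w.1 * w.2.1, w.1 * w.2.2).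
rewrite (_ : (fun w => _) = (fun u => phi (cx u)) \o h); last first.
  apply/funext => -[t [x y]]; rewrite /h /cx /=; congr phi.
  by apply/eqP; rewrite eq_complex /=; apply/andP; split; apply/eqP; ring.
apply: (measurableT_comp mphi); apply/measurable_fun_pairP; split.
  apply: measurable_funM; first exact: measurable_fst.
  by apply: measurableT_comp measurable_fst _; exact: measurable_snd.
apply: measurable_funM; first exact: measurable_fst.
by apply: measurableT_comp measurable_snd _; exact: measurable_snd.
Qed.

Lemma measurable_space (phi : C -> R) : mC phi ->
  measurable_fun [set: R * (R * R)] (fun w => phi (cx w.2)).
Proof. by move=> mphi; apply: (measurableT_comp mphi); exact: measurable_snd. Qed.

Lemma measurable_time (f : R -> R) : measurable_fun setT f ->
  measurable_fun [set: R * (R * R)] (fun w => f w.1).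
Proof. by move=> mf; apply: (measurableT_comp mf); exact: measurable_fst. Qed.

Lemma measurable_powR_comp d (T : measurableType d) (f : T -> R) (b : R) :
  measurable_fun setT f -> measurable_fun setT (fun x => f x `^ b).
Proof. by move=> mf; exact: (measurableT_comp (measurable_powR b) mf). Qed.

(** The integrand left by [line_holder] after multiplication by the weight; the exponents e and
    gam make up for each other. *)
Definition hardy_kernel (p e gam : R) (H : C -> R) (t : R) (z : C) : R :=
  disk 0 1 z * (1 - normc z) `^ e * (segment_ind 0 1 t * (H (t%:C * z) `^ p * (1 - t * normc z) `^ gam)).

Lemma hardy_kernel_ge0 p e gam H t z : 0 <= hardy_kernel p e gam H t z.
Proof. by rewrite !mulr_ge0 ?disk_ge0 ?powR_ge0 ?segment_ind_ge0. Qed.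

Lemma weight_le (al : R) z : normc z < 1 -> weight al z <= 2 `^ `|al| * (1 - normc z) `^ al.
Proof.
move=> z1; have z0 : 0 < 1 - normc z by rewrite subr_gt0.
apply: weight_comparable => //; rewrite lexx andbT; move: z0; clear; lra.
Qed.

Lemma weight_ge (al : R) z : normc z < 1 -> (1 - normc z) `^ al <= 2 `^ `|al| * weight al z.
Proof.
move=> z1; have z0 : 0 < 1 - normc z by rewrite subr_gt0.
have n0 := normc_ge0 z; rewrite /weight.
move: (normc z) z1 z0 n0 => x z1 z0 n0; apply: powR_comparable.
- by rewrite ler1n.
- by move: z0 n0; clear; nra.
- by move: z0 n0; clear; nra.
- by move: z0 n0; clear; nra.
Qed.

Lemma hardy_pointwise (p al kap : R) : 1 <= p -> 1 < kap -> exists2 K : R, 0 < K &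
  forall (u H : C -> R) (S : R), mC H -> (forall z, 0 <= H z) -> (forall z, 0 <= u z) -> 0 <= S ->
  (forall z, (normc z < 1)%R -> (u z)%:E <= S%:E + \int[mu]_t (segment_ind 0 1 t * H (t%:C * z))%:E)%E ->
  forall z, ((disk 0 1 z * (u z `^ p * weight al z))%:E <=
    (2 `^ p * S `^ p * (disk 0 1 z * weight al z))%:E +
    K%:E * \int[mu]_t (hardy_kernel p (al - (kap - 1) * (p - 1)) (kap * (p - 1)) H t z)%:E)%E.
Proof.
move=> p1 k1; have [K1 K10 HK1] := line_holder p1 k1.
have p0 : 0 <= p by rewrite (le_trans ler01).
exists (2 `^ `|al| * 2 `^ p * K1); first by rewrite !mulr_gt0 ?powR_gt0.
move=> u H S mH H0 u0 S0 uH z.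
set e := al - _; set gam := kap * _.
have I0 : (0 <= \int[mu]_t (hardy_kernel p e gam H t z)%:E)%E.
  by apply: integral_ge0 => t _; rewrite lee_fin hardy_kernel_ge0.
have A0 : (0 <= (2 `^ `|al| * 2 `^ p * K1)%:E)%E.
  by rewrite lee_fin !mulr_ge0 ?powR_ge0 // ltW.
have B0 : (0 <= (2 `^ p * S `^ p * (disk 0 1 z * weight al z))%:E)%E.
  by rewrite lee_fin !mulr_ge0 ?powR_ge0 ?disk_ge0.
have [z1|z1] := ltP (normc z) 1; last first.
  have D0 : disk 0 1 z = 0 by rewrite /disk subr0 (le_gtF z1).
  by rewrite {1}D0 mul0r adde_ge0 // mule_ge0.
have D1 : disk 0 1 z = 1 by rewrite /disk subr0 z1.
have z0 : 0 < 1 - normc z by rewrite subr_gt0.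
have [uS|Su] := leP (u z) (2 * S).
  apply: (@le_trans _ _ (2 `^ p * S `^ p * (disk 0 1 z * weight al z))%:E); last by rewrite leeDl // mule_ge0.
  rewrite lee_fin mulrCA ler_wpM2r //; first by rewrite mulr_ge0 ?disk_ge0 ?weight_ge0.
  by rewrite -powRM // ge0_ler_powR // ?nnegrE // mulr_ge0.
have mG : measurable_fun setT (fun t : R => H (t%:C * z)).
  case: (z) => x y; exact: (measurable_fun_pair1 (x, y) (measurable_scaled mH)).
have v0 : 0 <= u z / 2 by rewrite divr_ge0.
have Hv : ((u z / 2)%:E <= \int[mu]_t (segment_ind 0 1 t * H (t%:C * z))%:E)%E.
  have := uH z z1; move: (\int[mu]_t (segment_ind 0 1 t * H (t%:C * z))%:E)%E => [i| |] //; last by move=> _; rewrite leey.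
  by rewrite -EFinD !lee_fin; move: Su; clear; move: (u z) => a; lra.
have x01 : 0 <= normc z < 1 by rewrite normc_ge0.
have {Hv} := HK1 _ _ _ x01 mG (fun t => H0 _) v0 Hv.
rewrite -/gam; set J := (\int[mu]_t _)%E => HJ.
have -> : (\int[mu]_t (hardy_kernel p e gam H t z)%:E = ((1 - normc z) `^ e)%:E * J)%E.
  rewrite /J -ge0_integralZl_EFin ?powR_ge0 //.
  - by apply: eq_integral => t _; rewrite /hardy_kernel D1 mul1r EFinM.
  - by move=> t _; rewrite lee_fin mulr_ge0 ?segment_ind_ge0 // mulr_ge0 ?powR_ge0.
  - apply/measurable_EFinP; apply: measurable_funM; first exact: measurable_segment_ind.
    apply: measurable_funM; first exact: measurable_powR_comp.
    apply: measurable_powR_comp; apply: measurable_funB => //.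
    by apply: measurable_funM.
apply: (@le_trans _ _ ((2 `^ `|al| * 2 `^ p * K1)%:E * (((1 - normc z) `^ e)%:E * J))%E); last first.
  by rewrite leeDr.
have c0 : 0 <= 2 `^ `|al| * 2 `^ p * (1 - normc z) `^ e by rewrite !mulr_ge0 ?powR_ge0.
have -> : ((2 `^ `|al| * 2 `^ p * K1)%:E * (((1 - normc z) `^ e)%:E * J) =
   (2 `^ `|al| * 2 `^ p * (1 - normc z) `^ e)%:E * (K1%:E * J))%E.
  by rewrite !muleA -!EFinM; congr (_ * J)%E; congr EFin; ring.
apply: (le_trans _ (lee_wpmul2l _ HJ)); last by rewrite lee_fin.
rewrite -EFinM lee_fin D1 mul1r.
have -> : u z `^ p = 2 `^ p * (u z / 2) `^ p.
  by rewrite -powRM ?ler0n // mulrC divfK.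
apply: (le_trans (ler_wpM2l _ (weight_le al z1))); first by rewrite mulr_ge0 ?powR_ge0.
have -> : (1 - normc z) `^ al = (1 - normc z) `^ e * (1 - normc z) `^ ((kap - 1) * (p - 1)).
  by rewrite -powRD ?(gt_eqF z0) ?implybT // /e subrK.
by apply: le_of_eq; ring.
Qed.

Lemma measurable_abs_lt : measurable_fun [set: R * (R * R)] (fun w => disk 0 w.1 (cx w.2)).
Proof.
apply: measurable_bool_real; apply: measurable_fun_ltr.
  have := measurable_space (phi := fun z => normc (z - 0)); apply.
  have := @measurable_normc R; congr mC; apply/funext => z; by rewrite subr0.
exact: measurable_fst.
Qed.

Lemma measurable_hardy_kernel (p e gam : R) (H : C -> R) : mC H ->
  measurable_fun [set: R * (R * R)] (fun w => (hardy_kernel p e gam H w.1 (cx w.2))%:E).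
Proof.
move=> mH; have mn := @measurable_normc R.
have mHp : mC (fun z => H z `^ p) by exact: mCp.
have mtn : measurable_fun [set: R * (R * R)] (fun w => 1 - w.1 * normc (cx w.2)).
  apply: measurable_funB; first exact: measurable_cst.
  apply: measurable_funM; first exact: measurable_fst.
  exact: measurable_space.
apply/measurable_EFinP; apply: measurable_funM.
  have := measurable_space (phi := fun z => disk 0 1 z * (1 - normc z) `^ e); apply.
  apply: mCM; first exact: measurable_disk.
  by apply: mCp; apply: measurable_funB; [exact: measurable_cst|].
apply: measurable_funM; first by apply: measurable_time; exact: measurable_segment_ind.
apply: measurable_funM; first exact: (measurable_scaled mHp).
exact: measurable_powR_comp.
Qed.

(** For fixed t substitute w = t z, then integrate over t first: what remains is the integral of
    (t - |w|) ^ e over |w| < t <= 1. The support of H keeps t >= 1/2, so that the Jacobian t ^ (-2)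
    is bounded. *)
Lemma hardy_kernel_area (p e gam : R) : 0 < p -> -1 < e -> exists2 K : R, 0 < K &
  forall H : C -> R, mC H -> (forall z, 0 <= H z) ->
  (forall z, H z != 0 -> 2^-1 <= normc z < 1) ->
  (area_int (fun z => \int[mu]_t (hardy_kernel p e gam H t z)%:E) <=
   K%:E * area_int (fun w => (H w `^ p * (1 - normc w)%R `^ (gam + (e + 1)))%:E))%E.
Proof.
move=> p0 e1; have [K1 K10 HK1] := pole_integral e1.
exists (4 * 2 `^ `|e| * K1); first by rewrite !mulr_gt0 ?powR_gt0.
move=> H mH H0 HS.
have Hp0 z : 0 <= H z `^ p by exact: powR_ge0.
have mHp : mC (fun z => H z `^ p) by exact: mCp.
have mn := @measurable_normc R.
have mk := measurable_hardy_kernel p e gam mH.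
have <- : (\int[mu]_t area_int (fun z => (hardy_kernel p e gam H t z)%:E) =
    area_int (fun z => \int[mu]_t (hardy_kernel p e gam H t z)%:E))%E.
  apply: (@area_int_swap_line R (fun t z => (hardy_kernel p e gam H t z)%:E)) => //.
  by move=> t z; rewrite lee_fin hardy_kernel_ge0.
pose phi t w : R := disk 0 t w * (1 - normc w * t `^ (-1)) `^ e * (H w `^ p * (1 - normc w) `^ gam).
have phi0 t w : 0 <= phi t w by rewrite !mulr_ge0 ?disk_ge0 ?powR_ge0.
pose k' t w : R := segment_ind 2^-1 1 t * t `^ (- 2) * phi t w.
have k'0 t w : 0 <= k' t w by rewrite mulr_ge0 // mulr_ge0 ?segment_ind_ge0 ?powR_ge0.
have mphi : measurable_fun [set: R * (R * R)] (fun w => phi w.1 (cx w.2)).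
  apply: measurable_funM.
    apply: measurable_funM; first exact: measurable_abs_lt.
    apply: measurable_powR_comp; apply: measurable_funB; first exact: measurable_cst.
    apply: measurable_funM; first exact: measurable_space.
    by apply: (measurable_time (f := fun t => t `^ (-1))); exact: measurable_powR.
  have := measurable_space (phi := fun z => H z `^ p * (1 - normc z) `^ gam); apply.
  by apply: mCM => //; apply: mCp; apply: measurable_funB; [exact: measurable_cst|].
have mk' : measurable_fun [set: R * (R * R)] (fun w => (k' w.1 (cx w.2))%:E).
  apply/measurable_EFinP; apply: measurable_funM => //.
  apply: (measurable_time (f := fun t => segment_ind 2^-1 1 t * t `^ (- 2))).
  by apply: measurable_funM; [exact: measurable_segment_ind|exact: measurable_powR].
apply: (@le_trans _ _ (\int[mu]_t area_int (fun w => (k' t w)%:E))%E).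
  apply: le_integral_ge0 => t; first by apply: area_int_ge0 => z; rewrite lee_fin hardy_kernel_ge0.
  have [/andP[t2 t1]|ht] := boolP (2^-1 <= t <= 1); last first.
    apply: (@le_trans _ _ 0%E); last by apply: area_int_ge0 => z; rewrite lee_fin.
    rewrite [leLHS](_ : _ = 0%E) //; rewrite /area_int; apply: integral0_eq => u _.
    rewrite /hardy_kernel; have [h1|h1] := eqVneq (H (t%:C * cx u)) 0.
      by rewrite h1 powR0 ?(gt_eqF p0) // !(mul0r, mulr0).
    rewrite /disk subr0; case: (ltP (normc (cx u)) 1) => h2; last by rewrite !mul0r.
    rewrite segment_indE; case: (boolP (0 <= t <= 1)) => [/andP[t0 t1]|_]; last by rewrite mul0r mulr0.
    exfalso; move: ht; rewrite t1 andbT => /negP; apply.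
    have /andP[h3 _] := HS _ h1; apply: (le_trans h3); rewrite normcM normcR ger0_norm //.
    by rewrite ler_piMr // ltW.
  have t0 : 0 < t by rewrite (lt_le_trans _ t2).
  have mphit : mC (phi t) by exact: (measurable_fun_pair2 t mphi).
  have -> : area_int (fun z => (hardy_kernel p e gam H t z)%:E) = area_int (fun z => (phi t (t%:C * z))%:E).
    congr area_int; apply/funext => z; congr EFin.
    rewrite /hardy_kernel /phi /disk !subr0 normcM normcR gtr0_norm //.
    have -> : t * normc z * t `^ (-1) = normc z.
      by rewrite powR_inv1 ?(ltW t0) // mulrAC divff ?mul1r // gt_eqF.
    by rewrite segment_indE (ltW t0) t1 mul1r -[X in _ = (_ < X)%R%:R * _ * _](mulr1 t) ltr_pM2l.
  rewrite (@area_int_dil R (fun z => (phi t z)%:E)) //; last 2 first.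
  - exact: mC_EFin.
  - by move=> z; rewrite lee_fin.
  rewrite -area_intZ ?invr_ge0 ?exprn_ge0 ?(ltW t0) //; last 2 first.
  - exact: mC_EFin.
  - by move=> z; rewrite lee_fin.
  apply: area_int_le => z; first by rewrite -EFinM lee_fin mulr_ge0 // invr_ge0 exprn_ge0 // ltW.
  by rewrite -EFinM lee_fin /k' segment_indE t2 t1 mul1r powRN powR_mulrn // ltW.
have -> : (\int[mu]_t area_int (fun w => (k' t w)%:E) = area_int (fun w => \int[mu]_t (k' t w)%:E))%E.
  by apply: (@area_int_swap_line R (fun t z => (k' t z)%:E)).
rewrite -area_intZ; last 3 first.
- by rewrite !mulr_ge0 ?powR_ge0 // ltW.
- by apply: mC_EFin; apply: mCM => //; apply: mCp; apply: measurable_funB; [exact: measurable_cst|].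
- by move=> z; rewrite lee_fin mulr_ge0 ?powR_ge0.
apply: area_int_le => w; first by apply: integral_ge0 => t _; rewrite lee_fin.
rewrite -EFinM; have [h1|h1] := eqVneq (H w) 0.
  rewrite [leLHS](_ : _ = 0%E) ?lee_fin ?mulr_ge0 ?powR_ge0 ?(ltW K10) //.
  apply: integral0_eq => t _; rewrite /k' /phi h1 powR0 ?(gt_eqF p0) //.
  by rewrite !(mul0r, mulr0).
have /andP[w2 w1] := HS _ h1; set x := normc w in w1 w2 *.
have L0 : 0 < 1 - x by rewrite subr_gt0.
pose Q := H w `^ p * (1 - x) `^ gam; have Q0 : 0 <= Q by rewrite mulr_ge0 ?powR_ge0.
apply: (@le_trans _ _ (\int[mu]_t ((4 * 2 `^ `|e| * Q)%:E * ((x < t <= 1)%R%:R * (t - x) `^ e)%:E))%E).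
  apply: le_integral_ge0 => t; first by rewrite lee_fin.
  rewrite -EFinM lee_fin /k' /phi -/x -/Q segment_indE /disk subr0 -/x.
  case: (ltP x t) => h2 /=; last by rewrite !(mul0r, mulr0).
  have t2 : 2^-1 <= t by rewrite (le_trans w2) // ltW.
  have t0 : 0 < t by rewrite (lt_le_trans _ t2).
  rewrite t2 /=; case: (leP t 1) => t1 /=; last by rewrite !mul0r mulr0.
  rewrite !mul1r.
  have t4 : t `^ (- 2) <= 4.
    rewrite powRN powR_mulrn ?(ltW t0) // invf_ple ?posrE ?exprn_gt0 //.
    by move: t2; rewrite expr2; clear; nra.
  have P : (1 - x * t `^ (-1)) `^ e <= 2 `^ `|e| * (t - x) `^ e.
    have E : 1 - x * t `^ (-1) = (t - x) / t.
      by rewrite powR_inv1 ?(ltW t0) // mulrBl divff // gt_eqF.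
    have tx0 : 0 < t - x by rewrite subr_gt0.
    rewrite E; apply: powR_comparable => //; first by rewrite ler1n.
      rewrite ler_pM2l // lef_pV2 ?posrE //; move: t1; clear; lra.
    rewrite mulrC ler_pM2r //; rewrite invf_ple ?posrE //.
  have e0 : 0 <= (t - x) `^ e by exact: powR_ge0.
  rewrite mulrA (_ : 4 * _ * Q * _ = 4 * (2 `^ `|e| * (t - x) `^ e) * Q); last by ring.
  by rewrite ler_wpM2r // ler_pM ?powR_ge0.
rewrite ge0_integralZl_EFin; last 4 first.
- by [].
- by move=> t _; rewrite lee_fin mulr_ge0 ?powR_ge0 ?ler0n.
- apply/measurable_EFinP; apply: measurable_funM.
    apply: measurable_bool_real; apply: measurable_and.
      by apply: measurable_fun_ltr => //; exact: measurable_cst.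
    by apply: measurable_fun_ler => //; exact: measurable_cst.
  apply: measurable_powR_comp; apply: measurable_funB => //.
- by rewrite !mulr_ge0 ?powR_ge0.
apply: (le_trans (lee_wpmul2l _ (HK1 x w1))); first by rewrite lee_fin !mulr_ge0 ?powR_ge0.
rewrite -EFinM lee_fin /Q [(1 - x) `^ (gam + _)]powRD; last by rewrite (gt_eqF L0) implybT.
by apply: le_of_eq; ring.
Qed.

(** Hardy's inequality: integrating along radii costs the factor 1 - |z|. The exponent kap is
    chosen so that both kap > 1 and e > -1, which are the conditions for the two one-variable
    integrals to converge. The values of H on |z| < 1/2 are accounted for by S. *)
Lemma hardy_area (p al : R) : 1 <= p -> -1 < al -> exists2 K : R, 0 < K &
  forall (u H : C -> R) (S : R), mC H -> (forall z, 0 <= H z) -> (forall z, 0 <= u z) -> 0 <= S ->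
  (forall z, (normc z < 2^-1)%R -> (H z <= S)%R) ->
  (forall z, (normc z < 1)%R -> (u z)%:E <= \int[mu]_t (segment_ind 0 1 t * H (t%:C * z))%:E)%E ->
  (area_int (fun z => (disk 0 1 z * (u z `^ p * weight al z))%:E) <=
   K%:E * (area_int (fun z => (disk 0 1 z * (H z `^ p * ((1 - normc z)%R `^ p * weight al z)))%:E) + (S `^ p)%:E))%E.
Proof.
move=> p1 al1; have p0 : 0 < p by rewrite (lt_le_trans ltr01).
pose kap := 1 + (1 + al) / (2 * p).
have p20 : 0 < 2 * p by rewrite mulr_gt0.
have al0 : 0 < 1 + al by move: al1; clear; lra.
have k1 : 1 < kap by rewrite ltrDl divr_gt0.
pose e := al - (kap - 1) * (p - 1).
have e1 : -1 < e.
  have : (kap - 1) * (p - 1) < 1 + al.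
    rewrite /kap addrC addKr mulrAC ltr_pdivrMr //; move: p1 al0; clear; nra.
  by rewrite /e; clear; lra.
have [K1 K10 HK1] := hardy_pointwise al p1 k1.
have [K2 K20 HK2] := hardy_kernel_area (kap * (p - 1)) p0 e1.
have [K3 K30 HK3] := disk_weight_area al1.
exists (2 `^ p * K3 + K1 * K2 * 2 `^ `|al|).
  by rewrite addr_gt0 // !mulr_gt0 ?powR_gt0.
move=> u H S mH H0 u0 S0 HS uH.
pose H2 z : R := disk 0 1 z * (~~ (normc z < 2^-1))%R%:R * H z.
have H20 z : 0 <= H2 z by rewrite !mulr_ge0 ?disk_ge0 ?ler0n.
have mH2 : mC H2.
  apply: mCM => //; apply: mCM; first exact: measurable_disk.
  apply: (@measurable_bool_real R _ (R * R)%type); apply: measurable_neg.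
  by apply: measurable_fun_ltr; [exact: measurable_normc|exact: measurable_cst].
have H2S z : H2 z != 0 -> 2^-1 <= normc z < 1.
  rewrite /H2 /disk subr0; case: (ltP (normc z) 1) => h1; last by rewrite !mul0r eqxx.
  by case: (ltP (normc z) 2^-1) => // h2; rewrite mulr0 mul0r eqxx.
have uH2 z : normc z < 1 -> ((u z)%:E <= S%:E + \int[mu]_t (segment_ind 0 1 t * H2 (t%:C * z))%:E)%E.
  move=> z1; apply: (le_trans (uH z z1)).
  have mG : measurable_fun setT (fun t : R => H2 (t%:C * z)).
    by case: (z) => x y; exact: (measurable_fun_pair1 (x, y) (measurable_scaled mH2)).
  have -> : (S%:E = \int[mu]_t (S * segment_ind 0 1 t)%:E)%E.
    under eq_integral do rewrite EFinM.
    rewrite ge0_integralZl_EFin ?integral_segment_ind ?subr0 ?mule1 //; last 2 first.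
    - by move=> t _; rewrite lee_fin segment_ind_ge0.
    - by apply/measurable_EFinP; exact: measurable_segment_ind.
  rewrite -ge0_integralD //; last 4 first.
  - by move=> t _; rewrite lee_fin mulr_ge0 ?segment_ind_ge0.
  - by apply/measurable_EFinP; apply: measurable_funM; [exact: measurable_cst|exact: measurable_segment_ind].
  - by move=> t _; rewrite lee_fin mulr_ge0 ?segment_ind_ge0.
  - by apply/measurable_EFinP; apply: measurable_funM; [exact: measurable_segment_ind|].
  apply: le_integral_ge0 => t; first by rewrite lee_fin mulr_ge0 ?segment_ind_ge0.
  rewrite -EFinD lee_fin [S * _]mulrC segment_indE.
  case: (boolP (0 <= t <= 1)) => [/andP[t0 t1]|_]; last by rewrite !mul0r addr0.
  rewrite !mul1r; have tz : normc (t%:C * z) < 1.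
    by rewrite normcM normcR ger0_norm // (le_lt_trans _ z1) // ler_piMl ?normc_ge0.
  rewrite /H2 /disk subr0 tz mul1r.
  case: (ltP (normc (t%:C * z)) 2^-1) => h2 /=.
    by rewrite mul0r addr0 HS.
  by rewrite mul1r lerDr.
have mHw : mC (fun z => disk 0 1 z * weight al z) by apply: mCM; [exact: measurable_disk|exact: mC_weight].
apply: (@le_trans _ _ (area_int (fun z => (2 `^ p * S `^ p)%:E * (disk 0 1 z * weight al z)%:E +
    K1%:E * \int[mu]_t (hardy_kernel p e (kap * (p - 1)) H2 t z)%:E)%E)).
  apply: area_int_le => z; first by rewrite lee_fin !mulr_ge0 ?disk_ge0 ?powR_ge0.
  rewrite -EFinM; exact: (HK1 u H2 S).
have k0 t z : (0 <= (hardy_kernel p e (kap * (p - 1)) H2 t z)%:E)%E by rewrite lee_fin hardy_kernel_ge0.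
have mI : mC (fun z => \int[mu]_t (hardy_kernel p e (kap * (p - 1)) H2 t z)%:E)%E.
  exact: (@measurable_fun_fubini_tonelli_G _ _ _ _ R mu _
    (measurable_hardy_kernel p e (kap * (p - 1)) mH2) (fun w => k0 _ _)).
have I0 z : (0 <= \int[mu]_t (hardy_kernel p e (kap * (p - 1)) H2 t z)%:E)%E.
  by apply: integral_ge0 => t _.
rewrite (@area_intD R (fun z => (2 `^ p * S `^ p)%:E * (disk 0 1 z * weight al z)%:E)%E
  (fun z => K1%:E * \int[mu]_t (hardy_kernel p e (kap * (p - 1)) H2 t z)%:E)%E); last 4 first.
- exact: mC_EFinZ.
- by apply: emeasurable_funM => //; exact: measurable_cst.
- by move=> z; rewrite -EFinM lee_fin !mulr_ge0 ?disk_ge0 ?powR_ge0.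
- by move=> z; rewrite mule_ge0 // lee_fin ltW.
rewrite (@area_intZ R (fun z => (disk 0 1 z * weight al z)%:E)); last 3 first.
- by rewrite mulr_ge0 ?powR_ge0.
- exact: mC_EFin.
- by move=> z; rewrite lee_fin !mulr_ge0 ?disk_ge0 ?powR_ge0.
rewrite area_intZ ?(ltW K10) //.
set X := area_int (fun z => (disk 0 1 z * (H z `^ p * _))%:E).
have X0 : (0 <= X)%E by apply: area_int_ge0 => z; rewrite lee_fin !mulr_ge0 ?disk_ge0 ?powR_ge0.
have B1 : (area_int (fun w => (H2 w `^ p * (1 - normc w) `^ (kap * (p - 1) + (e + 1)))%:E) <=
   (2 `^ `|al|)%:E * X)%E.
  rewrite -area_intZ ?powR_ge0 //; last 2 first.
  - apply: mC_EFin; apply: mCM; first exact: measurable_disk.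
    apply: mCM; first exact: mCp.
    apply: mCM; last exact: mC_weight.
    by apply: mCp; apply: measurable_funB; [exact: measurable_cst|exact: measurable_normc].
  - by move=> z; rewrite lee_fin !mulr_ge0 ?disk_ge0 ?powR_ge0.
  apply: area_int_le => z; first by rewrite lee_fin mulr_ge0 ?powR_ge0.
  rewrite -EFinM lee_fin; have [h|h] := eqVneq (H2 z) 0.
    by rewrite h powR0 ?(gt_eqF p0) // mul0r !mulr_ge0 ?disk_ge0 ?powR_ge0.
  have /andP[z2 z1] := H2S z h; have z0 : 0 < 1 - normc z by rewrite subr_gt0.
  have -> : H2 z = H z by rewrite /H2 /disk subr0 z1 (le_gtF z2) /= !mul1r.
  rewrite /disk subr0 z1 mul1r (_ : kap * (p - 1) + (e + 1) = p + al); last by rewrite /e; ring.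
  rewrite [(1 - normc z) `^ (p + al)]powRD; last by rewrite (gt_eqF z0) implybT.
  have := weight_ge al z1; move=> W.
  have := ler_wpM2l (mulr_ge0 (powR_ge0 (H z) p) (powR_ge0 (1 - normc z) p)) W.
  by rewrite mulrA => /le_trans; apply; apply: le_of_eq; ring.
have B2 := le_trans (HK2 H2 mH2 H20 H2S) (lee_wpmul2l (ltW (K20 : (0 < K2%:E)%E)) B1).
have S0' : 0 <= 2 `^ p * S `^ p by rewrite mulr_ge0 ?powR_ge0.
have A1 : ((2 `^ p * S `^ p)%:E * area_int (fun z => (disk 0 1 z * weight al z)%:E) <=
  (2 `^ p * K3)%:E * (S `^ p)%:E)%E.
  apply: (le_trans (lee_wpmul2l _ HK3)); first by rewrite lee_fin.
  by rewrite -!EFinM lee_fin; apply: le_of_eq; ring.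
apply: (le_trans (leeD A1 (lee_wpmul2l (ltW (K10 : (0 < K1%:E)%E)) B2))).
have c1 : 0 <= 2 `^ p * K3 by rewrite mulr_ge0 ?powR_ge0 // ltW.
have c2 : 0 <= K1 * K2 * 2 `^ `|al| by rewrite !mulr_ge0 ?powR_ge0 // ltW.
have Sp : (0 <= (S `^ p)%:E)%E by rewrite lee_fin powR_ge0.
rewrite (@ge0_muleDr _ _ X _ X0 Sp) addeC; apply: leeD.
  by rewrite !muleA -!EFinM; apply: lee_wpmul2r => //; rewrite lee_fin lerDr.
by rewrite -!EFinM lee_fin ler_wpM2r ?powR_ge0 // lerDl.
Qed.

End line_kernels.

(** * The integral operator along radii *)

Section radial_primitive.
Variable R : realType.
Notation mu := (@lebesgue_measure R).
Notation dA := (@lebesgue_measure R \x @lebesgue_measure R)%E.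
Local Open Scope complex_scope.
Notation C := (R[i]^o).

Lemma lebesgue_dilate (a : R) (f : R -> \bar R) : 0 < a -> mu.-integrable setT f ->
  (\int[mu]_x f (a * x)%R = (a^-1)%:E * \int[mu]_x f x)%E.
Proof.
move=> a0 intf; have mf := measurable_int _ intf.
have E (h : R -> \bar R) : measurable_fun setT h -> (forall x, (0 <= h x)%E) ->
    (\int[mu]_x h (a * x)%R = (a^-1)%:E * \int[mu]_x h x)%E.
  move=> mh h0; rewrite -(@lebesgue_affine R a 0) //.
  by apply: eq_integral => x _; rewrite addr0.
rewrite integralE [in RHS]integralE muleBr; last 2 first.
- by [].
- by rewrite fin_num_adde_defr // integrable_pos_fin_num.
have mp : measurable_fun setT f^\+%E := measurable_funepos mf.
have mn : measurable_fun setT f^\-%E := measurable_funeneg mf.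
have Ep := E _ mp (funepos_ge0 f); have En := E _ mn (funeneg_ge0 f).
rewrite -Ep -En; congr (_ + - _)%E; apply: eq_integral => x _.
  by rewrite !funeposE.
by rewrite !funenegE.
Qed.

(** Change of variable for a function that need not have a sign. *)
Lemma Iab_dilate (r : R) (q : R -> R) : 0 < r -> cont_on 0 r q ->
  Iab 0 r q = Iab 0 1 (fun t => r * q (r * t)).
Proof.
move=> r0 cq; have iq := cont_on_integrable cq.
have cq' : cont_on 0 1 (fun t => q (r * t)).
  move=> t /andP[t0 t1]; apply: (@continuous_comp _ _ _ (fun t => r * t) q).
    exact: mulrl_continuous.
  apply: cq; rewrite mulr_ge0 ?(ltW r0) //=.
  by rewrite -[leRHS]mulr1 ler_pM2l.
rewrite [RHS]RintegralZl //; last exact: cont_on_integrable.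
pose F : R -> \bar R := (EFin \o q) \_ `[0, r].
have iF : mu.-integrable setT F by apply/(integrable_mkcond _ _).1.
rewrite /Iab /Rintegral.
have -> : (\int[mu]_(t in `[0%R, 1%R]) (q (r * t))%:E = \int[mu]_t F (r * t)%R)%E.
  rewrite [LHS]integral_mkcond; apply: eq_integral => t _; rewrite /F /patch.
  by rewrite !mem_setE !in_itv /= pmulr_rge0 // ger_pMr.
rewrite lebesgue_dilate // fineM ?fin_numE //; last first.
  exact: integrable_fin_num.
rewrite mulrA divff ?gt_eqF // mul1r; congr fine.
by rewrite [LHS]integral_mkcond.
Qed.

Lemma Iab_norm_le (a b : R) (q N : R -> R) : cont_on a b q -> cont_on a b N ->
  (forall t, a <= t <= b -> `|q t| <= N t) -> `|Iab a b q| <= Iab a b N.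
Proof.
move=> cq cN H; apply: (@le_trans _ _ (Iab a b (fun t => `|q t|))).
  by apply: le_normr_Rintegral => //; exact: cont_on_integrable.
apply: Iab_le => // t tab; apply: (@continuous_comp _ _ _ q Num.norm); first exact: cq.
exact: norm_continuous.
Qed.

Lemma Iab_segment_ind (q : R -> R) : cont_on 0 1 q ->
  ((Iab 0 1 q)%:E = \int[mu]_t (segment_ind 0 1 t * q t)%:E)%E.
Proof.
move=> cq; have iq := cont_on_integrable cq.
rewrite /Iab /Rintegral fineK; last exact: integrable_fin_num.
rewrite integral_mkcond; apply: eq_integral => t _.
rewrite /patch mem_setE in_itv /= segment_indE; case: ifP => _; first by rewrite mul1r.
by rewrite mul0r.
Qed.

Lemma ccontM (F G : C -> C) z : ccont F z -> ccont G z -> ccont (fun w => F w * G w) z.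
Proof.
move=> cF cG e e0.
have M0 : 0 < normc (F z) + normc (G z) + 1.
  by rewrite ltr_wpDl // addr_ge0 ?normc_ge0.
pose e' := Num.min 1 (e / (normc (F z) + normc (G z) + 1)).
have e'0 : 0 < e' by rewrite lt_min ltr01 divr_gt0.
have e'1 : e' <= 1 by rewrite ge_min lexx.
have e'e : e' * (normc (F z) + normc (G z) + 1) <= e.
  by rewrite -ler_pdivlMr // ge_min lexx orbT.
have [d1 d10 H1] := cF _ e'0; have [d2 d20 H2] := cG _ e'0.
exists (Num.min d1 d2); first by rewrite lt_min d10.
move=> k; rewrite lt_min => /andP[/H1 k1 /H2 k2].
have -> : F (z + k) * G (z + k) - F z * G z =
  (F (z + k) - F z) * (G (z + k) - G z) + F z * (G (z + k) - G z) + (F (z + k) - F z) * G z.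
  by ring.
apply: le_trans e'e; rewrite (le_trans (normcD _ _)) // !normcM.
have H3 := normcD ((F (z + k) - F z) * (G (z + k) - G z)) (F z * (G (z + k) - G z)).
move: H3; rewrite !normcM.
have := normc_ge0 (F z); have := normc_ge0 (G z).
have := normc_ge0 (F (z + k) - F z); have := normc_ge0 (G (z + k) - G z).
move: k1 k2 e'1 e'0.
move: (normc (F (z + k) - F z)) (normc (G (z + k) - G z)) (normc (F z)) (normc (G z)) (normc _).
move=> a b x y w; clear; nra.
Qed.

Lemma ray_continuous (h : C -> C) z t (phi : C -> R) : ccont h (t%:C * z) ->
  (forall u v, `|phi u - phi v| <= normc (u - v)) ->
  {for t, continuous (fun t : R => phi (h (t%:C * z)))}.
Proof.
move=> ch ph; apply: continuous_eps => e e0; have [d d0 Hd] := ch _ e0.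
have M0 : 0 < normc z + 1 by rewrite ltr_wpDl ?normc_ge0.
exists (d / (normc z + 1)); first by rewrite divr_gt0.
move=> s sd; apply: (le_trans (ph _ _)).
have -> : (t + s)%:C * z = t%:C * z + s%:C * z by rewrite rmorphD mulrDl.
apply: Hd; rewrite normcM normcR; move: sd; rewrite ltr_pdivlMr //.
by apply: le_lt_trans; rewrite ler_wpM2l // lerDl.
Qed.

End radial_primitive.

Section integral_operator.
Variable R : realType.
Notation mu := (@lebesgue_measure R).
Local Open Scope complex_scope.
Notation C := (R[i]^o).
Variables f g : C -> C.
Let h (w : C) : C := f w * g^`()%classic w.
Hypothesis h_cont : forall w, normc w < 1 -> ccont h w.

Let q1 (z : C) (t : R) := complex.Re (h (t%:C * z) * z).
Let q2 (z : C) (t : R) := complex.Im (h (t%:C * z) * z).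

Lemma T_split z : T_ g f z = Iab 0 1 (q1 z) +i* Iab 0 1 (q2 z).
Proof. by []. Qed.

Lemma Re_mul_lip (z u v : C) : normc z < 1 ->
  `|complex.Re (u * z) - complex.Re (v * z)| <= normc (u - v).
Proof.
move=> z1; rewrite -Re_sub -mulrBl (le_trans (normRe _)) // normcM.
by rewrite ler_piMr ?normc_ge0 // ltW.
Qed.

Lemma Im_mul_lip (z u v : C) : normc z < 1 ->
  `|complex.Im (u * z) - complex.Im (v * z)| <= normc (u - v).
Proof.
move=> z1; have -> : complex.Im (u * z) - complex.Im (v * z) = complex.Im ((u - v) * z).
  by rewrite mulrBl; case: (u * z) (v * z) => [? ?] [? ?].
rewrite (le_trans (normIm _)) // normcM.
by rewrite ler_piMr ?normc_ge0 // ltW.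
Qed.

Lemma q_cont z t : normc z < 1 -> normc (t%:C * z) < 1 ->
  {for t, continuous (q1 z)} /\ {for t, continuous (q2 z)}.
Proof.
move=> z1 tz; split.
  apply: (ray_continuous (phi := fun u => complex.Re (u * z)) (h_cont tz)) => u v.
  exact: Re_mul_lip.
apply: (ray_continuous (phi := fun u => complex.Im (u * z)) (h_cont tz)) => u v.
exact: Im_mul_lip.
Qed.

Lemma T_ray z (r : R) : 0 < r -> normc z < 1 -> r * normc z < 1 ->
  T_ g f (r%:C * z) = Iab 0 r (q1 z) +i* Iab 0 r (q2 z).
Proof.
move=> r0 z1 rz; have cq t : 0 <= t <= r -> normc (t%:C * z) < 1.
  move=> /andP[t0 tr]; rewrite normcM normcR ger0_norm //.
  by rewrite (le_lt_trans _ rz) // ler_wpM2r ?normc_ge0.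
have c1 : cont_on 0 r (q1 z) by move=> t /cq /(q_cont z1)[].
have c2 : cont_on 0 r (q2 z) by move=> t /cq /(q_cont z1)[].
rewrite (Iab_dilate r0 c1) (Iab_dilate r0 c2).
have E t : h (t%:C * (r%:C * z)) * (r%:C * z) = r%:C * (h ((r * t)%:C * z) * z).
  have -> : t%:C * (r%:C * z) = (r * t)%:C * z by rewrite rmorphM /=; ring.
  by ring.
have e1 t : q1 (r%:C * z) t = r * q1 z (r * t).
  rewrite /q1 (congr1 (@complex.Re R) (E t)); case: (_ * z) => a b.
  by rewrite [LHS]/= mul0r subr0.
have e2 t : q2 (r%:C * z) t = r * q2 z (r * t).
  rewrite /q2 (congr1 (@complex.Im R) (E t)); case: (_ * z) => a b.
  by rewrite [LHS]/= mul0r addr0.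
rewrite T_split; congr (_ +i* _).
  by apply: eq_Iab => t _; exact: e1.
by apply: eq_Iab => t _; exact: e2.
Qed.

(** Along the ray through z, T_g f is the integral of a continuous function, whose value at z
    determines the derivative in the direction z, hence the complex derivative. *)
Lemma T_deriv z c : normc z < 1 -> z != 0 -> cdiff (T_ g f) z c -> c = h z.
Proof.
move=> z1 z0 Tc; have n0 : 0 < normc z by rewrite normc_gt0.
suff H e : 0 < e -> normc (c - h z) * normc z <= 3 * e.
  apply/eqP; rewrite -subr_eq0 -normc_eq0 eq_le normc_ge0 andbT leNgt; apply/negP => c0.
  have := H (normc (c - h z) * normc z / 4); rewrite divr_gt0 ?mulr_gt0 // => /(_ isT).
  by have := mulr_gt0 c0 n0; lra.
move=> e0; have [d d0 Hd] := Tc e e0.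
have [d' d'0 Hd'] := h_cont z1 e0.
pose s := Num.min (d / 2) (Num.min (d' / 2) ((1 - normc z) / 2)).
have s0 : 0 < s by rewrite !lt_min !divr_gt0 // subr_gt0.
have [s1 s2 s3] : [/\ s <= d / 2, s <= d' / 2 & s <= (1 - normc z) / 2].
  by rewrite /s !ge_min !lexx ?orbT.
have sz : s * normc z <= s by exact: ler_piMr (ltW s0) (ltW z1).
have sn : (1 + s) * normc z < 1 by move: s3 sz z1; lra.
have s10 : 0 < 1 + s by rewrite addr_gt0.
have s11 : 1 <= 1 + s by rewrite lerDl ltW.
have near t : 1 <= t <= 1 + s -> normc (h (t%:C * z) * z - h z * z) <= e.
  move=> /andP[t1 ts]; rewrite -mulrBl normcM.
  have -> : t%:C * z = z + (t - 1)%:C * z by rewrite rmorphB rmorph1; ring.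
  have := Hd' ((t - 1)%:C * z); rewrite normcM normcR ger0_norm ?subr_ge0 // => Hk.
  apply: (@le_trans _ _ (normc (h (z + (t - 1)%:C * z) - h z))).
    by rewrite ler_piMr ?normc_ge0 // ltW.
  apply: Hk; have : (t - 1) * normc z <= s * 1.
    by rewrite ler_pM ?subr_ge0 ?normc_ge0 ?(ltW z1) // lerBlDl.
  by move: s2 d'0; lra.
have cq t : 0 <= t <= 1 + s -> normc (t%:C * z) < 1.
  move=> /andP[t0 tr]; rewrite normcM normcR ger0_norm //.
  by rewrite (le_lt_trans _ sn) // ler_wpM2r ?normc_ge0.
have c1 : cont_on 0 (1 + s) (q1 z) by move=> t /cq /(q_cont z1)[].
have c2 : cont_on 0 (1 + s) (q2 z) by move=> t /cq /(q_cont z1)[].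
have a1 : `|Iab 1 (1 + s) (q1 z) - complex.Re (h z * z) * (1 + s - 1)| <= e * (1 + s - 1).
  apply: Iab_approx => //; first exact: (cont_onS ler01 (lexx _) c1).
  by move=> t /near; apply: le_trans; rewrite /q1 -Re_sub normRe.
have a2 : `|Iab 1 (1 + s) (q2 z) - complex.Im (h z * z) * (1 + s - 1)| <= e * (1 + s - 1).
  apply: Iab_approx => //; first exact: (cont_onS ler01 (lexx _) c2).
  move=> t /near; apply: le_trans; rewrite /q2.
  have -> (a b : C) : complex.Im a - complex.Im b = complex.Im (a - b) by case: a b => [? ?] [? ?].
  exact: normIm.
have TE : T_ g f (z + s%:C * z) - T_ g f z = Iab 1 (1 + s) (q1 z) +i* Iab 1 (1 + s) (q2 z).
  have -> : z + s%:C * z = (1 + s)%:C * z by rewrite rmorphD rmorph1 mulrDl mul1r.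
  rewrite T_ray // T_split (Iab_split ler01 s11 c1) (Iab_split ler01 s11 c2).
  by apply/eqP; rewrite eq_complex /=; apply/andP; split; apply/eqP; ring.
have sk : normc (s%:C * z) < d.
  rewrite normcM normcR gtr0_norm //; move: sz s1 d0; lra.
have := Hd _ sk; rewrite TE.
set I := _ +i* _ => HI.
have I1 : normc (I - h z * z * s%:C) <= 2 * e * s.
  apply: (le_trans (normc_le _)).
  have E1 : 1 + s - 1 = s by ring.
  move: a1 a2; rewrite E1 /I; case: (h z * z) => a b /= a1 a2.
  rewrite !mulr0 subr0 add0r (_ : 2 * e * s = e * s + e * s); last by ring.
  by rewrite lerD.
have : normc ((c - h z) * z * s%:C) <= 3 * e * s.
  have -> : (c - h z) * z * s%:C = (I - h z * z * s%:C) - (I - c * (s%:C * z)) by ring.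
  apply: (le_trans (normcB _ _)); move: I1 HI; rewrite normcM normcR gtr0_norm // => I1 HI.
  have : e * (s * normc z) <= e * s by rewrite ler_pM2l.
  by move: I1 HI; lra.
by rewrite normcM normcM normcR gtr0_norm // ler_pM2r.
Qed.

(** At the origin there is no ray; the identity extends by continuity of both sides. *)
Lemma T_derivative z : analytic_on_disk (T_ g f) -> normc z < 1 -> cdiff (T_ g f) z (h z).
Proof.
have half (d : R) : 0 < d -> d / 2 < d by move=> d0; rewrite ltr_pdivrMr // ltr_pMr // ltr1n.
have fin (a b c : R) : a <= c / 3 -> b <= c / 3 -> 0 < c -> c <= a + b -> False by lra.
have cancel (a b c : R[i]) : a - b - (a - c) = c - b by ring.
move=> Ta z1; have Td w : normc w < 1 -> cdiff (T_ g f) w ((T_ g f)^`()%classic w).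
  by move=> w1; apply: derivable_cdiff; exact: Ta.
have Tc : ccont (fun w => (T_ g f)^`()%classic w) z by exact: cdiff_deriv_cont Td z1.
suff -> : h z = (T_ g f)^`()%classic z by exact: Td.
have TE w : normc w < 1 -> w != 0 -> (T_ g f)^`()%classic w = h w.
  by move=> w1 w0; apply: T_deriv => //; exact: Td.
have [z0|/(TE _ z1)//] := eqVneq z 0.
apply/eqP; rewrite -subr_eq0 -normc_eq0 eq_le normc_ge0 andbT leNgt; apply/negP.
set E := normc _ => E0.
have E3 : 0 < E / 3 by rewrite divr_gt0.
have [d1 d10 H1] := Tc _ E3; have [d2 d20 H2] := h_cont z1 E3.
pose s := Num.min (2^-1) (Num.min (d1 / 2) (d2 / 2)).
have s0 : 0 < s by rewrite !lt_min !divr_gt0 // ?invr_gt0 ?ltr0n.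
have [s1 s2 s3] : [/\ s <= 2^-1, s <= d1 / 2 & s <= d2 / 2].
  by rewrite /s !ge_min !lexx ?orbT.
have ns : normc (s%:C : C) = s by rewrite normcR gtr0_norm.
have := H1 s%:C; have := H2 s%:C; rewrite ns.
rewrite z0 !add0r TE; last 2 first.
- by rewrite ns (le_lt_trans s1) // invf_lt1 // ltr1n.
- by rewrite -normc_gt0 ns.
move: E0; rewrite /E z0 => E0 K2 K1.
have {}K2 := K2 (le_lt_trans s3 (half _ d20)).
have {}K1 := K1 (le_lt_trans s2 (half _ d10)).
have := normcB (h s%:C - (T_ g f)^`()%classic 0) (h s%:C - h 0).
rewrite cancel.
exact: fin K1 K2 E0.
Qed.

Lemma T_bound z : normc z < 1 ->
  ((normc (T_ g f z))%:E <=
   \int[mu]_t (segment_ind 0 1 t * (2 * (disk 0 1 (t%:C * z)%R * normc (h (t%:C * z)%R))))%:E)%E.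
Proof.
move=> z1; have cq t : 0 <= t <= 1 -> normc (t%:C * z) < 1.
  move=> /andP[t0 tr]; rewrite normcM normcR ger0_norm //.
  by rewrite (le_lt_trans _ z1) // ler_piMl ?normc_ge0.
pose N (t : R) : R := normc (h (t%:C * z)).
have cN : cont_on 0 1 N.
  by move=> t /cq tz; apply: (ray_continuous (h_cont tz)) => u v; exact: normc_dist_le.
have c1 : cont_on 0 1 (q1 z) by move=> t /cq /(q_cont z1)[].
have c2 : cont_on 0 1 (q2 z) by move=> t /cq /(q_cont z1)[].
have hz t : normc (h (t%:C * z) * z) <= N t by rewrite normcM ler_piMr ?normc_ge0 // ltW.
have a1 : `|Iab 0 1 (q1 z)| <= Iab 0 1 N.
  by apply: Iab_norm_le => // t _; apply: le_trans (hz t); exact: normRe.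
have a2 : `|Iab 0 1 (q2 z)| <= Iab 0 1 N.
  by apply: Iab_norm_le => // t _; apply: le_trans (hz t); exact: normIm.
apply: (@le_trans _ _ (2 * Iab 0 1 N)%:E).
  rewrite lee_fin T_split (le_trans (normc_le _)) //= mulr_natl mulr2n.
  exact: lerD.
have -> : 2 * Iab 0 1 N = Iab 0 1 (fun t => 2 * N t).
  by rewrite [RHS]RintegralZl //; exact: cont_on_integrable.
rewrite Iab_segment_ind; last first.
  move=> t t01; apply: (@continuous_comp _ _ _ N (fun x => 2 * x)); first exact: cN.
  exact: mulrl_continuous.
apply: le_of_eq; apply: eq_integral => t _.
rewrite segment_indE; case: (boolP (0 <= t <= 1)) => [/cq tz|_]; last by rewrite !mul0r.
by rewrite /disk subr0 tz !mul1r.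
Qed.

End integral_operator.

(** * Norms as area integrals *)

Section bridges.
Variable R : realType.
Notation mu := (@lebesgue_measure R).
Notation dA := (@lebesgue_measure R \x @lebesgue_measure R)%E.
Local Open Scope complex_scope.
Notation C := (R[i]^o).

(** For arbitrary sets, because Lebesgue measure is defined on all of them as an outer measure;
    Carleson boxes are compared in this way. *)
Lemma area_mono (A B : set (R * R)) : A `<=` B -> (area A <= area B)%E.
Proof.
move=> AB; apply: le_integral_ge0 => x; first exact: mu_ext_ge0.
by apply: le_mu_ext; apply: le_xsection.
Qed.

Lemma area_bool (b : C -> bool) : mC (fun z : C => (b z)%:R : R) ->
  area (coords [set z | b z]) = area_int (fun z : C => ((b z)%:R : R)%:E).
Proof.
move=> mb; pose A : set (R * R) := coords [set z | b z].
have mA : measurable A.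
  have -> : A = (fun u => (b (cx u))%:R : R) @^-1` `]0, +oo[.
    apply/seteqP; split => u; rewrite /A /coords /= in_itv /= andbT.
      by rewrite /cx => ->.
    by rewrite /cx; case: (b _) => //; rewrite ltxx.
  by rewrite -[X in measurable X]setTI; apply: mb => //; exact: measurable_itv.
transitivity (dA (A `&` setT)); first by rewrite setIT.
rewrite -integral_indic //; apply: eq_integral => u _.
rewrite indicE; congr ((_ : bool)%:R%:E).
by apply/idP/idP; rewrite inE /A /coords /cx.
Qed.

(** The p-th power of the norm: estimates are easier to add up without the root. *)
Definition bergman_int (p al : R) (f : C -> C) : \bar R :=
  area_int (fun z => (disk 0 1 z * (normc (f z) `^ p * weight al z))%:E).

Lemma bergman_int_ge0 p al f : (0 <= bergman_int p al f)%E.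
Proof. by apply: area_int_ge0 => z; rewrite lee_fin !mulr_ge0 ?disk_ge0 ?powR_ge0. Qed.

Lemma bergman_normE p al f : bergman_norm p al f = (bergman_int p al f `^ p^-1)%E.
Proof.
congr (_ `^ _)%E; rewrite /bergman_int /area_int integral_mkcond; apply: eq_integral => u _.
rewrite /patch /disk subr0 /weight.
have -> : (u \in coords (@unit_disk R)) = (normc (cx u) < 1)%R.
  by apply/idP/idP; rewrite inE.
by case: ifP => _; [rewrite mul1r|rewrite mul0r].
Qed.

Lemma analytic_holo (f : C -> C) : analytic_on_disk f -> holo 1 f.
Proof. by move=> fa w w1; exists (f^`()%classic w); apply: derivable_cdiff; exact: fa. Qed.

Lemma holo_analytic (f : C -> C) : holo 1 f -> analytic_on_disk f.
Proof. by move=> fh z /fh[c /cdiff_derivable[]]. Qed.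

Lemma bergman_spaceP (p al : R) (f : C -> C) : 0 < p ->
  bergman_space p al f <-> analytic_on_disk f /\ exists2 x : R, 0 <= x & bergman_int p al f = x%:E.
Proof.
move=> p0; rewrite /bergman_space /= bergman_normE; split=> -[fa H]; split=> //.
  have := lty_poweRy (invr_neq0 (lt0r_neq0 p0)) H; have := bergman_int_ge0 p al f.
  case: (bergman_int p al f) => // x x0 _; exists x => //.
by case: H => x x0 ->; rewrite poweR_EFin ltry.
Qed.

Lemma powR_root (p x : R) : 0 < p -> 0 <= x -> (x `^ p^-1) `^ p = x.
Proof. by move=> p0 x0; rewrite -powRrM mulVf ?gt_eqF // powRr1. Qed.

Lemma bounded_integral (p al : R) (T : (C -> C) -> C -> C) : 0 < p ->
  bounded_operator (bergman_space p al) (bergman_norm p al) T ->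
  exists2 M : R, 0 <= M & forall f, bergman_space p al f -> (bergman_int p al (T f) <= M%:E * bergman_int p al f)%E.
Proof.
move=> p0 [XT [M HM]]; exists (Num.max M 0 `^ p); first exact: powR_ge0.
move=> f Xf; have := HM f Xf; have [_ [x x0 fx]] := (bergman_spaceP al f p0).1 Xf.
have [_ [y y0 fy]] := (bergman_spaceP al (T f) p0).1 (XT f Xf).
rewrite !bergman_normE fx fy !poweR_EFin -!EFinM !lee_fin => H.
have M0 : 0 <= Num.max M 0 by rewrite le_max lexx orbT.
rewrite -(powR_root p0 y0) -(powR_root p0 x0) -powRM ?powR_ge0 //.
apply: ge0_ler_powR; rewrite ?nnegrE ?powR_ge0 ?mulr_ge0 ?powR_ge0 ?(ltW p0) //.
by rewrite (le_trans H) // ler_wpM2r ?powR_ge0 // le_max lexx.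
Qed.

Lemma below_integral (p al : R) (T : (C -> C) -> C -> C) : 0 < p ->
  (forall f, bergman_space p al f -> bergman_space p al (T f)) ->
  bounded_below (bergman_space p al) (bergman_norm p al) T <->
  exists2 K : R, 0 < K & forall f, bergman_space p al f -> (bergman_int p al f <= K%:E * bergman_int p al (T f))%E.
Proof.
move=> p0 XT; split=> -[K K0 HK].
  exists (K `^ p)^-1; first by rewrite invr_gt0 powR_gt0.
  move=> f Xf; have := HK f Xf; have [_ [x x0 fx]] := (bergman_spaceP al f p0).1 Xf.
  have [_ [y y0 fy]] := (bergman_spaceP al (T f) p0).1 (XT f Xf).
  rewrite !bergman_normE fx fy !poweR_EFin -!EFinM !lee_fin => H.
  rewrite ler_pdivlMl ?powR_gt0 // -(powR_root p0 y0) -(powR_root p0 x0) -powRM ?powR_ge0 ?(ltW K0) //.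
  by apply: ge0_ler_powR; rewrite ?nnegrE ?powR_ge0 ?mulr_ge0 ?powR_ge0 ?(ltW p0) ?(ltW K0).
exists (K `^ p^-1)^-1; first by rewrite invr_gt0 powR_gt0.
move=> f Xf; have := HK f Xf; have [_ [x x0 fx]] := (bergman_spaceP al f p0).1 Xf.
have [_ [y y0 fy]] := (bergman_spaceP al (T f) p0).1 (XT f Xf).
rewrite !bergman_normE fx fy !poweR_EFin -!EFinM !lee_fin => H.
rewrite ler_pdivrMl ?powR_gt0 // -powRM ?(ltW K0) //.
by apply: ge0_ler_powR; rewrite ?nnegrE ?invr_ge0 ?mulr_ge0 ?(ltW p0) ?(ltW K0).
Qed.

End bridges.

(** * Cauchy's estimate with weights *)

Section local_estimates.
Variable R : realType.
Local Open Scope complex_scope.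
Notation C := R[i].

Lemma weight_disc (al theta : R) : 0 <= theta < 1 -> exists2 K : R, 0 < K &
  forall a z : C, normc a < 1 -> normc (z - a) < theta * (1 - normc a) ->
  [/\ normc z < 1, weight al a <= K * weight al z & weight al z <= K * weight al a].
Proof.
move=> /andP[t0 t1]; have d0 : 0 < 1 - theta by rewrite subr_gt0.
exists ((4 / (1 - theta)) `^ `|al|); first by rewrite powR_gt0 // divr_gt0.
move=> a z a1 za; have h0 : 0 < 1 - normc a by rewrite subr_gt0.
have c1 : 1 <= 4 / (1 - theta) by rewrite ler_pdivlMr //; move: t0; clear; lra.
have c4 : 4 <= 4 / (1 - theta) by rewrite ler_pdivlMr //; move: t0; clear; lra.
have nz0 := normc_ge0 z; have na0 := normc_ge0 a.
have b1 := normc_dist z a; have b2 := normc_dist a z; rewrite normc_distC in b2.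
have k1 : (1 - theta) * (1 - normc a) <= 1 - normc z by move: b1 za; clear; lra.
have k2 : 1 - normc z <= (1 + theta) * (1 - normc a) by move: b2 za; clear; lra.
have k0 : 0 < 1 - normc z by rewrite (lt_le_trans _ k1) // mulr_gt0.
have z1 : normc z < 1 by rewrite -subr_gt0.
have sa0 : 0 < 1 - normc a ^+ 2 by rewrite subr_gt0 expr_lt1.
have sz0 : 0 < 1 - normc z ^+ 2 by rewrite subr_gt0 expr_lt1.
have za2 : 1 - normc z ^+ 2 <= 4 * (1 - normc a ^+ 2).
  by move: k2 t1 t0 na0 nz0 a1 h0 k0; clear; nra.
have az2 : (1 - theta) * (1 - normc a ^+ 2) <= 4 * (1 - normc z ^+ 2).
  by move: k1 t1 t0 na0 nz0 a1 h0 k0; clear; nra.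
set k := 4 / (1 - theta) in c1 c4 *.
have k40 : 0 < k by rewrite (lt_le_trans ltr01).
have E1 : 1 - normc z ^+ 2 <= k * (1 - normc a ^+ 2).
  by rewrite (le_trans za2) // ler_wpM2r // ltW.
have E2 : 1 - normc a ^+ 2 <= k * (1 - normc z ^+ 2).
  by rewrite /k mulrAC ler_pdivlMr // mulrC.
by split=> //; apply: powR_comparable => //; rewrite ler_pdivrMr // mulrC.
Qed.

Lemma mC_disk_norm_weight (p al : R) (F : C -> C) : 0 < p -> holo 1 F ->
  mC (fun z => disk 0 1 z * (normc (F z) `^ p * weight al z)).
Proof.
move=> p0 Fh; rewrite (_ : (fun z => _) = (fun z => (disk 0 1 z * normc (F z) `^ p) * weight al z)).
  apply: mCM; last exact: mC_weight.
  apply: mC_disk_powR => //; first by move=> z; exact: normc_ge0.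
  by apply: measurable_disk_holo => // [u v|u]; [exact: normc_dist_le|exact: normc_ge0].
by apply/funext => z; rewrite mulrA.
Qed.

Lemma deriv_weighted (p al : R) : 1 <= p -> exists2 K : R, 0 < K &
  forall (F : C -> C) a c, holo 1 F -> normc a < 1 -> cdiff F a c ->
  (((normc c * (1 - normc a)) `^ p * (1 - normc a) ^+ 2 * weight al a)%:E <=
   K%:E * area_int (fun z => (disk a (2^-1 * (1 - normc a)) z *
      (disk 0 1 z * (normc (F z) `^ p * weight al z)))%:E))%E.
Proof.
move=> p1; have p0 : 0 < p by rewrite (lt_le_trans ltr01).
have [|K K0 HK] := @weight_disc al 2^-1.
  by rewrite invr_ge0 ler0n invf_lt1 ?ltr1n.
have [k k0 kE] : exists2 k : R, 0 < k & k = 2 * 128 by exists (2 * 128); rewrite ?mulr_gt0 ?ltr0n.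
have c0 : 0 < 4 * k `^ p by rewrite mulr_gt0 ?powR_gt0 ?ltr0n.
exists (4 * k `^ p * K); first by rewrite mulr_gt0.
move=> F a c Fh a1 Fc; have h0 : 0 < 1 - normc a by rewrite subr_gt0.
set r := 2^-1 * (1 - normc a); have r0 : 0 < r by rewrite mulr_gt0 ?invr_gt0.
have ar : normc a + r <= 1 by rewrite /r; move: h0; clear; lra.
have := deriv_powR p1 Fh r0 ar Fc; set X := area_int _ => HX.
have mD : mC (fun z => disk a r z * (disk 0 1 z * (normc (F z) `^ p * weight al z))).
  by apply: mCM; [exact: measurable_disk|exact: mC_disk_norm_weight].
have D0 z : 0 <= disk a r z * (disk 0 1 z * (normc (F z) `^ p * weight al z)).
  by rewrite !mulr_ge0 ?disk_ge0 ?powR_ge0.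
have W0 := weight_ge0 al a.
have HW : ((weight al a)%:E * X <= K%:E * area_int (fun z => (disk a r z *
      (disk 0 1 z * (normc (F z) `^ p * weight al z)))%:E))%E.
  have D0E z : (0 <= (disk a r z * (disk 0 1 z * (normc (F z) `^ p * weight al z)))%:E)%E.
    by rewrite lee_fin.
  rewrite -(area_intZ (ltW K0) (mC_EFin mD) D0E).
  have mX : mC (fun z => disk a r z * normc (F z) `^ p).
    rewrite (_ : (fun z => _) = (fun z => disk a r z * (disk 0 1 z * normc (F z) `^ p))).
      apply: mCM; first exact: measurable_disk.
      apply: mC_disk_powR => //; first by move=> z; exact: normc_ge0.
      by apply: measurable_disk_holo => // [u v|u]; [exact: normc_dist_le|exact: normc_ge0].
    apply/funext => z; rewrite {1 2}/disk; case: ltP => za; last by rewrite !mul0r.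
    by rewrite /disk subr0; have [-> _ _] := HK a z a1 za; rewrite !mul1r.
  have X0E z : (0 <= (disk a r z * normc (F z) `^ p)%:E)%E.
    by rewrite lee_fin mulr_ge0 ?disk_ge0 ?powR_ge0.
  rewrite /X -(area_intZ W0 (mC_EFin mX) X0E).
  apply: area_int_le => z; first by rewrite -EFinM lee_fin !mulr_ge0 ?disk_ge0 ?powR_ge0.
  rewrite -!EFinM lee_fin {1 2}/disk; case: ltP => za; last by rewrite !mul0r !mulr0.
  rewrite /disk subr0; have [-> H _] := HK a z a1 za; rewrite !mul1r.
  by rewrite mulrC mulrCA ler_wpM2l ?powR_ge0.
rewrite [(_ * K)%:E]EFinM -muleA; apply: le_trans (lee_wpmul2l _ HW); last by rewrite lee_fin ltW.
apply: le_trans (lee_wpmul2l _ (lee_wpmul2l _ HX)); last 2 first.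
- by rewrite lee_fin (ltW c0).
- by rewrite lee_fin.
rewrite -!EFinM lee_fin; apply: le_of_eq.
have -> : normc c * r / 128 = normc c * (1 - normc a) / k.
  by rewrite kE /r; field.
have c1 : 0 <= normc c * (1 - normc a) by rewrite mulr_ge0 ?normc_ge0 // ltW.
have <- : (normc c * (1 - normc a) / k) `^ p * k `^ p = (normc c * (1 - normc a)) `^ p.
  by rewrite -powRM ?divr_ge0 ?(ltW k0) // divfK // gt_eqF.
by rewrite /r; field.
Qed.

Lemma polar_form (a : C) : exists2 zeta : C, normc zeta = 1 & a = (normc a)%:C * zeta.
Proof.
have [->|a0] := eqVneq a 0; first by exists 1; rewrite ?normc1 // normc0 mul0r.
have n0 : 0 < normc a by rewrite normc_gt0.
exists ((normc a)%:C^-1 * a); last by rewrite mulVKf // -normc_gt0 normcR gtr0_norm.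
by rewrite normcM normcV normcR gtr0_norm // mulVf // gt_eqF.
Qed.

End local_estimates.

(** * Test functions and the Bloch bound *)

Section test_functions.
Variable R : realType.
Local Open Scope complex_scope.
Notation C := R[i].

Lemma cdiffX (F : C -> C) z a n : cdiff F z a -> exists c, cdiff (fun w => F w ^+ n) z c.
Proof.
move=> Fa; elim: n => [|n [c Hc]].
  by exists 0; rewrite (_ : (fun w => _) = fun=> 1); [exact: cdiff_cst|apply/funext => w; rewrite expr0].
exists (a * F z ^+ n + F z * c).
rewrite (_ : (fun w => _) = fun w => F w * F w ^+ n); first exact: cdiffM.
by apply/funext => w; rewrite exprS.
Qed.

(** The power m of the Cauchy kernel at a = r zeta. Its norm concentrates near zeta at scale
    1 - r. *)
Definition test_fun (r : R) (zeta : C) (m : nat) (z : C) : C := ((1 - r%:C * zeta^-1 * z) ^+ m)^-1.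

Lemma test_fun_holo r zeta m : 0 <= r < 1 -> normc zeta = 1 -> holo 1 (test_fun r zeta m).
Proof.
move=> r01 z1 w w1.
have nz : 1 - r%:C * zeta^-1 * w != 0.
  have [k1 _ _] := kdist_ge r01 z1 w1; have /andP[_ r1] := r01.
  by rewrite -normc_gt0 (lt_le_trans _ k1) // subr_gt0.
have [c Hc] : exists c, cdiff (fun w : C => 1 - r%:C * zeta^-1 * w) w c.
  exists (0 + (0 * w + - (r%:C * zeta^-1) * 1)).
  rewrite (_ : (fun w => _) = fun w => 1 + (- (r%:C * zeta^-1)) * w).
    apply: cdiffD; first exact: cdiff_cst.
    by apply: cdiffM; [exact: cdiff_cst|exact: cdiff_id].
  by apply/funext => v; rewrite mulNr.
have [d Hd] := cdiffX m Hc.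
exists (- (((1 - r%:C * zeta^-1 * w) ^+ m)^-1 ^+ 2) * d).
apply: (cdiff_comp (F := fun w => w^-1) Hd); apply: cdiff_inv.
exact: expf_neq0.
Qed.

Lemma test_fun_norm r zeta m z : 0 <= r < 1 -> normc zeta = 1 -> normc z < 1 ->
  normc (test_fun r zeta m z) = kdist r zeta z `^ (- m%:R).
Proof.
move=> r01 z1 zz; have [k1 _ _] := kdist_ge r01 z1 zz; have /andP[_ r1] := r01.
have k0 : 0 < kdist r zeta z by rewrite (lt_le_trans _ k1) // subr_gt0.
by rewrite /test_fun normcV normcX -/(kdist r zeta z) powRN powR_mulrn // ltW.
Qed.

Lemma test_fun_upper (p al : R) m : 1 <= p -> -1 < al -> al + 2 < p * m%:R ->
  exists2 K : R, 0 < K & forall r zeta, 0 <= r < 1 -> normc zeta = 1 ->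
  (bergman_int p al (test_fun r zeta m) <= (K * (1 - r) `^ (al + 2 - p * m%:R))%:E)%E.
Proof.
move=> p1 al1 pm; have [K K0 HK] := kernel_tail al1 pm; exists K => //.
move=> r zeta r01 z1; have /andP[r0 r1] := r01.
have h0 : 0 < 1 - r by rewrite subr_gt0.
apply: le_trans (HK r zeta (1 - r) r01 z1 h0).
apply: area_int_ler => z; first by rewrite !mulr_ge0 ?disk_ge0 ?powR_ge0.
rewrite {1 2}/disk subr0; case: (ltP (normc z) 1) => zz; last by rewrite !mul0r.
have [k1 _ _] := kdist_ge r01 z1 zz.
rewrite k1 !mul1r test_fun_norm // -powRrM mulNr [m%:R * p]mulrC.
exact: lexx.
Qed.

Lemma kdist_lip r zeta (z a : C) : 0 <= r < 1 -> normc zeta = 1 ->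
  kdist r zeta z <= kdist r zeta a + normc (z - a).
Proof.
move=> /andP[r0 r1] /unit_inv[_ zi _]; rewrite /kdist.
have -> : 1 - r%:C * zeta^-1 * z = (1 - r%:C * zeta^-1 * a) - r%:C * zeta^-1 * (z - a) by ring.
apply: (le_trans (normcB _ _)); rewrite lerD2l !normcM normcR zi mulr1 ger0_norm //.
by rewrite ler_piMl ?normc_ge0 // ltW.
Qed.

Lemma test_fun_lower (p al : R) m : 1 <= p -> -1 < al ->
  exists2 K : R, 0 < K & forall r zeta, 0 <= r < 1 -> normc zeta = 1 ->
  ((K * (1 - r) `^ (al + 2 - p * m%:R))%:E <= bergman_int p al (test_fun r zeta m))%E.
Proof.
move=> p1 al1.
have [|K1 K10 HK1] := @weight_disc R al 2^-1.
  by rewrite invr_ge0 ler0n invf_lt1 ?ltr1n.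
pose K2 : R := 3 `^ (- (p * m%:R)) * (2 `^ `|al| * K1)^-1 * 4^-1.
have K20 : 0 < K2 by rewrite !mulr_gt0 ?powR_gt0 ?invr_gt0 ?mulr_gt0 ?powR_gt0 ?ltr0n.
exists K2 => // r zeta r01 z1; have /andP[r0 r1] := r01.
have h0 : 0 < 1 - r by rewrite subr_gt0.
set h := 1 - r in h0 *; pose a : C := r%:C * zeta.
have na : normc a = r by rewrite normcM normcR z1 mulr1 ger0_norm.
pose rho := 2^-1 * h; have rho0 : 0 < rho by rewrite mulr_gt0 ?invr_gt0.
have pm0 : 0 <= p * m%:R by rewrite mulr_ge0 // (le_trans ler01).
have c0 : 0 <= 3 `^ (- (p * m%:R)) * h `^ (- (p * m%:R)) * ((2 `^ `|al| * K1)^-1 * h `^ al).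
  by rewrite !mulr_ge0 ?powR_ge0 // invr_ge0 mulr_ge0 ?powR_ge0 // ltW.
apply: (@le_trans _ _ ((3 `^ (- (p * m%:R)) * h `^ (- (p * m%:R)) * ((2 `^ `|al| * K1)^-1 * h `^ al))%:E *
    darea rho)%E).
  apply: (le_trans _ (lee_wpmul2l _ (darea_ge rho0))); last by rewrite lee_fin.
  rewrite -EFinM lee_fin /K2.
  have -> : h `^ (al + 2 - p * m%:R) = h `^ (- (p * m%:R)) * h `^ al * h ^+ 2.
    rewrite -powR_mulrn ?(ltW h0) // -!powRD ?(gt_eqF h0) ?implybT //.
    by congr powR; ring.
  by apply: le_of_eq; rewrite /rho; field; rewrite gt_eqF ?powR_gt0 // gt_eqF.
rewrite -(darea_shift a) -area_intZ //; last 2 first.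
- by apply: mC_EFin; exact: measurable_disk.
- by move=> z; rewrite lee_fin disk_ge0.
apply: area_int_le => z; first by rewrite -EFinM lee_fin mulr_ge0 ?disk_ge0.
rewrite -EFinM lee_fin {1}/disk; case: ltP => za; last first.
  by rewrite mulr0 !mulr_ge0 ?disk_ge0 ?powR_ge0.
have a1 : normc a < 1 by rewrite na.
have [|z1' W _] := HK1 a z a1; first by rewrite na.
have [k1 _ _] := kdist_ge r01 z1 z1'.
have k0 : 0 < kdist r zeta z by rewrite (lt_le_trans h0).
have k3 : kdist r zeta z <= 3 * h.
  have : kdist r zeta z <= kdist r zeta a + normc (z - a) by exact: kdist_lip.
  rewrite kdist_self //; move: za r0 r1; rewrite /rho /h; clear; nra.
rewrite mulr1 /disk subr0 z1' mul1r test_fun_norm // -powRrM mulNr [m%:R * p]mulrC.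
rewrite ler_pM ?mulr_ge0 ?powR_ge0 ?invr_ge0 ?mulr_ge0 ?powR_ge0 ?(ltW K10) //.
  rewrite -powRM ?ler0n ?(ltW h0) // !powRN lef_pV2 ?posrE ?powR_gt0 ?mulr_gt0 //.
  by apply: (ge0_ler_powR pm0); rewrite // nnegrE ?(ltW k0) // mulr_ge0 // ltW.
rewrite ler_pdivrMl ?mulr_gt0 ?powR_gt0 // -mulrA.
apply: (@le_trans _ _ (2 `^ `|al| * weight al a)); last by rewrite ler_wpM2l ?powR_ge0.
by have := weight_ge al a1; rewrite na.
Qed.

Lemma root_powR (p x : R) : 0 < p -> 0 <= x -> (x `^ p) `^ p^-1 = x.
Proof. by move=> p0 x0; rewrite -powRrM mulfV ?gt_eqF // powRr1. Qed.

Lemma large_exponent (p al : R) : 1 <= p -> -1 < al -> exists m : nat, al + 2 < p * m%:R.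
Proof.
move=> p1 al1; exists (Num.bound (al + 2)); have a0 : 0 <= al + 2 by move: al1; clear; lra.
by rewrite (lt_le_trans (archi_boundP a0)) // ler_peMl.
Qed.

(** Cauchy's estimate for T_g f at a, on the disc of radius (1 - |a|) / 2, for the test function
    f at a: there f a is comparable to the size of f, and only g' a is left. *)
Lemma bloch_bound (p al : R) (g : R[i]^o -> R[i]^o) : 1 <= p -> -1 < al -> analytic_on_disk g ->
  bounded_operator (bergman_space p al) (bergman_norm p al) (T_ g) ->
  exists2 B : R, 0 < B & forall z, normc z < 1 -> normc (g^`()%classic z) * (1 - normc z) <= B.
Proof.
move=> p1 al1 ga hT; have p0 : 0 < p by rewrite (lt_le_trans ltr01).
have [M M0 HM] := bounded_integral p0 hT.
have [m pm] := large_exponent p1 al1.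
have [K1 K10 HK1] := test_fun_upper p1 al1 pm.
have [K2 K20 HK2] := deriv_weighted al p1.
pose A := K2 * (M * K1) * 2 `^ `|al| * (2 `^ m%:R) `^ p.
have A0 : 0 <= A by rewrite !mulr_ge0 ?powR_ge0 // ltW.
exists (A `^ p^-1 + 1); first by rewrite ltr_wpDl // powR_ge0.
move=> a a1; have [zeta z1 aE] := polar_form a; set r := normc a in a1 aE *.
have r01 : 0 <= r < 1 by rewrite normc_ge0.
have h0 : 0 < 1 - r by rewrite subr_gt0.
set F : R[i]^o -> R[i]^o := test_fun r zeta m.
have Fh : holo 1 F by exact: test_fun_holo.
have FX : bergman_space p al F.
  apply/(bergman_spaceP _ _ p0); split; first exact: holo_analytic.
  have := HK1 r zeta r01 z1; have := bergman_int_ge0 p al F; rewrite -/F.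
  by case: (bergman_int p al F) => // x x0 _; exists x.
have [Ta _] := hT.1 F FX.
have gc w : normc w < 1 -> ccont g^`()%classic w.
  move=> w1; apply: (@cdiff_deriv_cont R g) => // v v1; apply: derivable_cdiff; exact: ga.
have hc w : normc w < 1 -> ccont (fun w => F w * g^`()%classic w) w.
  by move=> w1; apply: ccontM; [have [c /cdiff_cont] := Fh w w1|exact: gc].
have a1' : normc a < 1 by [].
have Td := T_derivative hc Ta a1'.
have := HK2 (T_ g F) a _ (analytic_holo Ta) a1' Td.
set X := area_int _ => H1.
have H2 : (X <= (M * (K1 * (1 - r) `^ (al + 2 - p * m%:R)))%:E)%E.
  apply: (@le_trans _ _ (bergman_int p al (T_ g F))).
    apply: area_int_ler => z; first by rewrite !mulr_ge0 ?disk_ge0 ?powR_ge0.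
    by rewrite ler_piMl ?disk_le1 // !mulr_ge0 ?disk_ge0 ?powR_ge0.
  apply: (le_trans (HM F FX)); rewrite [(M * _)%:E]EFinM; apply: lee_wpmul2l; first by rewrite lee_fin.
  exact: HK1.
have := le_trans H1 (lee_wpmul2l _ H2); rewrite lee_fin (ltW K20) => /(_ isT).
rewrite -EFinM lee_fin normcM test_fun_norm // -/r.
have nr : normc a = r by [].
set kd := kdist r zeta a; set G := normc (g^`()%classic a); set h := 1 - r in h0 *.
have kd2 : 0 < kd <= 2 * h.
  have /andP[r0 r1] := r01; rewrite /kd aE kdist_self // /h.
  by apply/andP; split; move: r0 r1 h0; rewrite /h; clear; nra.
have /andP[kd0 kdh] := kd2; have G0 : 0 <= G by exact: normc_ge0.
have W := weight_ge al a1'; rewrite nr -/h in W.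
have hal : h `^ (al + 2 - p * m%:R) = h `^ (- (p * m%:R)) * h ^+ 2 * h `^ al.
  rewrite -powR_mulrn ?(ltW h0) // -!powRD ?(gt_eqF h0) ?implybT //.
  by congr powR; ring.
have kdE : (kd `^ (- m%:R) * G * h) `^ p = kd `^ (- (p * m%:R)) * (G * h) `^ p.
  rewrite -mulrA powRM ?powR_ge0 ?mulr_ge0 ?(ltW h0) // -powRrM.
  by congr (powR _ _ * _); ring.
have kdl : h `^ (- (p * m%:R)) <= (2 `^ m%:R) `^ p * kd `^ (- (p * m%:R)).
  rewrite -powRrM [m%:R * p]mulrC !powRN ler_pdivlMr ?powR_gt0 // [_^-1 * _]mulrC ler_pdivrMr ?powR_gt0 //.
  rewrite -powRM ?ler0n ?(ltW h0) //.
  apply: ge0_ler_powR; rewrite ?nnegrE ?(ltW kd0) //.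
    by rewrite mulr_ge0 // ltW.
  by rewrite mulr_ge0 // ltW.
rewrite kdE hal; set Y := (G * h) `^ p; set Q := h `^ (- _) in kdl *; set Q' := kd `^ (- _) in kdl *.
have Q0 : 0 < Q by exact: powR_gt0.
have Y0 : 0 <= Y by exact: powR_ge0.
move=> H3; have YA : Y <= A.
  rewrite -(ler_pM2r (mulr_gt0 (mulr_gt0 Q0 (exprn_gt0 2 h0)) (powR_gt0 al h0))).
  have c0 : 0 <= 2 `^ `|al| * (2 `^ m%:R) `^ p :> R by rewrite mulr_ge0 ?powR_ge0.
  have := ler_wpM2l c0 H3; rewrite /A => H4.
  apply: (@le_trans _ _ (2 `^ `|al| * (2 `^ m%:R) `^ p * (Q' * Y * h ^+ 2 * weight al a))); last first.
    by apply: (le_trans H4); apply: le_of_eq; ring.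
  have -> : Y * (Q * h ^+ 2 * h `^ al) = (Y * h ^+ 2) * (Q * h `^ al) by ring.
  have -> : 2 `^ `|al| * (2 `^ m%:R) `^ p * (Q' * Y * h ^+ 2 * weight al a) =
    (Y * h ^+ 2) * (((2 `^ m%:R) `^ p * Q') * (2 `^ `|al| * weight al a)) by ring.
  apply: ler_wpM2l; first by rewrite mulr_ge0 ?sqr_ge0.
  by apply: ler_pM => //; rewrite ?powR_ge0 ?(ltW Q0).
rewrite -/G -[G * h](root_powR p0 (mulr_ge0 G0 (ltW h0))) -/Y.
apply: (@le_trans _ _ (A `^ p^-1)); last by rewrite lerDl.
by apply: ge0_ler_powR; rewrite ?nnegrE ?invr_ge0 ?(ltW p0).
Qed.

End test_functions.

(** * Necessity: where the test functions live *)

Section lower_bound_of_boxes.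
Variable R : realType.
Local Open Scope complex_scope.
Notation C := R[i].

Lemma gder_cont (g : R[i]^o -> R[i]^o) w : analytic_on_disk g -> normc w < 1 -> ccont g^`()%classic w.
Proof.
move=> ga w1; apply: (@cdiff_deriv_cont R g) => // v v1; apply: derivable_cdiff; exact: ga.
Qed.

Lemma product_cont (f g : R[i]^o -> R[i]^o) w : analytic_on_disk f -> analytic_on_disk g -> normc w < 1 ->
  ccont (fun w => f w * g^`()%classic w) w.
Proof.
move=> fa ga w1; apply: ccontM; last exact: gder_cont.
by have [c /cdiff_cont] := analytic_holo fa w1.
Qed.

Lemma mC_disk_ccont (h : C -> C) : (forall w, normc w < 1 -> ccont h w) ->
  mC (fun z => disk 0 1 z * normc (h z)).
Proof.
move=> hc; rewrite (_ : (fun z => _) = (fun z => (normc z < 1)%R%:R * normc (h z))).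
  apply: measurable_cont_on_disk; last by move=> z; exact: normc_ge0.
  move=> z z1 e e0; have [d d0 H] := hc z z1 e e0; exists d => // k /H.
  by apply: le_trans; exact: normc_dist_le.
by apply/funext => z; rewrite /disk subr0.
Qed.

(** Cut off outside the disk, where nothing is known of g. *)
Definition bloch_fun (g : R[i]^o -> R[i]^o) (z : C) : R :=
  disk 0 1 z * normc (g^`()%classic z) * (1 - normc z ^+ 2).

Lemma mC_bloch_fun g : analytic_on_disk g -> mC (bloch_fun g).
Proof.
move=> ga; apply: mCM; first by apply: mC_disk_ccont => w; exact: gder_cont.
apply: measurable_funB; first exact: measurable_cst.
by apply: measurable_funX; exact: measurable_normc.
Qed.

Lemma mC_bloch_fun_gt g (c : R) : analytic_on_disk g -> mC (fun z => (c < bloch_fun g z)%R%:R : R).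
Proof.
move=> ga; apply: (@measurable_bool_real R _ (R * R)%type); apply: measurable_fun_ltr.
  exact: measurable_cst.
exact: mC_bloch_fun.
Qed.

Lemma bloch_fun_gt g (c : R) z : 0 <= c -> (c < bloch_fun g z) = (normc z < 1) &&
  (c < normc (g^`()%classic z) * (1 - normc z ^+ 2)).
Proof.
move=> c0; rewrite /bloch_fun /disk subr0; case: (ltP (normc z) 1) => _; first by rewrite mul1r.
by rewrite !mul0r ltNge c0.
Qed.

Lemma area_norm_estimate (p al : R) : 1 <= p -> -1 < al -> exists2 K : R, 0 < K &
  forall (g f : R[i]^o -> R[i]^o) (S : R), analytic_on_disk g -> analytic_on_disk f -> 0 <= S ->
  (forall z, normc z < 2^-1 -> normc (f z * g^`()%classic z) <= S) ->
  (bergman_int p al (T_ g f) <= K%:E * ((2 `^ p)%:E * area_int (fun z => (disk 0 1 z * (normc (f z) `^ p *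
     ((normc (g^`()%classic z) * (1 - normc z)) `^ p * weight al z)))%:E) + ((2 * S) `^ p)%:E))%E.
Proof.
move=> p1 al1; have p0 : 0 < p by rewrite (lt_le_trans ltr01).
have [K K0 HK] := hardy_area p1 al1; exists K => // g f S ga fa S0 HS.
pose h w := f w * g^`()%classic w.
have hc w : normc w < 1 -> ccont h w by exact: product_cont.
pose H z := 2 * (disk 0 1 z * normc (h z)).
have mH : mC H by apply: mCZ; exact: mC_disk_ccont.
have H0 z : 0 <= H z by rewrite !mulr_ge0 ?disk_ge0 ?normc_ge0.
apply: (le_trans (HK (fun z => normc (T_ g f z)) H (2 * S) mH H0 _ _ _ _)).
- by move=> z; exact: normc_ge0.
- by rewrite mulr_ge0.
- move=> z z2; rewrite ler_pM2l // (le_trans _ (HS z z2)) // ler_piMl ?normc_ge0 ?disk_le1 //.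
- by move=> z z1; have := T_bound hc z1.
have XE z : disk 0 1 z * (normc (f z) `^ p *
     ((normc (g^`()%classic z) * (1 - normc z)) `^ p * weight al z)) =
    (disk 0 1 z * normc (h z) * (1 - normc z)) `^ p * weight al z.
  rewrite /disk subr0; case: (ltP (normc z) 1) => z1; last by rewrite !mul0r powR0 ?mul0r // gt_eqF.
  have z0 : 0 <= 1 - normc z by rewrite subr_ge0 ltW.
  by rewrite !mul1r /h normcM -mulrA [in RHS]powRM ?normc_ge0 ?mulr_ge0 ?normc_ge0 // mulrA.
have mX : mC (fun z => disk 0 1 z * (normc (f z) `^ p *
     ((normc (g^`()%classic z) * (1 - normc z)) `^ p * weight al z))).
  rewrite (funext XE); apply: mCM; last exact: mC_weight.
  apply: mCp; apply: mCM; first exact: mC_disk_ccont.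
  by apply: measurable_funB; [exact: measurable_cst|exact: measurable_normc].
have X0 z : (0 <= (disk 0 1 z * (normc (f z) `^ p *
     ((normc (g^`()%classic z) * (1 - normc z)) `^ p * weight al z)))%:E)%E.
  by rewrite lee_fin !mulr_ge0 ?disk_ge0 ?powR_ge0.
rewrite -(area_intZ (powR_ge0 2 p) (mC_EFin mX) X0).
apply: le_of_eq; congr (_ * (area_int _ + _))%E.
apply/funext => z; rewrite -EFinM XE /H; congr EFin.
rewrite /disk subr0; case: (ltP (normc z) 1) => z1; last by rewrite !mul0r powR0 ?mul0r ?mulr0 // gt_eqF.
have z0 : 0 <= 1 - normc z by rewrite subr_ge0 ltW.
by rewrite !mul1r !powRM ?normc_ge0 // !mulrA.
Qed.

Lemma sum4_lower (Y a b c d e : R) : Y <= a + b + c + d -> 4 * e <= Y -> a <= e -> b <= e -> c <= e ->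
  e <= d.
Proof. lra. Qed.

Definition big_part g (c : R) r zeta (t : R) z : R :=
  kbox r zeta t z * (c < bloch_fun g z)%R%:R.

Lemma mC_big_part g c r zeta t : analytic_on_disk g -> mC (big_part g c r zeta t).
Proof. by move=> ga; apply: mCM; [exact: mC_kbox|exact: mC_bloch_fun_gt]. Qed.

Lemma big_part_ge0 g c r zeta t z : 0 <= big_part g c r zeta t z.
Proof. by have /andP[h _] := kbox01 r zeta t z; rewrite mulr_ge0 ?ler0n. Qed.

(** The four regions of the disk: where g' is small; far from zeta; near zeta but in a thin
    collar; and the rest, which is the part of the box to be bounded from below and on which the
    weight is of order h ^ al. *)
Lemma integrand_split (p al : R) (g : R[i]^o -> R[i]^o) (B c lam eps : R) m r zeta z :
  1 <= p -> 0 <= r < 1 -> normc zeta = 1 -> 0 < c -> 1 <= lam -> 0 < eps <= 1 -> 0 <= B ->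
  (forall z, normc z < 1 -> normc (g^`()%classic z) * (1 - normc z) <= B) ->
  disk 0 1 z * (normc (test_fun r zeta m z) `^ p * ((normc (g^`()%classic z) * (1 - normc z)) `^ p * weight al z)) <=
  c `^ p * (disk 0 1 z * (normc (test_fun r zeta m z) `^ p * weight al z)) +
  B `^ p * (disk 0 1 z * (lam * (1 - r) <= kdist r zeta z)%R%:R * (kdist r zeta z `^ (- (p * m%:R)) * weight al z)) +
  B `^ p * (1 - r) `^ (- (p * m%:R)) * (kbox r zeta (lam * (1 - r)) z * collar (eps * (1 - r)) z * weight al z) +
  B `^ p * (1 - r) `^ (- (p * m%:R)) * ((2 * lam / eps) `^ `|al| * (1 - r) `^ al) * big_part g c r zeta (lam * (1 - r)) z.
Proof.
move=> p1 r01 z1 c0 lam1 /andP[eps0 eps1] B0 HB.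
set h := 1 - r; set f := test_fun r zeta m.
have p0 : 0 < p by rewrite (lt_le_trans ltr01).
have h0 : 0 < h by have /andP[_ r1] := r01; rewrite subr_gt0.
have kb := kbox01 r zeta (lam * h) z; have bp := big_part_ge0 g c r zeta (lam * h) z.
have t1 : 0 <= c `^ p * (disk 0 1 z * (normc (f z) `^ p * weight al z)).
  by rewrite !mulr_ge0 ?disk_ge0 ?powR_ge0.
have t2 : 0 <= B `^ p * (disk 0 1 z * (lam * h <= kdist r zeta z)%R%:R * (kdist r zeta z `^ (- (p * m%:R)) * weight al z)).
  by rewrite !mulr_ge0 ?disk_ge0 ?powR_ge0 ?ler0n.
have t3 : 0 <= B `^ p * h `^ (- (p * m%:R)) * (kbox r zeta (lam * h) z * collar (eps * h) z * weight al z).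
  by have /andP[? _] := kb; rewrite !mulr_ge0 ?disk_ge0 ?powR_ge0 ?ler0n.
have t4 : 0 <= B `^ p * h `^ (- (p * m%:R)) * ((2 * lam / eps) `^ `|al| * h `^ al) * big_part g c r zeta (lam * h) z.
  by rewrite !mulr_ge0 ?powR_ge0.
have [zz|zz] := ltP (normc z) 1; last first.
  by rewrite {1}/disk subr0 (le_gtF zz) mul0r !addr_ge0.
have Dz : disk 0 1 z = 1 by rewrite /disk subr0 zz.
have fE : normc (f z) `^ p = kdist r zeta z `^ (- (p * m%:R)).
  by rewrite test_fun_norm // -powRrM mulNr [m%:R * p]mulrC.
have [k1 k2 _] := kdist_ge r01 z1 zz; set k := kdist r zeta z in fE k1 k2 t2 *.
have k0 : 0 < k by rewrite (lt_le_trans h0).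
have z0 : 0 < 1 - normc z by rewrite subr_gt0.
set G := normc (g^`()%classic z) * (1 - normc z).
have G0 : 0 <= G by rewrite mulr_ge0 ?normc_ge0 // ltW.
have GB : G `^ p <= B `^ p by apply: ge0_ler_powR; rewrite ?nnegrE ?(ltW p0) //; exact: HB.
have [gc|gc] := leP (bloch_fun g z) c.
  have Gc : G `^ p <= c `^ p.
    apply: ge0_ler_powR; rewrite ?nnegrE ?(ltW p0) ?(ltW c0) //.
    apply: le_trans gc; rewrite /bloch_fun Dz mul1r ler_wpM2l ?normc_ge0 //.
    by have := normc_ge0 z; move: zz; clear; nra.
  apply: (@le_trans _ _ (c `^ p * (disk 0 1 z * (normc (f z) `^ p * weight al z)))).
    rewrite Dz !mul1r [normc (f z) `^ p * (_ * _)]mulrCA ler_wpM2r //.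
    by rewrite mulr_ge0 ?powR_ge0.
  by rewrite -!addrA lerDl !addr_ge0.
have main : disk 0 1 z * (normc (f z) `^ p * (G `^ p * weight al z)) <= B `^ p * (k `^ (- (p * m%:R)) * weight al z).
  by rewrite Dz mul1r fE mulrCA ler_wpM2r // mulr_ge0 ?powR_ge0.
apply: (le_trans main).
move: t2; have [kl|kl] := leP (lam * h) k => t2.
  apply: (@le_trans _ _ (B `^ p * (disk 0 1 z * true%:R * (k `^ (- (p * m%:R)) * weight al z)))).
    by rewrite Dz !mul1r.
  by rewrite -!addrA addrCA lerDl !addr_ge0.
have kbE : kbox r zeta (lam * h) z = 1 by rewrite /kbox Dz -/k kl mul1r.
have kh : k `^ (- (p * m%:R)) <= h `^ (- (p * m%:R)).
  rewrite !powRN lef_pV2 ?posrE ?powR_gt0 //.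
  by apply: ge0_ler_powR; rewrite ?nnegrE ?(ltW h0) ?(ltW k0) // mulr_ge0 // ltW.
have main2 : B `^ p * (k `^ (- (p * m%:R)) * weight al z) <= B `^ p * h `^ (- (p * m%:R)) * weight al z.
  by rewrite -mulrA ler_wpM2l ?powR_ge0 // ler_wpM2r ?weight_ge0.
apply: (le_trans main2).
have [ez|ez] := ltP (1 - eps * h) (normc z).
  have cE : collar (eps * h) z = 1 by rewrite /collar Dz ez mul1r.
  rewrite kbE cE !mul1r addrAC lerDr !addr_ge0 //.
have bE : big_part g c r zeta (lam * h) z = 1 by rewrite /big_part kbE gc mul1r.
rewrite bE mulr1; apply: (@le_trans _ _ (B `^ p * h `^ (- (p * m%:R)) * ((2 * lam / eps) `^ `|al| * h `^ al))); last first.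
  by rewrite lerDr !addr_ge0.
rewrite ler_wpM2l ?mulr_ge0 ?powR_ge0 //; have nz := normc_ge0 z.
have l0 : 0 < lam by rewrite (lt_le_trans ltr01).
have le1 : 2 * lam <= 2 * lam / eps by rewrite ler_pdivlMr // ler_piMr // mulr_ge0 // ltW.
apply: powR_comparable => //.
- by apply: le_trans le1; move: lam1; clear; lra.
- rewrite ler_pdivrMr ?divr_gt0 ?mulr_gt0 //.
  have e1 : eps * h <= 1 - normc z by move: ez; clear; lra.
  apply: (@le_trans _ _ ((1 - normc z) * (2 * lam / eps))).
    rewrite mulrA ler_pdivlMr // mulrC; apply: (le_trans e1); rewrite ler_peMr ?(ltW z0) //.
    by move: lam1; clear; lra.
  rewrite ler_wpM2r ?divr_ge0 ?mulr_ge0 ?(ltW l0) ?(ltW eps0) //.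
  by move: zz nz; clear; nra.
- apply: (@le_trans _ _ (2 * lam * h)); last by rewrite ler_wpM2r // ltW.
  by move: k2 kl zz nz; clear; nra.
Qed.

Lemma small_power (a b : R) : 0 < a -> 0 < b -> exists x : R,
  [/\ 0 < x, x <= 1 & forall y, 0 <= y <= x -> y `^ b <= a].
Proof.
move=> a0 b0; exists (Num.min 1 (a `^ b^-1)); split.
- by rewrite lt_min ltr01 powR_gt0.
- by rewrite ge_min lexx.
move=> y /andP[y0 yx]; rewrite -(powR_root b0 (ltW a0)).
apply: ge0_ler_powR; rewrite ?nnegrE ?powR_ge0 ?(ltW b0) //.
by apply: (le_trans yx); rewrite ge_min lexx orbT.
Qed.

Lemma thin_box_area (al : R) : -1 < al -> exists2 K : R, 0 < K & forall r zeta t s,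
  0 <= r < 1 -> normc zeta = 1 -> 0 < t -> t <= 4^-1 -> 0 < s ->
  (area_int (fun z => (kbox r zeta t z * collar s z * weight al z)%:E) <= (K * t * s `^ (al + 1))%:E)%E.
Proof.
move=> al1; have [|q0 q1] := andP (@pow2_ratio R (al + 1) _); first by move: al1; clear; lra.
exists (2 `^ `|al| * 2 * 8 / (1 - 2 `^ (- (al + 1)))).
  by rewrite divr_gt0 ?subr_gt0 // !mulr_gt0 ?powR_gt0.
move=> r zeta t s r01 z1 t0 t4 s0.
apply: (le_trans (@weighted_area R al (8 * t) s (fun z => kbox r zeta t z * collar s z) al1 _ s0 _ _ _ _)).
- by rewrite mulr_ge0 // ltW.
- by apply: mCM; [exact: mC_kbox|exact: mC_collar].
- move=> z; have /andP[k0 k1] := kbox01 r zeta t z.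
  rewrite mulr_ge0 ?collar_ge0 // mulr_ile1 ?collar_ge0 //.
  by rewrite /collar mulr_ile1 ?disk_ge0 ?disk_le1 ?ler0n //; case: (_ < _).
- move=> z; rewrite mulf_eq0 negb_or => /andP[k0 c0].
  have [zz _ _] := kbox_neq0 r01 z1 k0; split=> //.
  move: c0; rewrite /collar; case: (ltP (1 - s) (normc z)) => [h _|_].
    by move: h; clear; lra.
  by rewrite mulr0 eqxx.
- move=> s' s'0; apply: le_trans (kbox_collar r01 z1 t0 t4 s'0).
  apply: area_int_ler => z; have /andP[k0 k1] := kbox01 r zeta t z.
    by rewrite !mulr_ge0 ?collar_ge0.
  rewrite ler_wpM2r ?collar_ge0 // ler_piMr //.
  by rewrite /collar mulr_ile1 ?disk_ge0 ?disk_le1 ?ler0n //; case: (_ < _).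
by rewrite lee_fin; apply: le_of_eq; ring.
Qed.

Lemma big_part_fin g c r zeta t :
  exists2 x : R, 0 <= x & area_int (fun z => (big_part g c r zeta t z)%:E) = x%:E.
Proof.
have [E _] := darea_fin (@ltr01 R).
have H : (area_int (fun z => (big_part g c r zeta t z)%:E) <= darea 1)%E.
  apply: area_int_ler => z; first exact: big_part_ge0.
  rewrite /big_part /kbox -mulrA ler_piMr ?disk_ge0 //.
  by rewrite mulr_ile1 ?ler0n //; case: (_ < _).
have : (0 <= area_int (fun z => (big_part g c r zeta t z)%:E))%E.
  by apply: area_int_ge0 => z; rewrite lee_fin big_part_ge0.
move: H; rewrite E; case: (area_int _) => // x _ x0; by exists x.
Qed.

Lemma area_int_le4 (Y F1 F2 F3 F4 : C -> R) (a b c d : R) : (forall z, 0 <= Y z) ->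
  mC F1 -> mC F2 -> mC F3 -> mC F4 -> (forall z, 0 <= F1 z) -> (forall z, 0 <= F2 z) ->
  (forall z, 0 <= F3 z) -> (forall z, 0 <= F4 z) -> 0 <= a -> 0 <= b -> 0 <= c -> 0 <= d ->
  (forall z, Y z <= a * F1 z + b * F2 z + c * F3 z + d * F4 z) ->
  (area_int (fun z => (Y z)%:E) <= a%:E * area_int (fun z => (F1 z)%:E) +
    b%:E * area_int (fun z => (F2 z)%:E) + c%:E * area_int (fun z => (F3 z)%:E) +
    d%:E * area_int (fun z => (F4 z)%:E))%E.
Proof.
move=> Y0 m1 m2 m3 m4 p1 p2 p3 p4 a0 b0 c0 d0 H.
have q1 z : 0 <= a * F1 z by rewrite mulr_ge0.
have q2 z : 0 <= b * F2 z by rewrite mulr_ge0.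
have q3 z : 0 <= c * F3 z by rewrite mulr_ge0.
have q4 z : 0 <= d * F4 z by rewrite mulr_ge0.
have q12 z : 0 <= a * F1 z + b * F2 z by rewrite addr_ge0.
have q123 z : 0 <= a * F1 z + b * F2 z + c * F3 z by rewrite addr_ge0.
have m12 := mCD (mCZ a m1) (mCZ b m2); have m123 := mCD m12 (mCZ c m3).
rewrite -!area_intZr // -(area_intDr (mCZ a m1) (mCZ b m2) q1 q2).
rewrite -(area_intDr m12 (mCZ c m3) q12 q3) -(area_intDr m123 (mCZ d m4) q123 q4).
exact: area_int_ler.
Qed.

(** Every term in [integrand_split] scales like h ^ (al + 2 - p m). Choosing first c, then lam,
    then eps, each of the first three regions carries at most a quarter of the lower bound for the
    norm; the contribution of |z| < 1/2 is bounded, hence negligible for small h since the exponent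
    is negative. So the last region carries the remaining quarter. *)
Lemma big_part_area (p al : R) (g : R[i]^o -> R[i]^o) : 1 <= p -> -1 < al -> analytic_on_disk g ->
  bounded_operator (bergman_space p al) (bergman_norm p al) (T_ g) ->
  bounded_below (bergman_space p al) (bergman_norm p al) (T_ g) ->
  exists c lam d h0 : R, [/\ 0 < c, 1 <= lam, 0 < d, 0 < h0 &
    forall r zeta, 0 <= r < 1 -> normc zeta = 1 -> 1 - r <= h0 ->
    ((d * (1 - r) ^+ 2)%:E <= area_int (fun z => (big_part g c r zeta (lam * (1 - r)) z)%:E))%E].
Proof.
move=> p1 al1 ga hT hB; have p0 : 0 < p by rewrite (lt_le_trans ltr01).
have [B B0 HB] := bloch_bound p1 al1 ga hT.
have [K K0 HK] := (below_integral p0 hT.1).1 hB.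
have [m pm] := large_exponent p1 al1.
have [K1 K10 HK1] := test_fun_upper p1 al1 pm.
have [K2 K20 HK2] := test_fun_lower m p1 al1.
have [K3 K30 HK3] := kernel_tail al1 pm.
have [Kh Kh0 HKh] := area_norm_estimate p1 al1.
have [Kw Kw0 HKw] := thin_box_area al1.
pose beta := p * m%:R - (al + 2); have beta0 : 0 < beta by rewrite subr_gt0.
pose S := 2 `^ m%:R * (2 * B); have S0 : 0 < S by rewrite !mulr_gt0 ?powR_gt0.
pose C1 := K * Kh * 2 `^ p; have C10 : 0 < C1 by rewrite !mulr_gt0 ?powR_gt0.
pose C2 := K * Kh * (2 * S) `^ p; have C20 : 0 < C2 by rewrite !mulr_gt0 ?powR_gt0 ?mulr_gt0.
pose e := K2 / (2 * C1) / 4; have e0 : 0 < e by rewrite !divr_gt0 ?mulr_gt0.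
have Bp0 : 0 < B `^ p by exact: powR_gt0.
(* in each of the first three regions at most [e] times the power of h *)
have [c [c0 _ Hc]] : exists x, [/\ 0 < x, x <= 1 & forall y, 0 <= y <= x -> y `^ p <= e / K1].
  by apply: small_power => //; exact: divr_gt0.
have [x [x0 x1 Hx]] : exists x, [/\ 0 < x, x <= 1 & forall y, 0 <= y <= x -> y `^ beta <= e / (B `^ p * K3)].
  by apply: small_power => //; rewrite divr_gt0 // !mulr_gt0.
pose lam := x^-1; have lam0 : 0 < lam by rewrite invr_gt0.
have lam1 : 1 <= lam by rewrite invf_ge1.
have [eps [eps0 eps1 Heps]] : exists y, [/\ 0 < y, y <= 1 & forall z, 0 <= z <= y ->
    z `^ (al + 1) <= e / (B `^ p * Kw * lam)].
  by apply: small_power; [rewrite divr_gt0 // !mulr_gt0|move: al1; clear; lra].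
(* below [h1] the contribution of |z| < 1/2 is at most half of the lower bound *)
have [h1 [h10 _ Hh1]] : exists y, [/\ 0 < y, y <= 1 & forall z, 0 <= z <= y -> z `^ beta <= K2 / (2 * C2)].
  by apply: small_power => //; rewrite divr_gt0 // mulr_gt0.
pose Cl := (2 * lam / eps) `^ `|al|; have Cl0 : 0 < Cl by rewrite powR_gt0 // !divr_gt0 ?mulr_gt0.
exists c, lam, (e / (B `^ p * Cl)), (Num.min h1 (4 * lam)^-1).
split=> //; first by rewrite divr_gt0 // mulr_gt0.
  by rewrite lt_min h10 invr_gt0 mulr_gt0.
move=> r zeta r01 z1; rewrite le_min => /andP[hh1 hlam].
have h0 : 0 < 1 - r by have /andP[_ r1] := r01; rewrite subr_gt0.
pose f : R[i]^o -> R[i]^o := test_fun r zeta m.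
have fh : holo 1 f by exact: test_fun_holo.
have HK1' := HK1 r zeta r01 z1; have HK2' := HK2 r zeta r01 z1.
have HK3' := HK3 r zeta (lam * (1 - r)) r01 z1 (mulr_gt0 lam0 h0).
have fX : bergman_space p al f.
  apply/(bergman_spaceP _ _ p0); split; first exact: holo_analytic.
  have := HK1'; have := bergman_int_ge0 p al f; rewrite /f.
  by case: (bergman_int p al _) => // y y0 _; exists y.
have fS z : normc z < 2^-1 -> normc (f z * g^`()%classic z) <= S.
  move=> z2; have zz : normc z < 1 by rewrite (lt_trans z2) // invf_lt1 ?ltr1n.
  have [_ k2 _] := kdist_ge r01 z1 zz.
  have k12 : 2^-1 <= kdist r zeta z by move: k2 z2; clear; lra.
  have k0 : 0 < kdist r zeta z by rewrite (lt_le_trans _ k12) // invr_gt0.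
  rewrite normcM /f test_fun_norm // ler_pM ?powR_ge0 ?normc_ge0 //.
    rewrite powRN -[leRHS]invrK lef_pV2 ?posrE ?invr_gt0 ?powR_gt0 //.
    have -> : (2 `^ m%:R)^-1 = 2^-1 `^ m%:R :> R by rewrite !powR_mulrn ?invr_ge0 // exprVn.
    by apply: ge0_ler_powR; rewrite ?nnegrE ?invr_ge0 // ltW.
  have g0 := normc_ge0 (g^`()%classic z).
  by have := HB z zz; move: z2 g0; clear; nra.
have HY := le_trans (HK f fX) (lee_wpmul2l (ltW (K0 : (0 < K%:E)%E)) (HKh g f S ga (holo_analytic fh) (ltW S0) fS)).
set Y := area_int _ in HY.
have [X X0 XE] := big_part_fin g c r zeta (lam * (1 - r)).
rewrite XE lee_fin.
set h := 1 - r in h0 hh1 hlam HK1' HK2' HK3' *.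
set P := h `^ (al + 2 - p * m%:R) in HK1' HK2'.
have P0 : 0 < P by exact: powR_gt0.
have hpm0 : 0 <= h `^ (- (p * m%:R)) by exact: powR_ge0.
have lh4 : lam * h <= 4^-1.
  have : lam * h <= lam * (4 * lam)^-1 by rewrite ler_pM2l.
  by rewrite invfM mulrCA divff ?gt_eqF // mulr1.
have HKw' := HKw r zeta (lam * h) (eps * h) r01 z1 (mulr_gt0 lam0 h0) lh4 (mulr_gt0 eps0 h0).
have kb0 z : 0 <= kbox r zeta (lam * h) z by have /andP[] := kbox01 r zeta (lam * h) z.
(* the integrals over the four regions *)
pose F1 z := disk 0 1 z * (normc (f z) `^ p * weight al z).
pose F2 z := disk 0 1 z * (lam * h <= kdist r zeta z)%R%:R * (kdist r zeta z `^ (- (p * m%:R)) * weight al z).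
pose F3 z := kbox r zeta (lam * h) z * collar (eps * h) z * weight al z.
pose F4 z := big_part g c r zeta (lam * h) z.
have mF1 : mC F1 by exact: mC_disk_norm_weight.
have mF2 : mC F2.
  apply: mCM; last by apply: mCM; [apply: mCp; exact: mC_kdist|exact: mC_weight].
  apply: mC_disk_bool; apply: (@measurable_bool_real R _ (R * R)%type).
  by apply: measurable_fun_ler; [exact: measurable_cst|exact: mC_kdist].
have mF3 : mC F3.
  by apply: mCM; [apply: mCM; [exact: mC_kbox|exact: mC_collar]|exact: mC_weight].
have mF4 : mC F4 by exact: mC_big_part.
have F10 z : 0 <= F1 z by rewrite !mulr_ge0 ?disk_ge0 ?powR_ge0.
have F20 z : 0 <= F2 z by rewrite !mulr_ge0 ?disk_ge0 ?powR_ge0 ?ler0n.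
have F30 z : 0 <= F3 z by rewrite !mulr_ge0 ?collar_ge0 ?weight_ge0.
have F40 z : 0 <= F4 z by exact: big_part_ge0.
have cp0 : 0 <= c `^ p by exact: powR_ge0.
pose k3 := B `^ p * h `^ (- (p * m%:R)); have k30 : 0 <= k3 by rewrite mulr_ge0 // ltW.
pose k4 := k3 * (Cl * h `^ al); have k40 : 0 <= k4 by rewrite !mulr_ge0 ?powR_ge0 // ltW.
have YE : (Y <= (c `^ p)%:E * bergman_int p al f + (B `^ p)%:E * area_int (fun z => (F2 z)%:E) +
   k3%:E * area_int (fun z => (F3 z)%:E) + k4%:E * X%:E)%E.
  rewrite -XE; apply: area_int_le4 => //; first by move=> z; rewrite !mulr_ge0 ?disk_ge0 ?powR_ge0.
  - exact: ltW.
  - by move=> z; apply: integrand_split => //; [rewrite eps0|exact: ltW].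
have PE b : 0 < b -> (b * h) `^ (al + 2 - p * m%:R) = (b `^ beta)^-1 * P.
  move=> b0; rewrite powRM ?(ltW b0) ?(ltW h0) // -powRN; congr (powR _ _ * _).
  by rewrite /beta; ring.
have A1 : ((c `^ p)%:E * bergman_int p al f <= (e * P)%:E)%E.
  apply: (le_trans (lee_wpmul2l _ HK1')); first by rewrite lee_fin.
  rewrite -EFinM lee_fin mulrA ler_wpM2r ?(ltW P0) // -ler_pdivlMr //.
  by apply: Hc; rewrite (ltW c0) lexx.
have A2 : ((B `^ p)%:E * area_int (fun z => (F2 z)%:E) <= (e * P)%:E)%E.
  apply: (le_trans (lee_wpmul2l _ HK3')); first by rewrite lee_fin ltW.
  rewrite -EFinM lee_fin PE // !mulrA ler_wpM2r ?(ltW P0) //.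
  have -> : (lam `^ beta)^-1 = x `^ beta.
    by rewrite -powRN /lam -powR_inv1 ?(ltW x0) // -powRrM mulrN mulN1r opprK.
  rewrite mulrC -ler_pdivlMr ?mulr_gt0 //.
  by apply: Hx; rewrite (ltW x0) lexx.
have A3 : (k3%:E * area_int (fun z => (F3 z)%:E) <= (e * P)%:E)%E.
  apply: (le_trans (lee_wpmul2l _ HKw')); first by rewrite lee_fin.
  rewrite -EFinM lee_fin.
  have -> : k3 * (Kw * (lam * h) * (eps * h) `^ (al + 1)) =
    eps `^ (al + 1) * (B `^ p * Kw * lam) * P.
    rewrite /k3 powRM ?(ltW eps0) ?(ltW h0) //.
    have -> : P = h `^ (- (p * m%:R)) * h * h `^ (al + 1).
      rewrite -{2}[h]powRr1 ?(ltW h0) // -!powRD ?(gt_eqF h0) ?implybT //.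
      by rewrite /P; congr powR; ring.
    ring.
  rewrite ler_wpM2r ?(ltW P0) // -ler_pdivlMr ?mulr_gt0 //.
  by apply: Heps; rewrite (ltW eps0) lexx.
have := le_trans YE (leeD (leeD (leeD A1 A2) A3) (lexx _)).
rewrite -EFinM -!EFinD => YU.
have Y0 : (0 <= Y)%E by apply: area_int_ge0 => z; rewrite lee_fin !mulr_ge0 ?disk_ge0 ?powR_ge0.
have [y y0 yE] : exists2 y : R, 0 <= y & Y = y%:E.
  by move: Y0 YU; case: (Y) => // y' y'0 _; exists y'.
have := le_trans HK2' HY; move: YU; rewrite yE -[((2 `^ p)%:E * _)%E]EFinM -[(_ + ((2 * S) `^ p)%:E)%E]EFinD -!EFinM !lee_fin => YU YL.
have hC2 : C2 <= K2 / 2 * P.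
  have hb : h `^ beta <= K2 / (2 * C2) by apply: Hh1; rewrite (ltW h0).
  have PV : P = (h `^ beta)^-1 by rewrite -powRN /P; congr powR; rewrite /beta; ring.
  rewrite PV ler_pdivlMr ?powR_gt0 //; apply: (le_trans (ler_wpM2l (ltW C20) hb)).
  by apply: le_of_eq; field; rewrite gt_eqF.
have YL2 : 4 * (e * P) <= y.
  have -> : 4 * (e * P) = (K2 / 2 * P) / C1 by rewrite /e; field; rewrite gt_eqF.
  rewrite ler_pdivrMr //.
  have -> : y * C1 = K * (Kh * (2 `^ p * y)) by rewrite /C1; ring.
  have E2 : K * (Kh * (2 `^ p * y + (2 * S) `^ p)) = K * (Kh * (2 `^ p * y)) + C2 by rewrite /C2; ring.
  by move: YL hC2; rewrite E2; clear; lra.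
have := sum4_lower YU YL2 (lexx _) (lexx _) (lexx _).
have k4E : k4 = (B `^ p * Cl) * (h `^ (- (p * m%:R)) * h `^ al) by rewrite /k4 /k3; ring.
have PP : P = h `^ (- (p * m%:R)) * h `^ al * h ^+ 2.
  rewrite -powR_mulrn ?(ltW h0) // -!powRD ?(gt_eqF h0) ?implybT //.
  by rewrite /P; congr powR; ring.
rewrite k4E PP => HF.
have q0 : 0 < h `^ (- (p * m%:R)) * h `^ al by rewrite mulr_gt0 ?powR_gt0.
have b0 : 0 < B `^ p * Cl by rewrite mulr_gt0.
rewrite -(ler_pM2l (mulr_gt0 b0 q0)); apply: le_trans HF.
by apply: le_of_eq; field; rewrite !gt_eqF.
Qed.

End lower_bound_of_boxes.

(** * Necessity: from kernel boxes to Carleson boxes *)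

Section arcs.
Variable R : realType.
Local Open Scope complex_scope.
Notation C := R[i].

Lemma lipschitz_of_derivative (f df : R -> R) : (forall x, is_derive x (1 : R) f (df x)) ->
  (forall x, `|df x| <= 1) -> forall x, `|f x - f 0| <= `|x|.
Proof.
move=> fd d1 x; have fc : continuous f.
  by move=> y; apply: differentiable_continuous; apply/derivable1_diffP; have [] := fd y.
have H (a b : R) : a <= b -> `|f b - f a| <= b - a.
  move=> ab; have [|c _ ->] := @MVT_segment R f df a b ab (fun x _ => fd x).
    exact: continuous_subspaceT.
  by rewrite normrM [`|b - a|]ger0_norm ?subr_ge0 // ler_piMl ?subr_ge0.
have [x0|x0] := leP 0 x; first by rewrite [`|x|]ger0_norm //; have := H 0 x x0; rewrite subr0.
by rewrite distrC [`|x|]ltr0_norm //; have := H x 0 (ltW x0); rewrite sub0r.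
Qed.

Lemma atan_le (u : R) : `|atan u| <= `|u|.
Proof.
have := @lipschitz_of_derivative atan _ (@is_derive1_atan R) _ u; rewrite atan0 subr0; apply.
move=> x; have x0 : 0 <= x ^+ 2 by exact: sqr_ge0.
have s0 : 0 < 1 + x ^+ 2 by rewrite ltr_wpDr.
by rewrite ger0_norm ?invr_ge0 ?(ltW s0) // invf_le1 // lerDl.
Qed.

Lemma sin_le (u : R) : `|sin u| <= `|u|.
Proof.
have := @lipschitz_of_derivative sin cos (@is_derive_sin R) _ u; rewrite sin0 subr0; apply.
by move=> x; rewrite ler_norml cos_geN1 cos_le1.
Qed.

Lemma chord_le (x y : R) : normc (cis x - cis y) <= `|x - y|.
Proof.
have -> : cis x - cis y = cis y * (cis (x - y) - 1).
  by rewrite mulrBr mulr1 -cisD; congr (cis _ - _); ring.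
rewrite normcM normc_cis mul1r; set u := x - y.
rewrite -(@ler_pXn2r _ 2) ?nnegrE ?normc_ge0 // normc_sqr /=.
have -> : u = u / 2 *+ 2 by rewrite -mulr_natr divfK.
set v := u / 2; rewrite cos_mulr2n sin_mulr2n.
have : sin v ^+ 2 <= v ^+ 2.
  rewrite -[leLHS]real_normK ?num_real // -[leRHS]real_normK ?num_real //.
  by rewrite ler_pXn2r ?nnegrE // sin_le.
rewrite [X in _ -> _ <= X]real_normK ?num_real // => H.
have := cos2Dsin2 v; move: H.
move: (cos v) (sin v) => a b H E.
have -> : (v *+ 2) ^+ 2 = 4 * v ^+ 2 by ring.
have -> : (a ^+ 2 *+ 2 - 1 - 1) ^+ 2 + (a * b *+ 2 - 0) ^+ 2 =
  4 * (1 - a ^+ 2) ^+ 2 + 4 * (a ^+ 2 * b ^+ 2) by ring.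
have -> : 1 - a ^+ 2 = b ^+ 2 by rewrite -E; ring.
have -> : 4 * (b ^+ 2) ^+ 2 + 4 * (a ^+ 2 * b ^+ 2) = 4 * ((a ^+ 2 + b ^+ 2) * b ^+ 2) by ring.
by rewrite E mul1r ler_pM2l.
Qed.

Lemma small_angle (w : C) (d : R) : normc w = 1 -> normc (w - 1) <= d -> d <= 2^-1 ->
  exists2 th : R, cis th = w & `|th| <= 2 * d.
Proof.
case: w => x y w1 wd d2.
have x2 : 2^-1 <= x.
  have := le_trans (normRe ((x +i* y) - 1)) wd; rewrite /= ler_norml => /andP[].
  by move: d2; clear; lra.
have yd : `|y| <= d by have := le_trans (normIm ((x +i* y) - 1)) wd; rewrite /= subr0.
have x0 : 0 < x by rewrite (lt_le_trans _ x2) // invr_gt0.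
exists (atan (y / x)); last first.
  apply: (le_trans (atan_le _)); rewrite normrM [`|x^-1|]gtr0_norm ?invr_gt0 //.
  rewrite ler_pdivrMr //; have := normr_ge0 y; move: x2 yd; clear; nra.
have xy : x ^+ 2 + y ^+ 2 = 1 by have := normc_sqr (x +i* y); rewrite w1 expr1n.
have cE : cos (atan (y / x)) = x.
  rewrite cos_atan; have -> : 1 + (y / x) ^+ 2 = (x^-1) ^+ 2.
    have yE : y ^+ 2 = 1 - x ^+ 2 by rewrite -xy; ring.
    by rewrite exprMn yE; field; rewrite gt_eqF.
  by rewrite sqrtr_sqr gtr0_norm ?invr_gt0 // invrK.
rewrite /cis cE; congr (_ +i* _).
have := atanK (y / x); rewrite /tan cE => /(congr1 (fun u => u * x)).
by rewrite !divfK ?gt_eqF.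
Qed.

Lemma arc_contains (b1 b2 : bool) (s t x : R) : s < x < t ->
  [set cos y +i* sin y | y in [set` Interval (BSide b1 s) (BSide b2 t)]] (cis x).
Proof.
move=> /andP[sx xt]; exists x => //=.
rewrite in_itv /=; case: b1; case: b2; rewrite /= ?(ltW sx) ?(ltW xt) ?sx ?xt //.
Qed.

(** The point z / |z| is close to zeta, and small chords have small angles. *)
Lemma near_arc_in_box (I : set R[i]^o) (b1 b2 : bool) (s t q : R) (z : C) :
  s < t -> I = [set cos y +i* sin y | y in [set` Interval (BSide b1 s) (BSide b2 t)]] ->
  16 * q <= t - s -> 16 * q <= 1 -> normc z < 1 -> 1 - normc z < q ->
  normc (z - cis ((s + t) / 2)) <= 2 * q -> carleson_box I (t - s) z.
Proof.
move=> st IE ql q1 z1 zq zz; set zeta := cis _ in zz *.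
have n0 : 0 < normc z by move: zq q1; clear; lra.
have nz : (normc z)%:C != 0 :> C by rewrite -normc_gt0 normcR gtr0_norm.
have zt0 : zeta != 0 by exact: cis_neq0.
pose w := z / ((normc z)%:C * zeta).
have w1 : normc w = 1.
  by rewrite /w normcM normcV normcM normc_cis mulr1 normcR gtr0_norm // divff // gt_eqF.
have wE : z = (normc z)%:C * (zeta * w).
  by rewrite /w; field; rewrite nz zt0.
clearbody w.
 have wd : normc (w - 1) <= 3 * q.
  have -> : normc (w - 1) = normc (zeta * w - zeta).
    by rewrite -{2}[zeta]mulr1 -mulrBr normcM normc_cis mul1r.
  have -> : zeta * w - zeta = (z - zeta) + (1 - (normc z)%:C) * (zeta * w).
    by rewrite mulrBl mul1r -wE; ring.
  apply: (le_trans (normcD _ _)); rewrite !normcM normc_cis w1 !mulr1.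
  have -> : normc (1 - (normc z)%:C) = 1 - normc z.
    rewrite (_ : 1 - (normc z)%:C = (1 - normc z)%:C); last by rewrite rmorphB rmorph1.
    by rewrite normcR ger0_norm // subr_ge0 ltW.
  by move: zz zq; clear; lra.
have [|th thw thd] := small_angle w1 wd; first by move: q1; clear; lra.
have zwE : zeta * w = cis ((s + t) / 2 + th) by rewrite cisD thw.
exists (normc z), (zeta * w); split=> //.
- exact: ltW.
- by move: zq ql z1; clear; lra.
- rewrite IE zwE; apply: arc_contains; move: thd; rewrite ler_norml => /andP[t1 t2].
  have q0 : 0 < q by move: zq z1; clear; lra.
  by apply/andP; split; move: t1 t2 q0 ql; clear; lra.
Qed.

(** A long arc is replaced by a short one with the same midpoint; this costs a constant because
    an arc has length at most 2 pi < 8. *)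
Lemma boxes_of_bounded_below (p al : R) (g : R[i]^o -> R[i]^o) : 1 <= p -> -1 < al -> analytic_on_disk g ->
  bounded_operator (bergman_space p al) (bergman_norm p al) (T_ g) ->
  bounded_below (bergman_space p al) (bergman_norm p al) (T_ g) ->
  exists c delta : R, [/\ 0 < c, 0 < delta &
    forall (I : set R[i]^o) (l : R), is_arc I l ->
      ((delta * l ^+ 2)%:E <
       area (coords ([set z : R[i]^o | unit_disk z /\
                       (c < normc (g^`()%classic z) * (1 - normc z ^+ 2))%R]
                     `&` carleson_box I l)))%E].
Proof.
move=> p1 al1 ga hT hB.
have [c [lam [d [h0 [c0 lam1 d0 h00 H]]]]] := big_part_area p1 al1 ga hT hB.
have lam0 : 0 < lam by rewrite (lt_le_trans ltr01).
have L0 : 0 < 16 * lam by rewrite mulr_gt0.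
pose l0 := Num.min 1 (16 * lam * h0).
have l00 : 0 < l0 by rewrite lt_min ltr01 mulr_gt0.
have [l01 l0h] : l0 <= 1 /\ l0 <= 16 * lam * h0 by rewrite !ge_min !lexx orbT.
pose kap := l0 / 8 / (16 * lam); have kap0 : 0 < kap by rewrite !divr_gt0.
exists c, (d * kap ^+ 2 / 2); split => //; first by rewrite divr_gt0 // mulr_gt0 // exprn_gt0.
move=> I l [b1 [b2 [s [t [st ts lE IE]]]]].
have l_gt0 : 0 < l by rewrite lE subr_gt0.
have l8 : l <= 8 by have := @pihalf_lt2 R; rewrite lE; move: ts; clear; move: pi => pi; lra.
(* length of the shorter arc, small enough for [big_part_area] to apply *)
pose l' := Num.min l l0.
have l'0 : 0 < l' by rewrite lt_min l_gt0.
have l'l : l' <= l by rewrite ge_min lexx.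
have l'l0 : l' <= l0 by rewrite /l' ge_min lexx orbT.
have l'k : l0 / 8 * l <= l'.
  by rewrite le_min; apply/andP; split; move: l8 l_gt0 l00 l01; clear; nra.
pose h := l' / (16 * lam); have h_gt0 : 0 < h by rewrite divr_gt0.
have hq : lam * h = l' / 16 by rewrite /h; field; rewrite gt_eqF.
have h1 : h <= 1.
  by rewrite ler_pdivrMr // mul1r; move: l'l0 l01 lam1; clear; lra.
have hh0 : h <= h0 by rewrite ler_pdivrMr // mulrC (le_trans l'l0).
pose zeta : C := cis ((s + t) / 2).
have r01 : 0 <= 1 - h < 1 by rewrite subr_ge0 h1 gtrBl.
have z1 : normc zeta = 1 by exact: normc_cis.
have := H (1 - h) zeta r01 z1; rewrite opprB addrC subrK => /(_ hh0).
pose b z : bool := [&& normc z < 1, kdist (1 - h) zeta z < lam * h & c < bloch_fun g z].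
have bE z : big_part g c (1 - h) zeta (lam * h) z = (b z)%:R.
  rewrite /big_part /kbox /disk subr0 /b.
  by case: (normc z < 1); case: (kdist _ _ z < _); case: (c < _); rewrite ?mul1r ?mul0r ?mulr0.
have mb : mC (fun z => (b z)%:R : R).
  by have := mC_big_part c (1 - h) zeta (lam * h) ga; rewrite (funext bE).
rewrite (_ : (fun z => _) = fun z => ((b z)%:R)%:E); last by apply/funext => z; rewrite bE.
rewrite -area_bool // => HA.
apply: lt_le_trans (le_trans HA (area_mono _)); last first.
  move=> u /and3P[b_1 b_2 b_3]; rewrite /coords /=.
  move: b_3; rewrite bloch_fun_gt ?(ltW c0) // => /andP[_ b_3].
  split; first by split.
  have [k1 k2 _] := kdist_ge r01 z1 b_1.
  rewrite lE; apply: (@near_arc_in_box I b1 b2 s t (lam * h)) => //.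
  - by rewrite hq -lE; move: l'l; clear; lra.
  - by rewrite hq; move: l'l0 l01; clear; lra.
  - exact: le_lt_trans b_2.
  - apply: (le_trans (kdist_near r01 z1 b_1)).
    by rewrite ler_pM2l // ltW.
rewrite lte_fin; have hk : kap * l <= h.
  rewrite /kap /h mulrAC ler_wpM2r ?invr_ge0 ?(ltW L0) //.
have k2 : (kap * l) ^+ 2 <= h ^+ 2.
  by rewrite ler_pXn2r ?nnegrE ?(ltW h_gt0) // mulr_ge0 // ltW.
have k3 : 0 < d * (kap * l) ^+ 2 by rewrite mulr_gt0 // exprn_gt0 // mulr_gt0.
apply: (@lt_le_trans _ _ (d * (kap * l) ^+ 2)); last by rewrite ler_pM2l.
by rewrite (_ : d * kap ^+ 2 / 2 * l ^+ 2 = d * (kap * l) ^+ 2 / 2); [move: k3; clear; lra|ring].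
Qed.

End arcs.

(** * Sufficiency: from Carleson boxes to discs *)

Section boxes_to_discs.
Variable R : realType.
Local Open Scope complex_scope.
Notation C := R[i].

Lemma polar_dist (r r' th ph : R) :
  normc (r'%:C * cis th - r%:C * cis ph) ^+ 2 = (r' - r) ^+ 2 + r * r' * normc (cis th - cis ph) ^+ 2.
Proof.
rewrite !normc_sqr /=; have E1 := cos2Dsin2 th; have E2 := cos2Dsin2 ph.
move: (cos th) (sin th) (cos ph) (sin ph) E1 E2 => a b c d E1 E2.
transitivity (r' ^+ 2 * (a ^+ 2 + b ^+ 2) + r ^+ 2 * (c ^+ 2 + d ^+ 2) - 2 * r * r' * (a * c + b * d)).
  by ring.
transitivity ((r' - r) ^+ 2 + r * r' * ((a ^+ 2 + b ^+ 2) + (c ^+ 2 + d ^+ 2) - 2 * (a * c + b * d))).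
  by rewrite E1 E2; ring.
by ring.
Qed.

(** A box over an arc of length l = (1 - |a|) / K around a / |a| reaches the unit circle, so it is
    not inside the disc of radius rho (1 - |a|) about a. Its points at depth at least eps l are,
    because (K - eps) ^ 2 + 1/4 < (K - eps / 2) ^ 2 when K eps = 4. *)
Lemma disc_of_box (I : set R[i]^o) (ph l eps K r : R) (z a : C) : 0 < l -> 0 < eps <= 1 -> K * eps = 4 ->
  I = [set cos y +i* sin y | y in [set` Interval (BSide true (ph - l / 2)) (BSide false (ph + l / 2))]] ->
  0 <= r -> 1 - r = K * l -> a = r%:C * cis ph -> carleson_box I l z ->
  normc (z - cis ph) < 2 * l /\ (normc z <= 1 - eps * l -> normc (z - a) < (1 - eps ^+ 2 / 8) * (1 - r)).
Proof.
move=> l0 /andP[e0 e1] Ke IE r0 rl aE [r' [zeta [r'0 rl' r'1 Iz zE]]].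
move: Iz; rewrite IE => -[th]; rewrite /= in_itv /= => /andP[t1 t2] zt.
have {zt}zE : z = r'%:C * cis th by rewrite zE -zt.
have tp : `|th - ph| <= l / 2.
  by rewrite ler_norml; apply/andP; split; move: t1 t2; clear; lra.
have ch := le_trans (chord_le th ph) tp.
split.
  have -> : z - cis ph = r'%:C * (cis th - cis ph) - (1 - r'%:C) * cis ph by rewrite zE; ring.
  apply: (le_lt_trans (normcB _ _)); rewrite !normcM normc_cis mulr1 normcR ger0_norm //.
  have -> : normc (1 - r'%:C) = 1 - r'.
    rewrite (_ : 1 - r'%:C = (1 - r')%:C); last by rewrite rmorphB rmorph1.
    by rewrite normcR ger0_norm // subr_ge0 ltW.
  have n0 := normc_ge0 (cis th - cis ph).
  by move: ch n0 rl' r'0 r'1 l0; clear; nra.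
move=> zl; have nz : normc z = r' by rewrite zE normcM normc_cis mulr1 normcR ger0_norm.
rewrite nz in zl; have K0 : 4 <= K.
  have : 0 <= K by rewrite -(pmulr_lge0 _ e0) Ke.
  by move: Ke e1 e0; clear; nra.
have rr : 0 <= r' - r <= (K - eps) * l.
  by apply/andP; split; move: zl rl rl' K0 l0; clear; nra.
have rho0 : 0 <= (1 - eps ^+ 2 / 8) * (1 - r).
  by rewrite rl mulr_ge0 ?mulr_ge0 ?(ltW l0) //; [move: e0 e1; clear; nra|move: K0; clear; lra].
rewrite -(@ltr_pXn2r _ 2) ?nnegrE ?normc_ge0 // aE zE polar_dist.
have -> : (1 - eps ^+ 2 / 8) * (1 - r) = (K - eps / 2) * l.
  rewrite rl; have -> : (1 - eps ^+ 2 / 8) * (K * l) = (K - (K * eps) * eps / 8) * l by ring.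
  by rewrite Ke; field.
have n0 := normc_ge0 (cis th - cis ph).
have c2 : normc (cis th - cis ph) ^+ 2 <= l ^+ 2 / 4.
  have -> : l ^+ 2 / 4 = (l / 2) ^+ 2 by field.
  by rewrite ler_pXn2r ?nnegrE // divr_ge0 // ltW.
have r1 : r <= 1 by rewrite -subr_ge0 rl mulr_ge0 ?(ltW l0) //; move: K0; clear; lra.
have c3 : r * r' * normc (cis th - cis ph) ^+ 2 <= l ^+ 2 / 4.
  apply: le_trans c2; rewrite ler_piMl ?sqr_ge0 // mulr_ile1 // ltW //.
have c4 : (r' - r) ^+ 2 <= ((K - eps) * l) ^+ 2.
  by have /andP[rr0 rr1] := rr; rewrite ler_pXn2r ?nnegrE // (le_trans rr0).
apply: (le_lt_trans (lerD c4 c3)).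
have -> : ((K - eps) * l) ^+ 2 + l ^+ 2 / 4 = ((K - eps) ^+ 2 + 4^-1) * l ^+ 2 by field.
rewrite exprMn ltr_pM2r ?exprn_gt0 // -subr_gt0.
have -> : (K - eps / 2) ^+ 2 - ((K - eps) ^+ 2 + 4^-1) = K * eps - 3 / 4 * eps ^+ 2 - 4^-1 by field.
by rewrite Ke; move: e0 e1; clear; nra.
Qed.

(** The part of the box at depth less than eps l has area O(eps l ^ 2), which for small eps is
    less than half of the given lower bound. *)
Lemma discs_of_boxes (g : R[i]^o -> R[i]^o) (c delta : R) : analytic_on_disk g -> 0 < c -> 0 < delta ->
  (forall (I : set R[i]^o) (l : R), is_arc I l ->
      ((delta * l ^+ 2)%:E <
       area (coords ([set z : R[i]^o | unit_disk z /\
                       (c < normc (g^`()%classic z) * (1 - normc z ^+ 2))%R]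
                     `&` carleson_box I l)))%E) ->
  exists rho eta : R, [/\ 0 < rho < 1, 0 < eta & forall a, normc a < 1 ->
    ((eta * (1 - normc a) ^+ 2)%:E <=
      area_int (fun z => (disk a (rho * (1 - normc a)) z * (c < bloch_fun g z)%R%:R)%:E))%E].
Proof.
move=> ga c0 d0 H.
pose eps := Num.min 1 (delta / 16).
have e0 : 0 < eps by rewrite lt_min ltr01 divr_gt0.
have [e1 e16] : eps <= 1 /\ eps <= delta / 16 by rewrite !ge_min !lexx orbT.
pose K := 4 / eps; have Ke : K * eps = 4 by rewrite divfK // gt_eqF.
have K4 : 4 <= K by rewrite ler_pdivlMr // ler_piMr.
have K0 : 0 < K by rewrite (lt_le_trans _ K4).
exists (1 - eps ^+ 2 / 8), (delta / (2 * K ^+ 2)); split.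
- by apply/andP; split; move: e0 e1; clear; nra.
- by rewrite divr_gt0 // mulr_gt0 // exprn_gt0.
move=> a a1; have [zeta z1 aE] := polar_form a; have [ph phE] := unit_cis z1.
set r := normc a in a1 aE *.
have r0 : 0 <= r by exact: normc_ge0.
pose l := (1 - r) / K; have l0 : 0 < l by rewrite divr_gt0 // subr_gt0.
have rl : 1 - r = K * l by rewrite /l mulrC divfK // gt_eqF.
have l4 : l <= 4^-1 by rewrite /l ler_pdivrMr //; move: K4 r0; clear; lra.
pose I : set R[i]^o := [set cos y +i* sin y | y in [set` Interval (BSide true (ph - l / 2)) (BSide false (ph + l / 2))]].
have arcI : is_arc I l.
  exists true, false, (ph - l / 2), (ph + l / 2); split => //.
  - by move: l0; clear; lra.
  - by have := @pi_ge2 R; move: l4; clear; move: pi => pi; lra.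
  - by field.
have {H} := H I l arcI.
set rho := 1 - eps ^+ 2 / 8.
pose b1 z : bool := (normc (z - a) < rho * (1 - r)) && (c < bloch_fun g z).
pose b2 z : bool := [&& normc z < 1, 1 - eps * l < normc z & normc (z - zeta) < 2 * l].
have mb1 : mC (fun z => (b1 z)%:R : R).
  have : mC (fun z => disk a (rho * (1 - r)) z * (c < bloch_fun g z)%R%:R).
    by apply: mCM; [exact: measurable_disk|exact: mC_bloch_fun_gt].
  by congr mC; apply/funext => z; rewrite /b1 /disk; case: (_ < _); rewrite ?mul1r ?mul0r.
have b2E z : (b2 z)%:R = collar (eps * l) z * disk zeta (2 * l) z.
  rewrite /b2 /collar /disk subr0.
  by case: (normc z < 1); case: (_ < normc z); case: (_ < 2 * l); rewrite ?mul1r ?mul0r ?mulr0.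
have mb2 : mC (fun z => (b2 z)%:R : R).
  by rewrite (funext b2E); apply: mCM; [exact: mC_collar|exact: measurable_disk].
have bE z : (b1 z || b2 z)%:R = 1 - (1 - (b1 z)%:R) * (1 - (b2 z)%:R) :> R.
  by case: (b1 z); case: (b2 z); rewrite /= ?subrr ?subr0 ?mul0r ?mulr0 ?mulr1 ?subrr ?subr0.
have mb : mC (fun z => (b1 z || b2 z)%:R : R).
  rewrite (funext bE); apply: measurable_funB; first exact: measurable_cst.
  apply: (mCM (phi := fun z => 1 - (b1 z)%:R) (psi := fun z => 1 - (b2 z)%:R)).
    by apply: measurable_funB; [exact: measurable_cst|exact: mb1].
  by apply: measurable_funB; [exact: measurable_cst|exact: mb2].
have S2 : (area_int (fun z => ((b2 z)%:R : R)%:E) <= (delta / 2 * l ^+ 2)%:E)%E.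
  have -> : (fun z => ((b2 z)%:R : R)%:E) = fun z => (collar (eps * l) z * disk zeta (2 * l) z)%:E.
    by apply/funext => z; rewrite b2E.
  apply: (le_trans (strip_area _ _ _ z1)).
  - by rewrite mulr_gt0.
  - by rewrite mulr_gt0.
  - by move: l4; clear; lra.
  rewrite lee_fin; have l20 : 0 < l ^+ 2 by rewrite exprn_gt0.
  rewrite (_ : 4 * (eps * l) * (2 * l) = 8 * eps * l ^+ 2); last by ring.
  by rewrite ler_pM2r //; move: e16; clear; lra.
have := area_mono (A := coords ([set z : R[i]^o | unit_disk z /\
     (c < normc (g^`()%classic z) * (1 - normc z ^+ 2))%R] `&` carleson_box I l))
   (B := coords [set z | b1 z || b2 z]).
have incl : coords ([set z : R[i]^o | unit_disk z /\
     (c < normc (g^`()%classic z) * (1 - normc z ^+ 2))%R] `&` carleson_box I l) `<=`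
   coords [set z | b1 z || b2 z].
  move=> u [[u1 u2] ub]; rewrite /coords /=; set z := u.1 +i* u.2 in u1 u2 ub *.
  have eps01 : 0 < eps <= 1 by rewrite e0.
  have aE' : a = r%:C * cis ph by rewrite aE phE.
  have [n1 n2] := disc_of_box l0 eps01 Ke (erefl I) r0 rl aE' ub.
  rewrite /b1 /b2; rewrite bloch_fun_gt ?(ltW c0) // u1 u2 andbT /=.
  have [n3|n3] := ltP (1 - eps * l) (normc z); last by rewrite n2.
  by rewrite -phE n1 orbT.
move=> /(_ incl) HA HB.
have := lt_le_trans HB HA; rewrite area_bool // => HC.
have HD : (area_int (fun z => ((b1 z || b2 z)%:R : R)%:E) <=
  area_int (fun z => ((b1 z)%:R : R)%:E) + area_int (fun z => ((b2 z)%:R : R)%:E))%E.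
  rewrite -area_intDr //.
  apply: area_int_ler => z; first exact: ler0n.
  by case: (b1 z); case: (b2 z); rewrite /= ?addr0 ?add0r // ler_wpDl.
have := lt_le_trans HC (le_trans HD (leeD (lexx _) S2)).
have -> : area_int (fun z => (disk a (rho * (1 - r)) z * (c < bloch_fun g z)%R%:R)%:E) =
  area_int (fun z => ((b1 z)%:R : R)%:E).
  by congr area_int; apply/funext => z; congr EFin; rewrite /b1 /disk; case: (_ < _); rewrite ?mul1r ?mul0r.
have : (0 <= area_int (fun z => ((b1 z)%:R : R)%:E))%E.
  by apply: area_int_ge0 => z; rewrite lee_fin ler0n.
case: (area_int _) => // [x _|_ _]; last by rewrite leey.
rewrite -EFinD lte_fin lee_fin rl => Hx.
have -> : delta / (2 * K ^+ 2) * (K * l) ^+ 2 = delta / 2 * l ^+ 2.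
  by field; rewrite gt_eqF.
by move: Hx; clear; lra.
Qed.

End boxes_to_discs.

(** * Sufficiency: averages over discs *)

Section disc_averages.
Variable R : realType.
Notation mu := (@lebesgue_measure R).
Notation dA := (@lebesgue_measure R \x @lebesgue_measure R)%E.
Local Open Scope complex_scope.
Notation C := R[i].

Definition disc_kernel (rho : R) (a z : C) : R :=
  disk 0 1 a * (1 - normc a) `^ (- 2) * disk a (rho * (1 - normc a)) z.

Lemma disc_kernel_ge0 rho a z : 0 <= disc_kernel rho a z.
Proof. by rewrite !mulr_ge0 ?disk_ge0 ?powR_ge0. Qed.

Lemma measurable_disc_kernel (rho : R) (phi : C -> R) : mC phi ->
  measurable_fun [set: (R * R) * (R * R)] (fun w => (disc_kernel rho (cx w.1) (cx w.2) * phi (cx w.2))%:E).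
Proof.
move=> mphi; have mn := @measurable_normc R; apply/measurable_EFinP.
have first (psi : C -> R) : mC psi -> measurable_fun [set: (R * R) * (R * R)] (fun w => psi (cx w.1)).
  by move=> m; apply: (measurableT_comp m); exact: measurable_fst.
have second (psi : C -> R) : mC psi -> measurable_fun [set: (R * R) * (R * R)] (fun w => psi (cx w.2)).
  by move=> m; apply: (measurableT_comp m); exact: measurable_snd.
have m1 : mC (fun a => 1 - normc a : R) by apply: measurable_funB; [exact: measurable_cst|].
apply: measurable_funM; last exact: second.
apply: measurable_funM.
  apply: (first (fun a => disk 0 1 a * (1 - normc a) `^ (- 2))).
  by apply: mCM; [exact: measurable_disk|exact: mCp].
apply: measurable_bool_real; apply: measurable_fun_ltr; last first.
  by apply: (first (fun a => rho * (1 - normc a))); exact: mCZ.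
pose d (w : (R * R) * (R * R)) : R * R := (w.2.1 - w.1.1, w.2.2 - w.1.2).
have md : measurable_fun setT d.
  apply/measurable_fun_pairP; split; apply: measurable_funB.
  - by apply: measurableT_comp measurable_fst _; exact: measurable_snd.
  - by apply: measurableT_comp measurable_fst _; exact: measurable_fst.
  - by apply: measurableT_comp measurable_snd _; exact: measurable_snd.
  - by apply: measurableT_comp measurable_snd _; exact: measurable_fst.
rewrite (_ : (fun w => _) = (fun u => normc (cx u)) \o d); first exact: measurableT_comp.
by apply/funext => -[[x y] [x' y']]; rewrite /d /cx /=; congr normc;
  apply/eqP; rewrite eq_complex /=; apply/andP; split; apply/eqP; ring.
Qed.

(** Normalised by (1 - |a|) ^ 2, which is comparable to the area of the disc. *)
Definition disc_average (rho : R) (phi : C -> R) (a : C) : \bar R :=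
  area_int (fun z => (disc_kernel rho a z * phi z)%:E).

Lemma disc_average_ge0 rho phi a : (forall z, 0 <= phi z) -> (0 <= disc_average rho phi a)%E.
Proof. by move=> phi0; apply: area_int_ge0 => z; rewrite lee_fin mulr_ge0 ?disc_kernel_ge0. Qed.

Lemma mC_disc_average rho (phi : C -> R) : mC phi -> (forall z, 0 <= phi z) -> mC (disc_average rho phi).
Proof.
move=> mphi phi0; apply: (@measurable_fun_fubini_tonelli_F _ _ _ _ R (@dAs R) _ (measurable_disc_kernel rho mphi)).
by move=> w; rewrite lee_fin mulr_ge0 ?disc_kernel_ge0.
Qed.

Lemma disc_averageE rho (phi : C -> R) a : normc a < 1 -> mC phi -> (forall z, 0 <= phi z) ->
  disc_average rho phi a = (((1 - normc a) ^+ 2)^-1%:E *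
    area_int (fun z => (disk a (rho * (1 - normc a)) z * phi z)%:E))%E.
Proof.
move=> a1 mphi phi0; have h0 : 0 < 1 - normc a by rewrite subr_gt0.
rewrite -area_intZr ?invr_ge0 ?exprn_ge0 ?(ltW h0) //; last 2 first.
- by apply: mCM => //; exact: measurable_disk.
- by move=> z; rewrite mulr_ge0 ?disk_ge0.
congr area_int; apply/funext => z; rewrite /disc_kernel /disk subr0 a1 mul1r powRN powR_mulrn ?(ltW h0) //.
by rewrite mulrA.
Qed.

(** By Tonelli: the points a whose disc contains z lie in a disc about z of comparable radius. *)
Lemma disc_average_area (rho : R) : 0 < rho < 1 -> exists2 K : R, 0 < K & forall phi : C -> R,
  mC phi -> (forall z, 0 <= phi z) ->
  (area_int (disc_average rho phi) <= K%:E * area_int (fun z => (disk 0 1 z * phi z)%:E))%E.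
Proof.
move=> /andP[r0 r1]; have d0 : 0 < 1 - rho by rewrite subr_gt0.
pose q := rho / (1 - rho); have q0 : 0 < q by rewrite divr_gt0.
have c16 : 0 < 16 * q ^+ 2 by rewrite mulr_gt0 // exprn_gt0.
exists (16 * q ^+ 2) => //.
move=> phi mphi phi0.
rewrite (@area_int_swap R (fun a z => (disc_kernel rho a z * phi z)%:E)); last 2 first.
- exact: measurable_disc_kernel.
- by move=> a z; rewrite lee_fin mulr_ge0 ?disc_kernel_ge0.
rewrite -area_intZr ?(ltW c16) //; last 2 first.
- by apply: mCM => //; exact: measurable_disk.
- by move=> z; rewrite mulr_ge0 ?disk_ge0.
apply: area_int_le => z; first by apply: area_int_ge0 => a; rewrite lee_fin mulr_ge0 ?disc_kernel_ge0.
have key a : disc_kernel rho a z != 0 -> [/\ normc z < 1, (1 - normc a) `^ (- 2) <= 4 * ((1 - normc z) ^+ 2)^-1 &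
    normc (a - z) < q * (1 - normc z)].
  rewrite /disc_kernel /disk subr0; case: (ltP (normc a) 1) => a1; last by rewrite !mul0r eqxx.
  case: (ltP (normc (z - a))) => za; last by rewrite mulr0 eqxx.
  move=> _; have h0 : 0 < 1 - normc a by rewrite subr_gt0.
  have b1 := normc_dist z a; have b2 := normc_dist a z; rewrite normc_distC in b2.
  have k1 : (1 - rho) * (1 - normc a) <= 1 - normc z by move: b1 za; clear; lra.
  have k2 : 1 - normc z <= 2 * (1 - normc a) by move: b2 za h0 r1; clear; nra.
  have k0 : 0 < 1 - normc z by rewrite (lt_le_trans _ k1) // mulr_gt0.
  split; first by rewrite -subr_gt0.
    rewrite powRN powR_mulrn ?(ltW h0) // ler_pdivlMr ?exprn_gt0 // mulrC ler_pdivrMr ?exprn_gt0 //.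
    by move: k2 k0 h0; clear; nra.
  rewrite normc_distC (lt_le_trans za) // /q mulrAC ler_pdivlMr // -mulrA ler_pM2l //.
  by rewrite mulrC.
have [z1|z1] := ltP (normc z) 1; last first.
  have -> : area_int (fun a => (disc_kernel rho a z * phi z)%:E) = 0%E; last first.
    by rewrite lee_fin mulr_ge0 ?(ltW c16) // mulr_ge0 ?disk_ge0.
  apply: integral0_eq => u _; have [->|/key[]] := eqVneq (disc_kernel rho (cx u) z) 0; first by rewrite mul0r.
  by rewrite ltNge z1.
have k0 : 0 < 1 - normc z by rewrite subr_gt0.
have qk0 : 0 < q * (1 - normc z) by rewrite mulr_gt0.
have [E /andP[_ A2]] := darea_fin qk0.
have c0 : 0 <= 4 * ((1 - normc z) ^+ 2)^-1 * phi z.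
  by rewrite !mulr_ge0 // invr_ge0 exprn_ge0 // ltW.
apply: (@le_trans _ _ ((4 * ((1 - normc z) ^+ 2)^-1 * phi z)%:E * darea (q * (1 - normc z)))%E).
  rewrite -(darea_shift z) -(area_intZr c0 (@measurable_disk R z _) (@disk_ge0 R z _)).
  apply: area_int_ler => a; first by rewrite mulr_ge0 ?disc_kernel_ge0.
  have [->|h] := eqVneq (disc_kernel rho a z) 0; first by rewrite mul0r mulr_ge0 ?disk_ge0.
  have [_ h1 h2] := key a h; rewrite [disk z _ a]/disk h2 mulr1.
  rewrite ler_wpM2r //; apply: le_trans h1.
  by rewrite /disc_kernel mulrAC mulrC ler_piMr ?powR_ge0 // mulr_ile1 ?disk_ge0 ?disk_le1.
rewrite E -EFinM lee_fin /disk subr0 z1 mul1r.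
apply: (le_trans (ler_wpM2l c0 A2)).
by apply: le_of_eq; field; rewrite gt_eqF.
Qed.

End disc_averages.

(** * Sufficiency: norms over relatively dense sets *)

Section relatively_dense_sets.
Variable R : realType.
Local Open Scope complex_scope.
Notation C := R[i].

Lemma mC_disk_norm_pow (F : C -> C) a (p r : R) : 0 < p -> holo 1 F -> normc a + r <= 1 ->
  mC (fun z => disk a r z * normc (F z) `^ p).
Proof.
move=> p0 Fh ar; rewrite (_ : (fun z => _) = (fun z => disk a r z * (disk 0 1 z * normc (F z) `^ p))).
  apply: mCM; first exact: measurable_disk.
  apply: mC_disk_powR => //; first by move=> z; exact: normc_ge0.
  by apply: measurable_disk_holo => // [u v|u]; [exact: normc_dist_le|exact: normc_ge0].
apply/funext => z; rewrite {1 2}/disk; case: ltP => za; last by rewrite !mul0r.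
have z1 : normc z < 1 by have := normc_dist z a; move: za ar; clear; lra.
by rewrite /disk subr0 z1 !mul1r.
Qed.

(** A dichotomy: either |F a| ^ p is small against the mean of |F| ^ p over the disc, or by
    [small_values] the set where F is small against F a is too small to exhaust the dense set. *)
Lemma dense_point (p rho eta tau : R) : 1 <= p -> 0 < rho < 1 -> 0 < eta -> 0 < tau ->
  exists2 K : R, 0 < K & forall (F : C -> C) (b : C -> bool) a, holo 1 F -> mC (fun z => (b z)%:R : R) ->
  normc a < 1 ->
  ((eta * (1 - normc a) ^+ 2)%:E <=
      area_int (fun z => (disk a (rho * (1 - normc a)) z * (b z)%:R)%:E))%E ->
  ((normc (F a) `^ p * (1 - normc a) ^+ 2)%:E <=
    tau%:E * area_int (fun z => (disk a (rho * (1 - normc a)) z * normc (F z) `^ p)%:E) +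
    K%:E * area_int (fun z => (disk a (rho * (1 - normc a)) z * ((b z)%:R * normc (F z) `^ p))%:E))%E.
Proof.
move=> p1 /andP[r0 r1] e0 t0; have p0 : 0 < p by rewrite (lt_le_trans ltr01).
pose M := (tau * rho ^+ 2)^-1; have M0 : 0 < M by rewrite invr_gt0 mulr_gt0 // exprn_gt0.
pose L := 8 * (1 + M) / eta; have L0 : 0 < L by rewrite divr_gt0 // mulr_gt0 // addr_gt0.
pose lam := expR (- (L + ln 2)).
have ln20 : 0 <= ln 2 :> R by rewrite ln_ge0 // ler1n.
have lam0 : 0 < lam by exact: expR_gt0.
have lam1 : lam <= 1 by rewrite -expR0 ler_expR oppr_le0 addr_ge0 // ltW.
have lamL : - ln lam - ln 2 = L by rewrite /lam expRK opprK addrK.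
have lp0 : 0 < lam `^ p by exact: powR_gt0.
have K0 : 0 < 2 / (eta * lam `^ p) by rewrite divr_gt0 // mulr_gt0.
exists (2 / (eta * lam `^ p)) => // F b a Fh mb a1 Hd.
have h0 : 0 < 1 - normc a by rewrite subr_gt0.
set h := 1 - normc a in h0 Hd *.
set r := rho * h; have rr0 : 0 < r by rewrite mulr_gt0.
have ar : normc a + r <= 1 by rewrite /r /h; move: r1 h0; rewrite /h; clear; nra.
set X := area_int (fun z => (disk a r z * normc (F z) `^ p)%:E).
set Y := area_int (fun z => (disk a r z * ((b z)%:R * _))%:E).
have X0 : (0 <= X)%E by apply: area_int_ge0 => z; rewrite lee_fin mulr_ge0 ?disk_ge0 ?powR_ge0.
have Y0 : (0 <= Y)%E by apply: area_int_ge0 => z; rewrite lee_fin !mulr_ge0 ?disk_ge0 ?powR_ge0 ?ler0n.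
have tX0 : (0 <= tau%:E * X)%E by rewrite mule_ge0 // lee_fin ltW.
have KY0 : (0 <= (2 / (eta * lam `^ p))%:E * Y)%E by rewrite mule_ge0 // lee_fin ltW.
have [Fa|Fa] := eqVneq (F a) 0.
  rewrite Fa normc0 powR0 ?gt_eqF // mul0r; exact: adde_ge0.
have nF : 0 < normc (F a) by rewrite normc_gt0.
have [E /andP[A1 A2]] := darea_fin rr0; set A := fine _ in E A1 A2.
have [XM|XM] := leP X ((M * normc (F a) `^ p)%:E * darea r)%E; last first.
  apply: (@le_trans _ _ (tau%:E * X)%E); last by rewrite leeDl.
  apply: le_trans (lee_wpmul2l _ (ltW XM)); last by rewrite lee_fin ltW.
  rewrite E -!EFinM lee_fin.
  have -> : tau * (M * normc (F a) `^ p * A) = normc (F a) `^ p * (A / rho ^+ 2).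
    by rewrite /M; field; rewrite !gt_eqF.
  rewrite ler_wpM2l ?powR_ge0 // ler_pdivlMr ?exprn_gt0 //; apply: le_trans A1.
  by rewrite /r exprMn mulrC.
have := small_values p1 Fh rr0 ar lam0 lam1 Fa XM; rewrite lamL E -EFinM.
pose s z : bool := normc (F z) < lam * normc (F a).
set Z := area_int _ => HZ.
have mD : mC (fun z => disk a r z * normc (F z)).
  have := mC_disk_norm_pow ltr01 Fh ar; congr mC; apply/funext => z.
  by rewrite powRr1 ?normc_ge0.
have c0 : 0 < lam * normc (F a) by rewrite mulr_gt0.
have ms : mC (fun z => disk a r z * (s z)%:R : R).
  have m' : mC (fun z => (disk a r z * normc (F z) < lam * normc (F a))%R%:R : R).
    apply: (@measurable_bool_real R _ (R * R)%type); apply: measurable_fun_ltr.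
      exact: mD.
    exact: measurable_cst.
  have := mCM (@measurable_disk R a r) m'; congr mC; apply/funext => z.
  by rewrite /s /disk; case: ltP => _; rewrite ?mul1r ?mul0r.
have D0 z := @disk_ge0 R a r z.
have mW : mC (fun z => disk a r z * ((b z)%:R * normc (F z) `^ p)).
  have := mCM mb (mC_disk_norm_pow p0 Fh ar); congr mC; apply/funext => z.
  by rewrite mulrCA.
have q0 : 0 < lam `^ p * normc (F a) `^ p by rewrite mulr_gt0 // powR_gt0.
have H1 : (area_int (fun z => (disk a r z * (b z)%:R)%:E) <=
    Z + ((lam `^ p * normc (F a) `^ p)^-1)%:E * Y)%E.
  rewrite -area_intZr ?invr_ge0 ?(ltW q0) //; last first.
    by move=> z; rewrite !mulr_ge0 ?powR_ge0 ?ler0n.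
  rewrite -area_intDr //; last 3 first.
  - exact: mCZ.
  - by move=> z; rewrite mulr_ge0 ?ler0n.
  - by move=> z; rewrite mulr_ge0 ?invr_ge0 ?(ltW q0) // !mulr_ge0 ?powR_ge0 ?ler0n.
  apply: area_int_ler => z; first by rewrite mulr_ge0 ?ler0n.
  rewrite mulrCA -mulrDr ler_wpM2l //; case: (b z); last first.
    by rewrite addr_ge0 ?ler0n // !mul0r mulr0.
  rewrite mul1r /s; case: ltP => hs.
    by rewrite lerDl mulr_ge0 ?invr_ge0 ?(ltW q0) ?powR_ge0.
  rewrite add0r mulrC ler_pdivlMr // mul1r -powRM ?(ltW lam0) ?(ltW nF) //.
  by apply: ge0_ler_powR; rewrite ?nnegrE ?(ltW p0) ?(ltW c0) ?normc_ge0.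
have Z0 : (0 <= Z)%E by apply: area_int_ge0 => z; rewrite lee_fin mulr_ge0 ?ler0n.
have HZ2 : (Z <= (eta / 2 * h ^+ 2)%:E)%E.
  move: HZ Z0; case: (Z) => [x| |] //.
    rewrite -EFinM !lee_fin => HZ _; rewrite -(ler_pM2l L0); apply: (le_trans HZ).
    have M1 : 0 < 1 + M by rewrite addr_gt0.
    have -> : L * (eta / 2 * h ^+ 2) = (1 + M) * (4 * h ^+ 2) by rewrite /L; field; rewrite gt_eqF.
    rewrite ler_pM2l //; apply: (le_trans A2); rewrite ler_pM2l // /r exprMn.
    by rewrite ler_piMl ?sqr_ge0 // expr_le1 ?(ltW r0) // ltW.
  by rewrite gt0_muley // lte_fin.
have := le_trans Hd (le_trans H1 (leeD HZ2 (lexx _))).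
case: (Y) Y0 KY0 => [y| |] //; last first.
  move=> _ _ _; rewrite (@gt0_muley _ (2 / (eta * lam `^ p))%:E) ?lte_fin //.
  by rewrite addey ?leey // gt_eqF // (lt_le_trans _ tX0).
rewrite -!EFinM -EFinD !lee_fin => y0 KY0 HF.
apply: (@le_trans _ _ (2 / (eta * lam `^ p) * y)%:E); last by rewrite leeDr.
rewrite lee_fin; set v := normc (F a) `^ p in q0 HF *.
have v0 : 0 < v by exact: powR_gt0.
have : eta / 2 * h ^+ 2 <= (lam `^ p * v)^-1 * y by move: HF; clear; lra.
rewrite [X in _ <= X]mulrC ler_pdivlMr // => HF2.
rewrite mulrAC ler_pdivlMr ?mulr_gt0 //.
by move: HF2; clear; lra.
Qed.

End relatively_dense_sets.

Section dense_sets_and_norms.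
Variable R : realType.
Local Open Scope complex_scope.
Notation C := R[i].

Lemma mC_disk_weight (p al : R) (F : C -> C) (b : C -> R) : 0 < p -> holo 1 F -> mC b ->
  mC (fun z => disk 0 1 z * (b z * (normc (F z) `^ p * weight al z))).
Proof.
move=> p0 Fh mb; have := mCM mb (mC_disk_norm_weight al p0 Fh); congr mC; apply/funext => z.
by rewrite mulrCA.
Qed.

Lemma weight_in_disc (al rho K : R) (a : C) (psi : C -> R) : 0 <= K ->
  (forall z, normc (z - a) < rho -> normc z < 1 /\ weight al a <= K * weight al z) ->
  (forall z, 0 <= psi z) -> mC (fun z => disk a rho z * psi z) ->
  mC (fun z => disk 0 1 z * (psi z * weight al z)) ->
  ((weight al a)%:E * area_int (fun z => (disk a rho z * psi z)%:E) <=
   K%:E * area_int (fun z => (disk a rho z * (disk 0 1 z * (psi z * weight al z)))%:E))%E.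
Proof.
move=> K0 H psi0 m1 m2.
have p1 z : 0 <= disk a rho z * psi z by rewrite mulr_ge0 ?disk_ge0.
have p2 z : 0 <= disk a rho z * (disk 0 1 z * (psi z * weight al z)).
  by rewrite !mulr_ge0 ?disk_ge0 ?weight_ge0.
rewrite -(area_intZr (weight_ge0 al a) m1 p1).
rewrite -(area_intZr K0 (mCM (@measurable_disk R a rho) m2) p2).
apply: area_int_ler => z; first by rewrite mulr_ge0 ?weight_ge0.
rewrite {1 2}/disk; case: ltP => za; last by rewrite !mul0r !mulr0.
have [z1 W] := H z za; rewrite /disk subr0 z1 !mul1r.
by rewrite mulrC mulrCA ler_wpM2l.
Qed.

Lemma diskK (z : C) (x : R) : disk 0 1 z * (disk 0 1 z * x) = disk 0 1 z * x.
Proof. by rewrite /disk; case: (_ < _); rewrite ?mul1r ?mul0r. Qed.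

(** Integrate [dense_point] over a. For tau small the first term is absorbed by the left-hand
    side, which is finite. *)
Lemma dense_sets_norm (p al rho eta : R) : 1 <= p -> 0 < rho < 1 -> 0 < eta ->
  exists2 K : R, 0 < K & forall (F : C -> C) (b : C -> bool), holo 1 F -> mC (fun z => (b z)%:R : R) ->
  (forall a, normc a < 1 -> ((eta * (1 - normc a) ^+ 2)%:E <=
      area_int (fun z => (disk a (rho * (1 - normc a)) z * (b z)%:R)%:E))%E) ->
  (bergman_int p al F < +oo)%E ->
  (bergman_int p al F <= K%:E * area_int (fun z => (disk 0 1 z * ((b z)%:R * (normc (F z) `^ p * weight al z)))%:E))%E.
Proof.
move=> p1 r01 e0; have p0 : 0 < p by rewrite (lt_le_trans ltr01).
have [|Kw Kw0 HKw] := @weight_disc R al rho; first by have /andP[r0 ->] := r01; rewrite ltW.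
have [Ko Ko0 HKo] := disc_average_area r01.
pose tau := (2 * Kw * Ko)^-1; have t0 : 0 < tau by rewrite invr_gt0 !mulr_gt0.
have [Kd Kd0 HKd] := dense_point p1 r01 e0 t0.
have K20 : 0 < Kd * Kw * Ko by rewrite !mulr_gt0.
exists (2 * (Kd * Kw * Ko)); first by rewrite mulr_gt0.
move=> F b Fh mb Hd fin.
pose phi1 z := disk 0 1 z * (normc (F z) `^ p * weight al z).
pose phi2 z := disk 0 1 z * ((b z)%:R * (normc (F z) `^ p * weight al z)).
have m1 : mC phi1 by exact: mC_disk_norm_weight.
have m2 : mC phi2 by exact: mC_disk_weight.
have f10 z : 0 <= phi1 z by rewrite !mulr_ge0 ?disk_ge0 ?powR_ge0.
have f20 z : 0 <= phi2 z by rewrite !mulr_ge0 ?disk_ge0 ?powR_ge0 ?ler0n.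
have point a : ((phi1 a)%:E <= (tau * Kw)%:E * disc_average rho phi1 a + (Kd * Kw)%:E * disc_average rho phi2 a)%E.
  have tK0 : (0 <= (tau * Kw)%:E)%E by rewrite lee_fin ltW // mulr_gt0.
  have dK0 : (0 <= (Kd * Kw)%:E)%E by rewrite lee_fin ltW // mulr_gt0.
  have [a1|a1] := ltP (normc a) 1; last first.
    rewrite {1}/phi1 {1}/disk subr0 (le_gtF a1) mul0r.
    by rewrite adde_ge0 // mule_ge0 // disc_average_ge0.
  have h0 : 0 < 1 - normc a by rewrite subr_gt0.
  have ar : normc a + rho * (1 - normc a) <= 1.
    by have /andP[r0 r1] := r01; move: r0 r1 h0; clear; nra.
  rewrite !disc_averageE //.
  have HH z : normc (z - a) < rho * (1 - normc a) -> normc z < 1 /\ weight al a <= Kw * weight al z.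
    by move=> za; have [? ? _] := HKw a z a1 za.
  have W1 := weight_in_disc (psi := fun z => normc (F z) `^ p) (ltW Kw0) HH (fun z => powR_ge0 _ _)
    (mC_disk_norm_pow p0 Fh ar) m1.
  have mb1 : mC (fun z => disk a (rho * (1 - normc a)) z * ((b z)%:R * normc (F z) `^ p)).
    have := mCM mb (mC_disk_norm_pow p0 Fh ar); congr mC; apply/funext => z.
    by rewrite mulrCA.
  have E2 : phi2 = fun z => disk 0 1 z * ((b z)%:R * normc (F z) `^ p * weight al z).
    by apply/funext => z; rewrite /phi2 -[_ * _ * weight _ _]mulrA.
  have W2 : ((weight al a)%:E * area_int (fun z => (disk a (rho * (1 - normc a)) z * ((b z)%:R * normc (F z) `^ p))%:E) <=
     Kw%:E * area_int (fun z => (disk a (rho * (1 - normc a)) z * phi2 z)%:E))%E.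
    rewrite E2; apply: weight_in_disc HH _ mb1 _; first exact: ltW.
      by move=> z; rewrite mulr_ge0 ?ler0n ?powR_ge0.
    by rewrite -E2.
  have HP := HKd F b a Fh mb a1 (Hd a a1).
  have h2 : 0 < (1 - normc a) ^+ 2 by rewrite exprn_gt0.
  have hw0 : (0 <= ((1 - normc a) ^+ 2)^-1%:E)%E by rewrite lee_fin invr_ge0 ltW.
  have -> : phi1 a = ((1 - normc a) ^+ 2)^-1 * (weight al a * (normc (F a) `^ p * (1 - normc a) ^+ 2)).
    by rewrite /phi1 /disk subr0 a1 mul1r; field; rewrite gt_eqF.
  have W0 : (0 <= (weight al a)%:E)%E by rewrite lee_fin weight_ge0.
  have HP2 := lee_wpmul2l W0 HP.
  rewrite [((_ ^+ 2)^-1 * _)%:E]EFinM [(weight al a * _)%:E]EFinM.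
  apply: (le_trans (lee_wpmul2l hw0 HP2)).
  set X := area_int _ in W1 *; set Y := area_int (fun z => (_ * ((b z)%:R * _))%:E) in W2 *.
  set X' := area_int _ in W1 *; set Y' := area_int (fun z => (_ * phi2 z)%:E) in W2 *.
  have Xp : (0 <= X)%E by apply: area_int_ge0 => z; rewrite lee_fin mulr_ge0 ?disk_ge0 ?powR_ge0.
  have Yp : (0 <= Y)%E by apply: area_int_ge0 => z; rewrite lee_fin !mulr_ge0 ?disk_ge0 ?powR_ge0 ?ler0n.
  have tp : (0 <= tau%:E)%E by rewrite lee_fin ltW.
  have kp : (0 <= Kd%:E)%E by rewrite lee_fin ltW.
  rewrite [((weight al a)%:E * _)%E]ge0_muleDr ?mule_ge0 // ge0_muleDr ?mule_ge0 //.
  have step (k : R) (U V : \bar R) : (0 <= k%:E)%E -> ((weight al a)%:E * U <= Kw%:E * V)%E ->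
     (((1 - normc a) ^+ 2)^-1%:E * ((weight al a)%:E * (k%:E * U)) <=
      (k * Kw)%:E * (((1 - normc a) ^+ 2)^-1%:E * V))%E.
    move=> k0 UV; rewrite [((weight al a)%:E * _)%E]muleCA [leLHS]muleCA EFinM -muleA.
    apply: lee_wpmul2l => //; rewrite [leRHS]muleCA; exact: lee_wpmul2l.
  by apply: leeD; apply: step.
have d10 a : (0 <= disc_average rho phi1 a)%E by exact: disc_average_ge0.
have d20 a : (0 <= disc_average rho phi2 a)%E by exact: disc_average_ge0.
have tK0 : 0 <= tau * Kw by rewrite ltW // mulr_gt0.
have dK0 : 0 <= Kd * Kw by rewrite ltW // mulr_gt0.
have H1 : (bergman_int p al F <= (tau * Kw)%:E * area_int (disc_average rho phi1) + (Kd * Kw)%:E * area_int (disc_average rho phi2))%E.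
  have md1 := mC_disc_average rho m1 f10; have md2 := mC_disc_average rho m2 f20.
  rewrite -(area_intZ tK0 md1 d10) -(area_intZ dK0 md2 d20) -area_intD.
  - by apply: area_int_le => z; [rewrite lee_fin; exact: f10|exact: point].
  - by apply: emeasurable_funM => //; exact: measurable_cst.
  - by apply: emeasurable_funM => //; exact: measurable_cst.
  - by move=> z; rewrite mule_ge0.
  - by move=> z; rewrite mule_ge0.
have HO1 := HKo phi1 m1 f10; have HO2 := HKo phi2 m2 f20.
have E1 : area_int (fun z => (disk 0 1 z * phi1 z)%:E) = bergman_int p al F.
  by congr area_int; apply/funext => z; rewrite /phi1 diskK.
have E2 : area_int (fun z => (disk 0 1 z * phi2 z)%:E) = area_int (fun z => (phi2 z)%:E).
  by congr area_int; apply/funext => z; rewrite /phi2 diskK.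
rewrite E1 in HO1; rewrite E2 in HO2.
have tK0' : (0 <= (tau * Kw)%:E)%E by rewrite lee_fin.
have dK0' : (0 <= (Kd * Kw)%:E)%E by rewrite lee_fin.
have := le_trans H1 (leeD (lee_wpmul2l tK0' HO1) (lee_wpmul2l dK0' HO2)).
rewrite -/phi2; set Z := area_int (fun z => (phi2 z)%:E).
have Z0 : (0 <= Z)%E by apply: area_int_ge0 => z; rewrite lee_fin.
have := bergman_int_ge0 p al F; move: fin; case: (bergman_int p al F) => // x _ x0.
case: (Z) Z0 => [z| |] // z0; last by move=> _; rewrite gt0_muley ?leey // lte_fin mulr_gt0.
rewrite -!EFinM -EFinD !lee_fin.
have -> : tau * Kw * (Ko * x) = x / 2 by rewrite /tau; field; rewrite !gt_eqF.
have -> : Kd * Kw * (Ko * z) = Kd * Kw * Ko * z by ring.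
by move: (Kd * Kw * Ko) => k; clear; lra.
Qed.

(** The weighted Cauchy estimate at a, integrated over a. *)
Lemma derivative_norm (p al : R) : 1 <= p -> exists2 K : R, 0 < K &
  forall (F F1 : C -> C), holo 1 F -> (forall z, normc z < 1 -> cdiff F z (F1 z)) ->
  (area_int (fun z => (disk 0 1 z * ((normc (F1 z) * (1 - normc z)) `^ p * weight al z))%:E) <=
   K%:E * bergman_int p al F)%E.
Proof.
move=> p1; have p0 : 0 < p by rewrite (lt_le_trans ltr01).
have [Kv Kv0 HKv] := deriv_weighted al p1.
have [|Ko Ko0 HKo] := @disc_average_area R 2^-1; first by rewrite invr_gt0 ltr0n invf_lt1 // ltr1n.
exists (Kv * Ko); first by rewrite mulr_gt0.
move=> F F1 Fh Fd; pose phi z := disk 0 1 z * (normc (F z) `^ p * weight al z).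
have mphi : mC phi by exact: mC_disk_norm_weight.
have phi0 z : 0 <= phi z by rewrite !mulr_ge0 ?disk_ge0 ?powR_ge0.
have E : area_int (fun z => (disk 0 1 z * phi z)%:E) = bergman_int p al F.
  by congr area_int; apply/funext => z; rewrite /phi diskK.
have := HKo phi mphi phi0; rewrite E => HO.
have Kv0' : (0 <= Kv%:E)%E by rewrite lee_fin ltW.
rewrite EFinM -muleA; apply: le_trans (lee_wpmul2l Kv0' HO).
rewrite -(area_intZ (ltW Kv0) (mC_disc_average _ mphi phi0)); last by move=> a; exact: disc_average_ge0.
apply: area_int_le => a; first by rewrite lee_fin !mulr_ge0 ?disk_ge0 ?powR_ge0.
have [a1|a1] := ltP (normc a) 1; last first.
  by rewrite {1}/disk subr0 (le_gtF a1) mul0r mule_ge0 // disc_average_ge0.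
rewrite disc_averageE // muleCA.
have h0 : 0 < 1 - normc a by rewrite subr_gt0.
have hw0 : (0 <= ((1 - normc a) ^+ 2)^-1%:E)%E by rewrite lee_fin invr_ge0 exprn_ge0 // ltW.
apply: le_trans (lee_wpmul2l hw0 (HKv F a _ Fh a1 (Fd a a1))).
rewrite -EFinM lee_fin /disk subr0 a1 mul1r.
by apply: le_of_eq; field; rewrite gt_eqF.
Qed.

(** On the dense set |g'| (1 - |z|) >= c / 2, so there |f| is at most 2 / c times
    |f g'| (1 - |z|), and f g' is the derivative of T_g f. *)
Lemma bounded_below_of_boxes (p al : R) (g : R[i]^o -> R[i]^o) (c delta : R) : 1 <= p -> -1 < al ->
  analytic_on_disk g ->
  bounded_operator (bergman_space p al) (bergman_norm p al) (T_ g) -> 0 < c -> 0 < delta ->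
  (forall (I : set R[i]^o) (l : R), is_arc I l ->
      ((delta * l ^+ 2)%:E <
       area (coords ([set z : R[i]^o | unit_disk z /\
                       (c < normc (g^`()%classic z) * (1 - normc z ^+ 2))%R]
                     `&` carleson_box I l)))%E) ->
  bounded_below (bergman_space p al) (bergman_norm p al) (T_ g).
Proof.
move=> p1 al1 ga hT c0 d0 Hbox; have p0 : 0 < p by rewrite (lt_le_trans ltr01).
have [rho [eta [r01 e0 Hdisc]]] := discs_of_boxes ga c0 d0 Hbox.
have [K1 K10 HK1] := @dense_sets_norm p al rho eta p1 r01 e0.
have [K2 K20 HK2] := derivative_norm al p1.
have c20 : 0 < (2 / c) `^ p by rewrite powR_gt0 // divr_gt0.
apply/(below_integral p0 hT.1); exists (K1 * ((2 / c) `^ p * K2)); first by rewrite !mulr_gt0.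
move=> f fX; have [fa [x x0 fx]] := (bergman_spaceP al f p0).1 fX.
have [Ta _] := hT.1 f fX.
have fin : (bergman_int p al f < +oo)%E by rewrite fx ltry.
have K10' : (0 <= K1%:E)%E by rewrite lee_fin ltW.
have c20' : (0 <= ((2 / c) `^ p)%:E)%E by rewrite lee_fin ltW.
apply: (le_trans (HK1 f (fun z => c < bloch_fun g z) (analytic_holo fa) (mC_bloch_fun_gt c ga) Hdisc fin)).
rewrite EFinM -muleA; apply: lee_wpmul2l => //.
pose F1 z := f z * g^`()%classic z.
have Td z : normc z < 1 -> cdiff (T_ g f) z (F1 z).
  by move=> z1; apply: T_derivative => // w w1; exact: product_cont.
rewrite EFinM -muleA; apply: le_trans (lee_wpmul2l c20' (HK2 (T_ g f) F1 (analytic_holo Ta) Td)).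
have XE z : disk 0 1 z * ((normc (F1 z) * (1 - normc z)) `^ p * weight al z) =
    (disk 0 1 z * normc (F1 z) * (1 - normc z)) `^ p * weight al z.
  rewrite /disk subr0; case: (ltP (normc z) 1) => z1; first by rewrite !mul1r.
  by rewrite !mul0r powR0 ?mul0r // gt_eqF.
have mX : mC (fun z => disk 0 1 z * ((normc (F1 z) * (1 - normc z)) `^ p * weight al z)).
  rewrite (funext XE); apply: mCM; last exact: mC_weight.
  apply: mCp; apply: mCM; first by apply: mC_disk_ccont => w w1; exact: product_cont.
  by apply: measurable_funB; [exact: measurable_cst|exact: measurable_normc].
have X0 z : 0 <= disk 0 1 z * ((normc (F1 z) * (1 - normc z)) `^ p * weight al z).
  by rewrite !mulr_ge0 ?disk_ge0 ?powR_ge0.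
rewrite -(area_intZr (ltW c20) mX X0).
apply: area_int_ler => z; first by rewrite !mulr_ge0 ?disk_ge0 ?powR_ge0 ?ler0n.
rewrite [leRHS]mulrCA ler_wpM2l ?disk_ge0 // mulrA.
have [|_] := boolP (c < bloch_fun g z); last first.
  by rewrite !mul0r !mulr_ge0 ?powR_ge0.
rewrite bloch_fun_gt ?(ltW c0) // => /andP[z1 gz]; rewrite mul1r !mulrA.
have h0 : 0 < 1 - normc z by rewrite subr_gt0.
rewrite ler_wpM2r ?weight_ge0 // /F1 normcM.
have cc : 0 <= 2 / c by rewrite divr_ge0 // ltW.
have m0 : 0 <= normc (f z) * normc (g^`()%classic z) * (1 - normc z).
  by rewrite !mulr_ge0 ?normc_ge0 // ltW.
rewrite -powRM //; apply: ge0_ler_powR; rewrite ?nnegrE ?(ltW p0) ?normc_ge0 //.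
  by rewrite mulr_ge0.
have g0 := normc_ge0 (g^`()%classic z).
have c2 : c <= 2 * (normc (g^`()%classic z) * (1 - normc z)).
  apply: (le_trans (ltW gz)); rewrite -subr_ge0.
  have -> : 2 * (normc (g^`()%classic z) * (1 - normc z)) - normc (g^`()%classic z) * (1 - normc z ^+ 2) =
    normc (g^`()%classic z) * (1 - normc z) ^+ 2 by ring.
  by rewrite mulr_ge0 ?sqr_ge0.
have -> : 2 / c * (normc (f z) * normc (g^`()%classic z) * (1 - normc z)) =
  normc (f z) * (2 * (normc (g^`()%classic z) * (1 - normc z)) / c) by ring.
by rewrite ler_peMr ?normc_ge0 // ler_pdivlMr // mul1r.
Qed.

End dense_sets_and_norms.

Theorem theorem3p4 (R : realType) (p alpha : R) (g : R[i]^o -> R[i]^o)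
  (hp : 1 <= p) (halpha : -1 < alpha)
  (hg : analytic_on_disk g)
  (hT : bounded_operator (bergman_space p alpha) (bergman_norm p alpha) (T_ g)) :
  bounded_below (bergman_space p alpha) (bergman_norm p alpha) (T_ g) <->
  exists c delta : R, [/\ 0 < c, 0 < delta &
    forall (I : set R[i]^o) (l : R), is_arc I l ->
      ((delta * l ^+ 2)%:E <
       area (coords ([set z : R[i]^o | unit_disk z /\
                       (c < normc (g^`()%classic z) * (1 - normc z ^+ 2))%R]
                     `&` carleson_box I l)))%E].
Proof.
split; first exact: boxes_of_bounded_below.
by move=> [c [delta [c0 d0 H]]]; exact: (bounded_below_of_boxes hp halpha hg hT c0 d0 H).
Qed.
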